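(* Let $X,Y$ and $Z$ be sets of size $n$, let $A\subset X\times Y$, and let $\phi:A\to Z$ be such that $(X,Y,Z,A,\phi)$ is a partial Latin square with at least $\epsilon n^5$ octahedra. Then there is a subset $B\subset A$ of size at least $\alpha n^2$, where $\alpha=\alpha(\epsilon)>0$ depends only on $\epsilon$, such that the partial Latin square $(X,Y,Z,B,\phi|_B)$ satisfies the quadrangle condition.
   Context: A partial Latin square is $(X,Y,Z,A,\phi)$ with $A\subset X\times Y$ and $\phi:A\to Z$ injective in each variable separately ($\phi(a,b_1)=\phi(a,b_2)\Rightarrow b_1=b_2$, $\phi(a_1,b)=\phi(a_2,b)\Rightarrow a_1=a_2$). An octahedron is a tuple $(x_1,x_2,y_1,y_2,x_3,x_4,y_3,y_4)$ with all eight cells $(x_i,y_j)$, $i,j\in\{1,2\}$, and $(x_i,y_j)$, $i,j\in\{3,4\}$, in $A$ and $\phi(x_1,y_1)=\phi(x_3,y_3)$, $\phi(x_2,y_1)=\phi(x_4,y_3)$, $\phi(x_1,y_2)=\phi(x_3,y_4)$, $\phi(x_2,y_2)=\phi(x_4,y_4)$ (degeneracies allowed). A partial Latin square with cell set $B$ and labelling $\phi$ satisfies: the label quadrangle condition if there are no $x_1,x_2,x_3,x_4\in X$, $y_1,y_2,y_3,y_4\in Y$ with all cells $(x_1,y_1),(x_2,y_1),(x_1,y_2),(x_2,y_2),(x_3,y_3),(x_4,y_3),(x_3,y_4),(x_4,y_4)$ in $B$, $\phi(x_1,y_1)=\phi(x_3,y_3)$, $\phi(x_2,y_1)=\phi(x_4,y_3)$,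 $\phi(x_1,y_2)=\phi(x_3,y_4)$ but $\phi(x_2,y_2)\neq\phi(x_4,y_4)$; the column quadrangle condition if there are no $x_1,\dots,x_5\in X$, $y_1,\dots,y_4\in Y$ with $x_5\neq x_4$, cells $(x_1,y_1),(x_2,y_1),(x_1,y_2),(x_2,y_2),(x_3,y_3),(x_4,y_3),(x_3,y_4),(x_5,y_4)$ in $B$ and $\phi(x_1,y_1)=\phi(x_3,y_3)$, $\phi(x_2,y_1)=\phi(x_4,y_3)$, $\phi(x_1,y_2)=\phi(x_3,y_4)$, $\phi(x_2,y_2)=\phi(x_5,y_4)$; the row quadrangle condition if there are no $x_1,\dots,x_4\in X$, $y_1,\dots,y_5\in Y$ with $y_5\neq y_4$, cells $(x_1,y_1),(x_2,y_1),(x_1,y_2),(x_2,y_2),(x_3,y_3),(x_4,y_3),(x_3,y_4),(x_4,y_5)$ in $B$ and $\phi(x_1,y_1)=\phi(x_3,y_3)$, $\phi(x_2,y_1)=\phi(x_4,y_3)$, $\phi(x_1,y_2)=\phi(x_3,y_4)$, $\phi(x_2,y_2)=\phi(x_4,y_5)$. It satisfies the quadrangle condition if it satisfies all three. *)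

(* Defs.v *)
From mathcomp Require Import all_boot.
Set Implicit Arguments.
Unset Strict Implicit.
Unset Printing Implicit Defensive.

(* A labelling [A -> Z] is encoded as a total function [phi : X -> Y -> Z]
   whose values outside the cell set [A] are never inspected. This loses no
   generality ([A] nonempty forces [Z] nonempty), and the restriction of [phi]
   to [B \subset A] is then [phi] itself, paired with the cell set [B]. *)

Section PartialLatinSquares.

Variables X Y Z : finType.

Definition partial_latin_square (A : {set X * Y}) (phi : X -> Y -> Z) : Prop :=
  (forall a b1 b2, (a, b1) \in A -> (a, b2) \in A ->
     phi a b1 = phi a b2 -> b1 = b2)
  /\ (forall a1 a2 b, (a1, b) \in A -> (a2, b) \in A ->
     phi a1 b = phi a2 b -> a1 = a2).

Definition is_octahedron (A : {set X * Y}) (phi : X -> Y -> Z)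
    (t : X * X * Y * Y * X * X * Y * Y) : bool :=
  let: (x1, x2, y1, y2, x3, x4, y3, y4) := t in
  [&& [&& (x1, y1) \in A, (x2, y1) \in A, (x1, y2) \in A & (x2, y2) \in A],
      [&& (x3, y3) \in A, (x4, y3) \in A, (x3, y4) \in A & (x4, y4) \in A],
      phi x1 y1 == phi x3 y3,
      phi x2 y1 == phi x4 y3,
      phi x1 y2 == phi x3 y4
    & phi x2 y2 == phi x4 y4].

Definition octahedra (A : {set X * Y}) (phi : X -> Y -> Z) :
    {set X * X * Y * Y * X * X * Y * Y} :=
  [set t | is_octahedron A phi t].

Definition label_quadrangle (B : {set X * Y}) (phi : X -> Y -> Z) : Prop :=
  ~ exists (x1 x2 x3 x4 : X) (y1 y2 y3 y4 : Y),
    [/\ [/\ (x1, y1) \in B, (x2, y1) \in B, (x1, y2) \in B & (x2, y2) \in B],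
        [/\ (x3, y3) \in B, (x4, y3) \in B, (x3, y4) \in B & (x4, y4) \in B],
        [/\ phi x1 y1 = phi x3 y3, phi x2 y1 = phi x4 y3
          & phi x1 y2 = phi x3 y4]
      & phi x2 y2 <> phi x4 y4].

Definition column_quadrangle (B : {set X * Y}) (phi : X -> Y -> Z) : Prop :=
  ~ exists (x1 x2 x3 x4 x5 : X) (y1 y2 y3 y4 : Y),
    [/\ x5 <> x4,
        [/\ (x1, y1) \in B, (x2, y1) \in B, (x1, y2) \in B & (x2, y2) \in B],
        [/\ (x3, y3) \in B, (x4, y3) \in B, (x3, y4) \in B & (x5, y4) \in B]
      & [/\ phi x1 y1 = phi x3 y3, phi x2 y1 = phi x4 y3,
            phi x1 y2 = phi x3 y4 & phi x2 y2 = phi x5 y4]].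

Definition row_quadrangle (B : {set X * Y}) (phi : X -> Y -> Z) : Prop :=
  ~ exists (x1 x2 x3 x4 : X) (y1 y2 y3 y4 y5 : Y),
    [/\ y5 <> y4,
        [/\ (x1, y1) \in B, (x2, y1) \in B, (x1, y2) \in B & (x2, y2) \in B],
        [/\ (x3, y3) \in B, (x4, y3) \in B, (x3, y4) \in B & (x4, y5) \in B]
      & [/\ phi x1 y1 = phi x3 y3, phi x2 y1 = phi x4 y3,
            phi x1 y2 = phi x3 y4 & phi x2 y2 = phi x4 y5]].

Definition quadrangle_condition (B : {set X * Y}) (phi : X -> Y -> Z) : Prop :=
  [/\ label_quadrangle B phi, column_quadrangle B phi & row_quadrangle B phi].

Lemma partial_latin_squareS (A B : {set X * Y}) (phi : X -> Y -> Z) :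
  B \subset A -> partial_latin_square A phi -> partial_latin_square B phi.
Proof.
move=> /subsetP sBA [injr injc]; split.
- by move=> a b1 b2 /sBA h1 /sBA h2; apply: injr.
- by move=> a1 a2 b /sBA h1 /sBA h2; apply: injc.
Qed.

End PartialLatinSquares.

(* Main.v *)
(** Identify the partial Latin square with its cells (x, y, z); any two coordinates
   determine the third, and the column and row conditions are the label condition after
   exchanging coordinates.  Call labels z <> z' mismatched if two rectangles share their
   first three labels and have fourth labels z and z'.  The core is to pass to a dense
   subsystem, still rich in octahedra, in which every label is mismatched with boundedly
   many labels.  Doing this once for each of the three coordinates and then colouring the
   three bounded-degree mismatch graphs properly, the most popular colour class has no
   mismatch at all.

   Dependent random choice through octahedra gives a dense B in which almost all patterns
   of certain fixed shapes reflect a popular relation of the ambient system A: a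
   quadruple of labels is popular ([Pop]) if it labels linearly many rectangles from
   different rows, and [H1], [H2] are iterated versions.  In a popular relation all
   labels but one determine the last up to O(1) choices.  After pruning B, each
   mismatch (d, d') extends in at least k n^18 ways to a configuration of popular
   relations ([conf]) with 18 free parameters, in which d and the parameters determine
   d' up to O(1) choices; hence d has at most O(1/k) mismatches d'. *)

Require Import Defs.
From mathcomp Require Import all_boot all_order all_algebra.
From mathcomp Require Import boolp reals ring lra.
Import Order.TTheory GRing.Theory Num.Theory.
Set Implicit Arguments.
Unset Strict Implicit.
Unset Printing Implicit Defensive.
Local Open Scope ring_scope.

(** For a fixed parameter, an octahedron acts as a partial translation: [octa_t] moves rows and
    columns independently and preserves labels, [octa_l] preserves columns, and [octa_r] preserves
    rows. A pattern whose relevant cells lie in such a family has a translated copy. A pattern kept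
    by about n^3 parameters thus has copies in linearly many rows or columns, and a random parameter
    keeps few patterns of the other kind.

    This controls almost all patterns, whereas a mismatch may sit anywhere. So it is joined to
    random patterns: each corner (x_i, y_j) of a rectangle is completed by a random row u_j and
    column v_i, and the four opposite corners (u_j, v_i) form a rectangle again. An equal label in
    the two rectangles links the opposite corners by [H2], which mentions neither that label nor the
    labels beside it, only positions where the latter recur.

    Two cells with the same label may still be an exceptional pair for this link. Making all such
    pairs good is too much for a pruning by averages; making every remaining cell good with one
    fixed centre of its label is not. Hence the detour through centres. *)

Lemma le_of_eq (R : realType) (x y : R) : x = y -> x <= y.
Proof. by move=> ->. Qed.

(** * Counting on finite types: injections, Markov, averages, Cauchy-Schwarz *)

Section Count.
Implicit Types A B I : finType.

Definition cnt A (P : A -> Prop) : nat := #|[set a | `[< P a >]]|.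

Lemma cnt_le A (P Q : A -> Prop) : (forall a, P a -> Q a) -> (cnt P <= cnt Q)%N.
Proof.
move=> PQ; apply/subset_leq_card/subsetP => a; rewrite !inE.
by move/asboolP => /PQ /asboolP.
Qed.

Lemma cnt_eq A (P Q : A -> Prop) : (forall a, P a <-> Q a) -> cnt P = cnt Q.
Proof.
by move=> PQ; apply/eqP; rewrite eqn_leq !cnt_le // => a /PQ.
Qed.

Lemma cnt_card A (P : A -> Prop) : (cnt P <= #|A|)%N.
Proof. exact: max_card. Qed.

Lemma cnt_true A : cnt (fun _ : A => True) = #|A|.
Proof.
by rewrite /cnt -cardsT; congr #|pred_of_set _|; apply/setP => a; rewrite !inE; apply/asboolP.
Qed.

Lemma cnt0 A (P : A -> Prop) : (forall a, ~ P a) -> cnt P = 0%N.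
Proof.
move=> nP; apply/eqP; rewrite cards_eq0; apply/eqP/setP => a; rewrite !inE.
by apply/asboolP; exact: nP.
Qed.

(** The injection is given as a relation, so that its value may be described by existentially
    quantified data; the last hypothesis says that the image recovers the source. In a linear system
    [lin] usually proves this. *)
Lemma cnt_rel A B (P : A -> Prop) (Q : B -> Prop) (R : A -> B -> Prop) :
  (forall a, P a -> exists2 b, Q b & R a b) ->
  (forall a a' b, P a -> P a' -> R a b -> R a' b -> a = a') ->
  (cnt P <= cnt Q)%N.
Proof.
move=> ex inj.
have /boolp.choice [f fP] : forall a, exists ob : option B,
    P a -> exists2 b, ob = Some b & Q b /\ R a b.
  move=> a; have [/ex [b Qb Rab]|nPa] := pselect (P a); last by exists None.
  by exists (Some b) => _; exists b.
have finj : {in [set a | `[< P a >]] &, injective f}.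
  move=> a a'; rewrite !inE => /asboolP Pa /asboolP Pa'.
  have [b -> [_ Rab]] := fP _ Pa; have [b' -> [_ Rab']] := fP _ Pa' => -[ebb].
  by apply: (inj _ _ b) => //; rewrite ebb.
rewrite /cnt -(card_in_imset finj) -(card_imset (mem [set b | `[< Q b >]]) (@Some_inj _)).
apply/subset_leq_card/subsetP => ob /imsetP [a]; rewrite inE => /asboolP Pa ->.
have [b -> [Qb _]] := fP _ Pa.
by apply/imsetP; exists b => //; rewrite inE; apply/asboolP.
Qed.

Lemma cnt_sum A (P : A -> Prop) : cnt P = \sum_a (`[< P a >] : nat).
Proof.
rewrite /cnt -sum1_card big_mkcond; apply: eq_bigr => a _.
by rewrite inE; case: `[< P a >].
Qed.

Lemma cnt_pair A B (P : A -> B -> Prop) :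
  cnt (fun p : A * B => P p.1 p.2) = \sum_a cnt (P a).
Proof.
rewrite cnt_sum -(pair_bigA _ (fun a b => (`[< P a b >] : nat))) /=.
by apply: eq_bigr => a _; rewrite cnt_sum.
Qed.

Lemma cnt_pairC A B (P : A -> B -> Prop) :
  (\sum_a cnt (P a) = \sum_b cnt (fun a => P a b))%N.
Proof.
under eq_bigr do rewrite cnt_sum.
by rewrite exchange_big; apply: eq_bigr => b _; rewrite cnt_sum.
Qed.

Lemma cnt_or A (P Q : A -> Prop) :
  (cnt (fun a => P a \/ Q a) <= cnt P + cnt Q)%N.
Proof.
rewrite /cnt -cardsUI; apply: leq_trans (leq_addr _ _).
apply/subset_leq_card/subsetP => a; rewrite !inE => /asboolP [Pa|Qa];
  apply/orP; [left|right]; exact/asboolP.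
Qed.

Lemma cnt_prod A B (P : A -> Prop) (Q : B -> Prop) :
  cnt (fun p : A * B => P p.1 /\ Q p.2) = (cnt P * cnt Q)%N.
Proof.
rewrite (cnt_pair (fun a b => P a /\ Q b)) [cnt P]cnt_sum big_distrl /=.
apply: eq_bigr => a _; have [Pa|nPa] := pselect (P a).
  by rewrite (asboolT Pa) mul1n; apply: cnt_eq => b; split=> [[]|].
by rewrite (asboolF nPa) mul0n; apply: cnt0 => b [].
Qed.

Lemma cnt_uniq A (P : A -> Prop) : (forall a b, P a -> P b -> a = b) -> (cnt P <= 1)%N.
Proof.
move=> u; rewrite -[leqRHS](card_unit) -(cnt_true unit).
by apply: (cnt_rel (R := fun _ _ => True)) => [a _|a a' _ /u h /h]; [exists tt|].
Qed.

Lemma cnt_gt0 A (P : A -> Prop) : (0 < cnt P)%N -> exists a, P a.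
Proof. by case/card_gt0P => a; rewrite inE => /asboolP; exists a. Qed.

Variable R : realType.

Local Notation "'#r' P" := ((cnt P)%:R : R) (at level 10, P at level 9).

Lemma cnt_pair_ge A B (P : A -> Prop) (Q : A -> B -> Prop) (k : R) :
  (forall a, P a -> k <= #r (Q a)) ->
  #r P * k <= #r (fun p : A * B => P p.1 /\ Q p.1 p.2).
Proof.
move=> h; rewrite (cnt_pair (fun a b => P a /\ Q a b)) [cnt P]cnt_sum !natr_sum mulr_suml.
apply: ler_sum => a _; have [Pa|nPa] := pselect (P a).
  rewrite (asboolT Pa) mul1r; apply: le_trans (h _ Pa) _.
  by rewrite ler_nat; apply: cnt_le => b; split.
by rewrite (asboolF nPa) mul0r ler0n.
Qed.

Lemma cnt_pair_le A B (P : A -> Prop) (Q : A -> B -> Prop) (k : R) :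
  (forall a, P a -> #r (Q a) <= k) ->
  #r (fun p : A * B => P p.1 /\ Q p.1 p.2) <= #r P * k.
Proof.
move=> h; rewrite (cnt_pair (fun a b => P a /\ Q a b)) [cnt P]cnt_sum !natr_sum mulr_suml.
apply: ler_sum => a _; have [Pa|nPa] := pselect (P a).
  rewrite (asboolT Pa) mul1r; apply: le_trans (h _ Pa).
  by rewrite ler_nat; apply: cnt_le => b [].
by rewrite (asboolF nPa) mul0r cnt0 // => b [].
Qed.

Lemma cnt_markov A B (P : A -> B -> Prop) (k : R) :
  #r (fun a => k <= #r (P a)) * k <= #r (fun p : A * B => P p.1 p.2).
Proof.
apply: le_trans (cnt_pair_ge (P := fun a => k <= #r (P a)) (Q := P) (fun a h => h)) _.
by rewrite ler_nat; apply: cnt_le => -[a b] [].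
Qed.

Lemma ler_cnt A (P Q : A -> Prop) : (forall a, P a -> Q a) -> #r P <= #r Q.
Proof. by move=> h; rewrite ler_nat; exact: cnt_le. Qed.

Lemma ler_cnt_or A (P Q S : A -> Prop) :
  (forall a, P a -> Q a \/ S a) -> #r P <= #r Q + #r S.
Proof.
by move=> h; rewrite -natrD ler_nat; apply: leq_trans (cnt_or _ _); exact: cnt_le.
Qed.

Lemma ler_cnt_rel A B (P : A -> Prop) (Q : B -> Prop) (S : A -> B -> Prop) :
  (forall a, P a -> exists2 b, Q b & S a b) ->
  (forall a a' b, P a -> P a' -> S a b -> S a' b -> a = a') ->
  #r P <= #r Q.
Proof. by move=> h1 h2; rewrite ler_nat; exact: cnt_rel h1 h2. Qed.

Lemma average_ge I (f : I -> R) (c : R) :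
  (0 < #|I|)%N -> c * #|I|%:R <= \sum_i f i -> exists i, c <= f i.
Proof.
move=> I0 h; apply: contrapT => /forallNP nex.
have : \sum_i f i < \sum_(i : I) c.
  have [i0 _] := card_gt0P I0.
  rewrite (bigD1 i0) //= [ltRHS](bigD1 i0) //=; apply: ltr_leD.
    by rewrite ltNge; apply/negP; exact: nex.
  by apply: ler_sum => i _; rewrite leNgt; apply/negP => /ltW; exact: nex.
by rewrite sumr_const -[c *+ _]mulr_natr ltNge h.
Qed.

(** Cauchy-Schwarz on a support of size at most [M], from expanding the sum of (f i - l)^2 over the
    support. Only a bound on the support is assumed, which suits the sparse sums in [pop_rich]. *)
Lemma sum_sqr_ge I (P : I -> Prop) (f : I -> R) (l M : R) :
  0 <= l -> #r P <= M -> (forall i, ~ P i -> f i = 0) -> l * M <= \sum_i f i ->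
  l ^+ 2 * M <= \sum_i f i ^+ 2.
Proof.
move=> l0 PM f0 lM.
have : 0 <= \sum_i (`[< P i >] : nat)%:R * (f i - l) ^+ 2.
  by apply: sumr_ge0 => i _; rewrite mulr_ge0 ?ler0n ?sqr_ge0.
have -> : \sum_i (`[< P i >] : nat)%:R * (f i - l) ^+ 2 =
    \sum_i f i ^+ 2 - 2 * l * (\sum_i f i) + l ^+ 2 * #r P.
  rewrite cnt_sum natr_sum !mulr_sumr -sumrB -big_split /=; apply: eq_bigr => i _.
  have [Pi|nPi] := pselect (P i); first by rewrite (asboolT Pi) /=; ring.
  by rewrite (asboolF nPi) (f0 _ nPi) /=; ring.
have : l ^+ 2 * #r P <= l ^+ 2 * M by rewrite ler_wpM2l ?sqr_ge0.
have : l * (l * M) <= l * \sum_i f i by rewrite ler_wpM2l.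
rewrite expr2; nra.
Qed.

End Count.
Notation "'#r[' R ']' P" := ((cnt P)%:R : R) (at level 10, P at level 9).
Arguments ler_cnt {R A P Q}.
Arguments ler_cnt_or {R A P Q S}.
Arguments ler_cnt_rel {R A B P Q S}.

(** * Ternary relations in which two coordinates determine the third *)

Definition rel3 (X Y Z : Type) := X -> Y -> Z -> Prop.

Definition linear3 (X Y Z : Type) (T : rel3 X Y Z) :=
  [/\ forall x y z z', T x y z -> T x y z' -> z = z',
      forall x z y y', T x y z -> T x y' z -> y = y'
    & forall y z x x', T x y z -> T x' y z -> x = x'].

Definition sub3 (X Y Z : Type) (S T : rel3 X Y Z) := forall x y z, S x y z -> T x y z.

Lemma lin_z (X Y Z : Type) (T : rel3 X Y Z) x y z z' :
  linear3 T -> T x y z -> T x y z' -> z = z'.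
Proof. by case=> h _ _; apply: h. Qed.

Lemma lin_y (X Y Z : Type) (T : rel3 X Y Z) x y y' z :
  linear3 T -> T x y z -> T x y' z -> y = y'.
Proof. by case=> _ h _; apply: h. Qed.

Lemma lin_x (X Y Z : Type) (T : rel3 X Y Z) x x' y z :
  linear3 T -> T x y z -> T x' y z -> x = x'.
Proof. by case=> _ _ h; apply: h. Qed.

Lemma linear3S (X Y Z : Type) (S T : rel3 X Y Z) : sub3 S T -> linear3 T -> linear3 S.
Proof.
move=> sST lT; split=> [x y z z'|x z y y'|y z x x'] /sST h /sST h'.
- exact: lin_z h h'.
- exact: lin_y h h'.
- exact: lin_x h h'.
Qed.

(* [lin lT] identifies variables forced to be equal by the linearity hypothesis lT. *)
Ltac lin1 lT :=
  match type of lT with linear3 ?T =>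
  match goal with
  | H1 : T ?x ?y ?z, H2 : T ?x ?y ?z' |- _ =>
      tryif constr_eq z z' then fail else
      (let e := fresh in pose proof (lin_z lT H1 H2) as e; first [subst z'|subst z])
  | H1 : T ?x ?y ?z, H2 : T ?x ?y' ?z |- _ =>
      tryif constr_eq y y' then fail else
      (let e := fresh in pose proof (lin_y lT H1 H2) as e; first [subst y'|subst y])
  | H1 : T ?x ?y ?z, H2 : T ?x' ?y ?z |- _ =>
      tryif constr_eq x x' then fail else
      (let e := fresh in pose proof (lin_x lT H1 H2) as e; first [subst x'|subst x])
  end end.
Ltac lin lT := repeat lin1 lT.
Ltac destr :=
  repeat match goal with
  | H : _ /\ _ |- _ => let h := fresh "h" in case: H => H h
  | H : and3 _ _ _ |- _ => let h1 := fresh "h" in let h2 := fresh "h" in case: H => H h1 h2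
  | H : and4 _ _ _ _ |- _ => let h1 := fresh "h" in let h2 := fresh "h" in
      let h3 := fresh "h" in case: H => H h1 h2 h3
  | H : and5 _ _ _ _ _ |- _ => let h1 := fresh "h" in let h2 := fresh "h" in
      let h3 := fresh "h" in let h4 := fresh "h" in case: H => H h1 h2 h3 h4
  | H : exists _, _ |- _ => let v := fresh "v" in case: H => v H
  end.

(** * Octahedra as families of cells indexed by three parameters *)

Section Octahedra.
Variables X Y Z : finType.
Implicit Types T S : rel3 X Y Z.

Definition octa T x1 x2 x3 x4 y1 y2 y3 y4 a b c d :=
  [/\ T x1 y1 a, T x2 y1 b, T x1 y2 c & T x2 y2 d] /\
  [/\ T x3 y3 a, T x4 y3 b, T x3 y4 c & T x4 y4 d].

(* Given its first cell, an octahedron is determined by (x2, y2, x4), by (x3, x4, y2), and by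
   (y3, y4, x2). *)
Definition octa_t T (w : X * Y * X) : rel3 X Y Z := fun x y z =>
  exists x3 y3 y4 b c d, octa T x w.1.1 x3 w.2 y w.1.2 y3 y4 z b c d.
Definition octa_l T (w : X * X * Y) : rel3 X Y Z := fun x y z =>
  exists x2 y3 y4 b c d, octa T x x2 w.1.1 w.1.2 y w.2 y3 y4 z b c d.
Definition octa_r T (w : Y * Y * X) : rel3 X Y Z := fun x y z =>
  exists x3 x4 y2 b c d, octa T x w.2 x3 x4 y y2 w.1.1 w.1.2 z b c d.

Definition octa_at T (x : X) (y : Y) := cnt (fun w : X * Y * X => exists z, octa_t T w x y z).
Definition octas T := cnt (fun t : (X * Y) * (X * Y * X) => exists z, octa_t T t.2 t.1.1 t.1.2 z).

Definition csize T := cnt (fun p : X * Y => exists z, T p.1 p.2 z).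

Lemma octa_t_sub T w : sub3 (octa_t T w) T.
Proof. by move=> x y z [x3 [y3 [y4 [b [c [d [[]]]]]]]]. Qed.
Lemma octa_l_sub T w : sub3 (octa_l T w) T.
Proof. by move=> x y z [x3 [y3 [y4 [b [c [d [[]]]]]]]]. Qed.
Lemma octa_r_sub T w : sub3 (octa_r T w) T.
Proof. by move=> x y z [x3 [y3 [y4 [b [c [d [[]]]]]]]]. Qed.

Lemma octas_sum T : octas T = (\sum_p octa_at T p.1 p.2)%N.
Proof.
exact: (cnt_pair (fun (p : X * Y) (w : X * Y * X) => exists z, octa_t T w p.1 p.2 z)).
Qed.

(** Through a given cell, (x2, y2, x4) and (x3, x4, y2) parametrise the same octahedra, so densities
    measured by [octa_at] serve for [octa_l] too. *)
Lemma octa_at_l T x y : linear3 T ->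
  (octa_at T x y <= cnt (fun w : X * X * Y => exists z, octa_l T w x y z))%N.
Proof.
move=> lT; apply: (cnt_rel (R := fun (t : X * Y * X) (w : X * X * Y) =>
  exists x3 y3 y4 a b c d, octa T x t.1.1 x3 t.2 y t.1.2 y3 y4 a b c d /\ w = (x3, t.2, t.1.2))).
  move=> [[x2 y2] x4] [a [x3 [y3 [y4 [b [c [d h]]]]]]].
  exists (x3, x4, y2); last by exists x3, y3, y4, a, b, c, d.
  by exists a, x2, y3, y4, b, c, d.
move=> [[x2 y2] x4] [[x2' y2'] x4'] [[x3 x5] y5] _ _ /=
  [x3' [y3 [y4 [a [b [c [d [h1 [? ? ?]]]]]]]]] [x3'' [y3' [y4' [a' [b' [c' [d' [h2 [? ? ?]]]]]]]]].
by subst; rewrite /octa in h1 h2; destr; lin lT.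
Qed.

Lemma octa_at_r T x y : linear3 T ->
  (octa_at T x y <= cnt (fun w : Y * Y * X => exists z, octa_r T w x y z))%N.
Proof.
move=> lT; apply: (cnt_rel (R := fun (t : X * Y * X) (w : Y * Y * X) =>
  exists x3 y3 y4 a b c d, octa T x t.1.1 x3 t.2 y t.1.2 y3 y4 a b c d /\ w = (y3, y4, t.1.1))).
  move=> [[x2 y2] x4] [a [x3 [y3 [y4 [b [c [d h]]]]]]].
  exists (y3, y4, x2); last by exists x3, y3, y4, a, b, c, d.
  by exists a, x3, x4, y2, b, c, d.
move=> [[x2 y2] x4] [[x2' y2'] x4'] [[x3 x5] y5] _ _ /=
  [x3' [y3 [y4 [a [b [c [d [h1 [? ? ?]]]]]]]]] [x3'' [y3' [y4' [a' [b' [c' [d' [h2 [? ? ?]]]]]]]]].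
by subst; rewrite /octa in h1 h2; destr; lin lT.
Qed.

End Octahedra.

(** * Dependent random choice *)

Definition scarce (R : realType) (Om P : finType) (I : P -> Om -> Prop) (k : R) (w : Om) (s : P) :=
  I s w /\ #r[R] (I s) < k.

(** After exchanging the sums, a pattern kept by at least [k] choices contributes 0 and any other
    less than [k]. *)
Lemma sum_scarce (R : realType) (Om P : finType) (I : P -> Om -> Prop) (k : R) :
  0 <= k -> \sum_w #r[R] (scarce I k w) <= #|P|%:R * k.
Proof.
move=> k0; rewrite -natr_sum cnt_pairC natr_sum mulr_natl -sumr_const; apply: ler_sum => s _.
have [h|h] := ltP (#r[R] (I s)) k.
  by apply: le_trans (ltW h); apply: ler_cnt => w [].
by rewrite cnt0 // => w [_]; rewrite ltNge h.
Qed.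

Section DependentChoice.
Variables (R : realType) (X Y Z : finType) (n : nat).
Hypotheses (cX : #|X| = n) (cY : #|Y| = n) (n_gt0 : (0 < n)%N).
Implicit Types T S : rel3 X Y Z.

(* Both choices are made simultaneously; the expected gain of csize over the (normalised)
   numbers of scarce patterns is positive by Cauchy-Schwarz. *)
Lemma drc T (Om1 Om2 P1 P2 : finType) (D1 : Om1 -> rel3 X Y Z) (D2 : Om2 -> rel3 X Y Z)
    (inc1 : P1 -> rel3 X Y Z -> Prop) (inc2 : P2 -> rel3 X Y Z -> Prop) (e g1 g2 : R) :
  0 < e -> 0 < g1 -> 0 < g2 -> linear3 T -> e * n%:R ^+ 5 <= (octas T)%:R ->
  #|Om1| = (n ^ 3)%N -> #|Om2| = (n ^ 3)%N -> (0 < #|P1|)%N -> (0 < #|P2|)%N ->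
  (forall w, sub3 (D1 w) T) -> (forall w, sub3 (D2 w) T) ->
  (forall x y, octa_at T x y <= cnt (fun w => exists z, D1 w x y z))%N ->
  (forall x y, octa_at T x y <= cnt (fun w => exists z, D2 w x y z))%N ->
  exists w1 w2, let S : rel3 X Y Z := fun x y z => D1 w1 x y z /\ D2 w2 x y z in
  [/\ e ^+ 2 / 2 * n%:R ^+ 2 <= (csize S)%:R,
      #r[R] (scarce (fun s w => inc1 s (D1 w)) (g1 * e ^+ 2 / 4 * n%:R ^+ 3) w1) <= g1 * #|P1|%:R
    & #r[R] (scarce (fun s w => inc2 s (D2 w)) (g2 * e ^+ 2 / 4 * n%:R ^+ 3) w2) <= g2 * #|P2|%:R].
Proof.
move=> e0 g10 g20 lT he cO1 cO2 p1 p2 sD1 sD2 ho1 ho2.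
pose N : R := n%:R; have N0 : 0 < N by rewrite ltr0n.
pose k1 := g1 * e ^+ 2 / 4 * N ^+ 3; pose k2 := g2 * e ^+ 2 / 4 * N ^+ 3.
have e20 : 0 < e ^+ 2 by rewrite exprn_gt0.
have N30 : 0 < N ^+ 3 by rewrite exprn_gt0.
have k10 : 0 < k1 by rewrite /k1 mulr_gt0 // divr_gt0 // mulr_gt0.
have k20 : 0 < k2 by rewrite /k2 mulr_gt0 // divr_gt0 // mulr_gt0.
pose S (w : Om1 * Om2) : rel3 X Y Z := fun x y z => D1 w.1 x y z /\ D2 w.2 x y z.
have sumS : e ^+ 2 * N ^+ 2 * N ^+ 6 <= \sum_w (csize (S w))%:R.
  rewrite -natr_sum /csize
    (cnt_pairC (fun w (p : X * Y) => exists z, S w p.1 p.2 z)) natr_sum.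
  (* A cell survives both choices for at least the square of [octa_at] pairs, so the second moment
     of [octa_at] bounds the expected size. *)
  apply: (@le_trans _ _ (\sum_(p : X * Y) (octa_at T p.1 p.2)%:R ^+ 2)); last first.
    apply: ler_sum => -[x y] _; rewrite -natrX ler_nat /= expnS expn1.
    apply: leq_trans (leq_mul (ho1 x y) (ho2 x y)) _; rewrite -cnt_prod.
    apply: cnt_le => -[w1 w2] [[z /= h1] [z' /= h2]]; exists z; split=> //=.
    by rewrite (lin_z lT (sD1 _ _ _ _ h1) (sD2 _ _ _ _ h2)).
  have -> : e ^+ 2 * N ^+ 2 * N ^+ 6 = (e * N ^+ 3) ^+ 2 * N ^+ 2 by ring.
  apply: (sum_sqr_ge (P := fun _ : X * Y => True)) => //.
  - by rewrite mulr_ge0 ?ltW.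
  - by rewrite cnt_true card_prod cX cY natrM expr2.
  - apply: le_trans _ (_ : (octas T)%:R <= _); last by rewrite octas_sum natr_sum.
    by apply: le_trans he; rewrite -mulrA -exprD.
(* On average the first term is at least e^2, and the values of [k1] and [k2] make each penalty at
   most e^2 / 4. *)
pose f (w : Om1 * Om2) : R := (csize (S w))%:R / N ^+ 2
  - #r[R] (scarce (fun s w => inc1 s (D1 w)) k1 w.1) / (g1 * #|P1|%:R)
  - #r[R] (scarce (fun s w => inc2 s (D2 w)) k2 w.2) / (g2 * #|P2|%:R).
have P10 : 0 < g1 * #|P1|%:R by rewrite mulr_gt0 ?ltr0n.
have P20 : 0 < g2 * #|P2|%:R by rewrite mulr_gt0 ?ltr0n.
have N3E : (n ^ 3)%:R = N ^+ 3 by rewrite natrX.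
have [[w1 w2] hw] : exists w, e ^+ 2 / 2 <= f w.
  apply: average_ge.
    by rewrite card_prod cO1 cO2 muln_gt0 !expn_gt0 n_gt0.
  rewrite card_prod cO1 cO2 natrM N3E /f !big_split /= !sumrN -!mulr_suml.
  have b1 : \sum_(w : Om1 * Om2) #r[R] (scarce (fun s w => inc1 s (D1 w)) k1 w.1) <= N ^+ 3 * (#|P1|%:R * k1).
    rewrite -(pair_bigA _ (fun a b => #r[R] (scarce (fun s w => inc1 s (D1 w)) k1 a))) /=.
    under eq_bigr do rewrite sumr_const cO2.
    rewrite sumrMnl -[_ *+ _]mulr_natl N3E ler_pM2l //.
    by apply: sum_scarce; rewrite ltW.
  have b2 : \sum_(w : Om1 * Om2) #r[R] (scarce (fun s w => inc2 s (D2 w)) k2 w.2) <= N ^+ 3 * (#|P2|%:R * k2).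
    rewrite -(pair_bigA _ (fun a b => #r[R] (scarce (fun s w => inc2 s (D2 w)) k2 b))) /=.
    rewrite sumr_const cO1 -[_ *+ _]mulr_natl N3E ler_pM2l //.
    by apply: sum_scarce; rewrite ltW.
  have -> : e ^+ 2 / 2 * (N ^+ 3 * N ^+ 3) =
    (e ^+ 2 * N ^+ 2 * N ^+ 6) / N ^+ 2 - N ^+ 3 * (#|P1|%:R * k1) / (g1 * #|P1|%:R)
      - N ^+ 3 * (#|P2|%:R * k2) / (g2 * #|P2|%:R).
    rewrite /k1 /k2; field.
    by rewrite !pnatr_eq0 -!lt0n p1 p2 n_gt0 !gt_eqF.
  by rewrite !lerB // ler_pM2r // invr_gt0 // exprn_gt0.
exists w1, w2; rewrite -/N -/k1 -/k2 /=.
(* The first term of [f] is at most 1 and [f] is positive at the chosen pair, so each normalised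
   penalty is at most 1. *)
have cS : (csize (S (w1, w2)))%:R / N ^+ 2 <= 1.
  rewrite ler_pdivrMr ?exprn_gt0 // mul1r /N -natrX ler_nat.
  by apply: leq_trans (cnt_card _) _; rewrite card_prod cX cY.
have r1 : 0 <= #r[R] (scarce (fun s w => inc1 s (D1 w)) k1 w1) / (g1 * #|P1|%:R) by rewrite divr_ge0 ?ler0n ?ltW.
have r2 : 0 <= #r[R] (scarce (fun s w => inc2 s (D2 w)) k2 w2) / (g2 * #|P2|%:R) by rewrite divr_ge0 ?ler0n ?ltW.
rewrite /f /= in hw; split.
- rewrite -ler_pdivlMr ?exprn_gt0 //; apply: le_trans hw _; lra.
- rewrite -[leRHS]mul1r -ler_pdivrMr //; lra.
- rewrite -[leRHS]mul1r -ler_pdivrMr //; lra.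
Qed.

End DependentChoice.

Lemma det_markov (R : realType) (A B : finType) (P : A -> B -> Prop) (k M : R) : 0 < k ->
  #r[R] (fun p : A * B => P p.1 p.2) <= M ->
  #r[R] (fun a => k <= #r[R] (P a)) <= M / k.
Proof.
move=> k0 h; rewrite ler_pdivlMr //; exact: le_trans (cnt_markov _ _) h.
Qed.

(** * Popular quadruples of labels and the octahedra they force *)

Section Popular.
Variables (R : realType) (X Y Z : finType) (n : nat).
Hypotheses (cX : #|X| = n) (cY : #|Y| = n) (cZ : #|Z| = n) (n_gt0 : (0 < n)%N).
Implicit Types T S A : rel3 X Y Z.

Definition rect S x y u v a al be m := [/\ S x y a, S x v al, S u y be & S u v m].

Definition pop_row A a al be m x := exists y u v, rect A x y u v a al be m.

(** Counting rows suffices: the row [x] and any three of the labels determine the rectangle, hence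
    the fourth label. *)
Definition Pop A (eta : R) a al be m := eta * n%:R <= #r[R] (pop_row A a al be m).

Definition unpop A eta S (t : X * Y * X * Y) := exists a al be m,
  rect S t.1.1.1 t.1.1.2 t.1.2 t.2 a al be m /\ ~ Pop A eta a al be m.

Let N0 : 0 < n%:R :> R. Proof. by rewrite ltr0n. Qed.

(** By [inj] each row serves at most one [z], while a popular [z] occupies at least [eta * n] of the
    [n] rows. *)
Lemma pop_bound A eta (f : Z -> Z * Z * Z * Z) : 0 < eta ->
  (forall z z' x, pop_row A (f z).1.1.1 (f z).1.1.2 (f z).1.2 (f z).2 x ->
     pop_row A (f z').1.1.1 (f z').1.1.2 (f z').1.2 (f z').2 x -> z = z') ->
  #r[R] (fun z => Pop A eta (f z).1.1.1 (f z).1.1.2 (f z).1.2 (f z).2) <= eta^-1.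
Proof.
move=> e0 inj.
have -> : eta^-1 = n%:R / (eta * n%:R) by field; rewrite !gt_eqF.
apply: det_markov; first by rewrite mulr_gt0.
rewrite ler_nat -cX -(cnt_true X).
apply: (cnt_rel (R := fun p x => p.2 = x)) => [[z x] _|[z x] [z' x'] x'' /= h h' e e'].
  by exists x.
by subst; rewrite (inj _ _ _ h h').
Qed.

Lemma pop_det_m A eta a al be : 0 < eta -> linear3 A ->
  #r[R] (fun m => Pop A eta a al be m) <= eta^-1.
Proof.
move=> e0 lA; apply: (pop_bound (f := fun m => (a, al, be, m))) => // m m' x /=.
by move=> [y [u [v h]]] [y' [u' [v' h']]]; rewrite /rect in h h'; destr; lin lA.
Qed.

Lemma pop_det_be A eta a al m : 0 < eta -> linear3 A ->
  #r[R] (fun be => Pop A eta a al be m) <= eta^-1.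
Proof.
move=> e0 lA; apply: (pop_bound (f := fun be => (a, al, be, m))) => // be be' x /=.
by move=> [y [u [v h]]] [y' [u' [v' h']]]; rewrite /rect in h h'; destr; lin lA.
Qed.

Lemma pop_det_a A eta al be m : 0 < eta -> linear3 A ->
  #r[R] (fun a => Pop A eta a al be m) <= eta^-1.
Proof.
move=> e0 lA; apply: (pop_bound (f := fun a => (a, al, be, m))) => // a a' x /=.
by move=> [y [u [v h]]] [y' [u' [v' h']]]; rewrite /rect in h h'; destr; lin lA.
Qed.

Definition in_rect (t : X * Y * X * Y) S := exists a al be m,
  rect S t.1.1.1 t.1.1.2 t.1.2 t.2 a al be m.

(* Each w carries the rectangle to a copy with the same labels in another row; at most n^2
   parameters w give the same row. *)
Lemma translated_rect_pop T x y u v a al be m (eta : R) : linear3 T ->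
  rect T x y u v a al be m ->
  eta * n%:R ^+ 3 <= #r[R] (fun w => in_rect (x, y, u, v) (octa_t T w)) ->
  Pop T eta a al be m.
Proof.
move=> lT hr h.
suff : #r[R] (fun w => in_rect (x, y, u, v) (octa_t T w)) <=
    #r[R] (fun p : X * (X * Y) => pop_row T a al be m p.1 /\ True).
  move/(le_trans h).
  rewrite (cnt_prod (pop_row T a al be m) (fun _ : X * Y => True)) cnt_true card_prod cX cY !natrM.
  rewrite (_ : eta * _ = eta * n%:R * (n%:R * n%:R)); last by ring.
  by rewrite ler_pM2r ?mulr_gt0.
apply: (ler_cnt_rel (S := fun (w : X * Y * X) (p : X * (X * Y)) =>
  w.1 = p.2 /\ exists c d y4, [/\ T x w.1.2 c, T p.1 y4 c, T w.1.1 w.1.2 d & T w.2 y4 d])).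
  move=> [[x2 y2] x4] [a' [al' [be' [m' [h1 h2 h3 h4]]]]].
  rewrite /octa_t /octa /= in h1 h2 h3 h4; rewrite /rect in hr; destr.
  lin lT; match goal with H : T ?q _ a, H' : T ?q _ al |- _ =>
    tryif constr_eq q x then fail else exists (q, (x2, y2)) end.
    by split=> //; rewrite /pop_row /=; do 3 eexists; split; eassumption.
  by split=> //=; do 3 eexists; split; eassumption.
move=> [[x2 y2] x4] [[x2' y2'] x4'] [x3 [x5 y5]] _ _ /=.
move=> [[? ?] h1] [[? ?] h2]; subst; destr; by lin lT.
Qed.

(** Cauchy-Schwarz over rows, then over pairs of columns. *)
Lemma c4_count (E : X -> Y -> Prop) (b : R) : 0 <= b ->
  b * n%:R ^+ 2 <= #r[R] (fun p : X * Y => E p.1 p.2) ->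
  b ^+ 4 * n%:R ^+ 4 <= #r[R] (fun t : X * Y * X * Y =>
    [/\ E t.1.1.1 t.1.1.2, E t.1.1.1 t.2, E t.1.2 t.1.1.2 & E t.1.2 t.2]).
Proof.
move=> b0 h; set N : R := n%:R in h *.
have s1 : (b * N) ^+ 2 * N <= \sum_x #r[R] (E x) ^+ 2.
  apply: (sum_sqr_ge (P := fun _ : X => True)) => //; first by rewrite mulr_ge0 // ltW.
    by rewrite cnt_true cX.
  by apply: le_trans (le_trans h _); [rewrite expr2 mulrA|rewrite cnt_pair natr_sum].
have s2 : (b ^+ 2 * N) ^+ 2 * N ^+ 2 <=
    \sum_(q : Y * Y) #r[R] (fun x => E x q.1 /\ E x q.2) ^+ 2.
  apply: (sum_sqr_ge (P := fun _ : Y * Y => True)) => //.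
  - by rewrite mulr_ge0 ?exprn_ge0 // ltW.
  - by rewrite cnt_true card_prod cY natrM expr2.
  rewrite -natr_sum (cnt_pairC (fun (q : Y * Y) x => E x q.1 /\ E x q.2)) natr_sum.
  apply: le_trans (le_trans s1 _); first by apply: le_of_eq; ring.
  by apply: ler_sum => x _; rewrite cnt_prod natrM expr2.
apply: le_trans (le_trans s2 _); first by apply: le_of_eq; ring.
under eq_bigr do rewrite expr2 -natrM -cnt_prod.
rewrite -natr_sum -cnt_pair; apply: (ler_cnt_rel (S := fun (p : (Y * Y) * (X * X)) t =>
    t = (p.2.1, p.1.1, p.2.2, p.1.2))).
  by move=> [[y v] [x u]] /= [[h1 h2] [h3 h4]]; exists (x, y, u, v).
by move=> [[y v] [x u]] [[y' v'] [x' u']] t _ _ -> [-> -> -> ->].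
Qed.

(** Two rectangles with the same labels form an octahedron. At least half of the guaranteed b^4 n^4
    rectangles of [S] carry popular labels, and by [pop_det_m] there are at most n^3 / eta popular
    quadruples, so Cauchy-Schwarz over the quadruples applies. *)
Lemma pop_rich T S (b eta : R) : 0 < b -> 0 < eta -> linear3 T -> sub3 S T ->
  b * n%:R ^+ 2 <= (csize S)%:R ->
  #r[R] (unpop T eta S) <= b ^+ 4 / 2 * n%:R ^+ 4 ->
  eta * (b ^+ 4 / 2) ^+ 2 * n%:R ^+ 5 <= (octas S)%:R.
Proof.
move=> b0 e0 lT sST hS hu; set N : R := n%:R in hS hu *.
have lS := linear3S sST lT.
pose Q := (Z * Z * Z * Z)%type.
pose pp (q : Q) := Pop T eta q.1.1.1 q.1.1.2 q.1.2 q.2.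
pose rc (q : Q) (t : X * Y * X * Y) :=
  rect S t.1.1.1 t.1.1.2 t.1.2 t.2 q.1.1.1 q.1.1.2 q.1.2 q.2.
have h4 := c4_count (E := fun x y => exists z, S x y z) (ltW b0) hS; rewrite -/N in h4.
have hp : b ^+ 4 / 2 * N ^+ 4 <= #r[R] (fun p : Q * (X * Y * X * Y) => pp p.1 /\ rc p.1 p.2).
  apply: (@le_trans _ _ (#r[R] (fun t : X * Y * X * Y => exists q, pp q /\ rc q t))); last first.
    apply: (ler_cnt_rel (S := fun t p => t = p.2)) => [t [q h]|t t' p _ _ -> ->] //.
    by exists (q, t).
  have {}h4 : b ^+ 4 * N ^+ 4 <= #r[R] (fun t => in_rect t S).
    apply: le_trans h4 _; apply: ler_cnt => -[[[x y] u] v] /= [[a ?] [al ?] [be ?] [m ?]].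
    by exists a, al, be, m.
  have h5 : #r[R] (fun t => in_rect t S) <= #r[R] (unpop T eta S) +
      #r[R] (fun t : X * Y * X * Y => exists q, pp q /\ rc q t).
    apply: ler_cnt_or => -[[[x y] u] v] [a [al [be [m h]]]].
    have [p|np] := pselect (Pop T eta a al be m); last by left; exists a, al, be, m.
    by right; exists (a, al, be, m).
  have := le_trans h4 h5; lra.
have cp : #r[R] pp <= N ^+ 3 / eta.
  have -> : N ^+ 3 / eta = #r[R] (fun q : Z * Z * Z => True) * eta^-1.
    by rewrite cnt_true !card_prod cZ !natrM -/N; ring.
  apply: le_trans (cnt_pair_le (P := fun q : Z * Z * Z => True)
    (Q := fun q m => Pop T eta q.1.1 q.1.2 q.2 m) _); last by move=> q _; exact: pop_det_m.
  by apply: ler_cnt => -[[[a al] be] m].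
have h6 : (eta * (b ^+ 4 / 2) * N) ^+ 2 * (N ^+ 3 / eta) <=
    \sum_q #r[R] (fun t => pp q /\ rc q t) ^+ 2.
  apply: (sum_sqr_ge _ cp) => [|q nq|]; first by rewrite !mulr_ge0 ?exprn_ge0 ?ltW ?invr_gt0.
    by rewrite cnt0 // => t [].
  rewrite (_ : _ * (N ^+ 3 / eta) = b ^+ 4 / 2 * N ^+ 4); last by field; rewrite gt_eqF.
  by rewrite -natr_sum -cnt_pair.
move: h6; under eq_bigr do rewrite expr2 -natrM -cnt_prod.
rewrite -natr_sum -cnt_pair => h6.
apply: le_trans (le_trans h6 _).
  by apply: le_of_eq; field; rewrite gt_eqF.
apply: (ler_cnt_rel (S := fun (p : Q * ((X * Y * X * Y) * (X * Y * X * Y)))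
   (o : (X * Y) * (X * Y * X)) =>
   o = (p.2.1.1.1, (p.2.1.1.2, p.2.1.2, p.2.2.1.2)))).
  move=> [[[[a c] b'] d] [[[[x1 y1] x2] y2] [[[x3 y3] x4] y4]]].
  rewrite /pp /rc /rect /= => h; exists ((x1, y1), (x2, y2, x4)) => //=.
  by destr; exists a, x3, y3, y4, b', c, d.
move=> [[[[a c] b'] d] [[[[x1 y1] x2] y2] [[[x3 y3] x4] y4]]].
move=> [[[[a' c'] b''] d'] [[[[x1' y1'] x2'] y2'] [[[x3' y3'] x4'] y4']]] o.
rewrite /pp /rc /rect /= => h h' -> [? ? ? ? ?]; subst; destr; by lin lS.
Qed.

End Popular.

Ltac chase := repeat first [eassumption | split].

(** * Passing to subsystems: popular rectangles and row translations *)

Section Stages.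
Variables (R : realType) (X Y Z : finType) (n : nat).
Hypotheses (cX : #|X| = n) (cY : #|Y| = n) (cZ : #|Z| = n) (n_gt0 : (0 < n)%N).
Implicit Types T S A : rel3 X Y Z.

Let N0 : 0 < n%:R :> R. Proof. by rewrite ltr0n. Qed.
Let N0' : n%:R != 0 :> R. Proof. by rewrite gt_eqF. Qed.

(** The constant of [pop_rich] for the density b = e^2 / 2 given by [drc] and the popularity (b^4 /
    2) e^2 / 4 that [drc] yields when a proportion b^4 / 2 of scarce rectangles is tolerated. *)
Definition rich (e : R) : R :=
  (e ^+ 2 / 2) ^+ 4 / 2 * e ^+ 2 / 4 * ((e ^+ 2 / 2) ^+ 4 / 2) ^+ 2.

Lemma rich_gt0 e : 0 < e -> 0 < rich e.
Proof. by move=> e0; rewrite /rich; repeat first [apply: mulr_gt0|apply: exprn_gt0|by rewrite invr_gt0]. Qed.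

(** The first choice of [drc] is free to control the patterns of [inc]. The second is always
    [octa_t] with rectangles as patterns: it makes most rectangles of [S] popular in [T], so
    [pop_rich] keeps [S] rich and stages can be iterated. *)
Lemma stage T (Om P : finType) (D : Om -> rel3 X Y Z) (inc : P -> rel3 X Y Z -> Prop) (e g : R) :
  0 < e -> 0 < g -> linear3 T -> e * n%:R ^+ 5 <= (octas T)%:R ->
  #|Om| = (n ^ 3)%N -> (0 < #|P|)%N ->
  (forall s S S', sub3 S S' -> inc s S -> inc s S') ->
  (forall w, sub3 (D w) T) ->
  (forall x y, octa_at T x y <= cnt (fun w => exists z, D w x y z))%N ->
  exists S, [/\ sub3 S T, e ^+ 2 / 2 * n%:R ^+ 2 <= (csize S)%:R,
    rich e * n%:R ^+ 5 <= (octas S)%:R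
    & #r[R] (fun s => inc s S /\
        #r[R] (fun w => inc s (D w)) < g * e ^+ 2 / 4 * n%:R ^+ 3) <= g * #|P|%:R].
Proof.
move=> e0 g0 lT he cOm cP mono sD hD.
pose b := e ^+ 2 / 2; pose g2 := b ^+ 4 / 2.
have b0 : 0 < b by rewrite divr_gt0 ?exprn_gt0.
have g20 : 0 < g2 by rewrite divr_gt0 ?exprn_gt0.
have c3 : #|[the finType of (X * Y * X)%type]| = (n ^ 3)%N by rewrite !card_prod cX cY; ring.
have c4 : #|[the finType of (X * Y * X * Y)%type]| = (n ^ 4)%N by rewrite !card_prod cX cY; ring.
have [|||w1 [w2 [h1 h2 h3]]] := drc cX cY n_gt0 (D1 := D) (D2 := octa_t T) inc
  (@in_rect X Y Z) e0 g0 g20 lT he cOm c3 cP _ sD _ hD.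
- by rewrite c4 expn_gt0 n_gt0.
- by move=> w; exact: octa_t_sub.
- by [].
set S : rel3 X Y Z := fun x y z => _ in h1.
have sS : sub3 S (octa_t T w2) by move=> x y z [].
have sST : sub3 S T by move=> x y z [_] /octa_t_sub.
exists S; split=> //.
- apply: (pop_rich cX cY cZ n_gt0 b0 _ lT sST h1) => //.
    by rewrite divr_gt0 // mulr_gt0 // exprn_gt0.
  rewrite c4 natrX in h3; apply: le_trans h3; apply: ler_cnt.
  move=> [[[x y] u] v] [a [al [be [m [hr nP]]]]]; split.
    by exists a, al, be, m; case: hr => *; split; apply: sS.
  rewrite ltNge; apply/negP => h; apply: nP.
  apply: (translated_rect_pop cX cY cZ n_gt0 lT _ h).
  by case: hr => *; split; apply: sST.
- apply: le_trans h2; apply: ler_cnt => s [hs hc]; split=> //.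
  by apply: mono hs => x y z [].
Qed.

(** Here both choices are made in [octa_t]; the first, unlike the one inside [stage], makes the
    proportion of unpopular rectangles as small as desired. *)
Lemma stage_pop T (e g : R) :
  0 < e -> 0 < g -> linear3 T -> e * n%:R ^+ 5 <= (octas T)%:R ->
  exists S, [/\ sub3 S T, rich e * n%:R ^+ 5 <= (octas S)%:R
    & #r[R] (unpop n T (g * e ^+ 2 / 4) S) <= g * n%:R ^+ 4].
Proof.
move=> e0 g0 lT he.
have c3 : #|[the finType of (X * Y * X)%type]| = (n ^ 3)%N by rewrite !card_prod cX cY; ring.
have c4 : #|[the finType of (X * Y * X * Y)%type]| = (n ^ 4)%N by rewrite !card_prod cX cY; ring.
have [||||S [sST _ h1 h2]] := stage (D := octa_t T) (inc := @in_rect X Y Z) e0 g0 lT he c3.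
- by rewrite c4 expn_gt0 n_gt0.
- move=> [[[x y] u] v] S S' sSS [a [al [be [m [h1 h2 h3 h4]]]]].
  by exists a, al, be, m; split; apply: sSS.
- by move=> w; exact: octa_t_sub.
- by [].
exists S; split=> //; rewrite c4 natrX in h2; apply: le_trans h2; apply: ler_cnt.
move=> [[[x y] u] v] [a [al [be [m [hr nP]]]]]; split; first by exists a, al, be, m.
rewrite ltNge; apply/negP => h; apply: nP.
apply: (translated_rect_pop cX cY cZ n_gt0 lT _ h).
by case: hr => *; split; apply: sST.
Qed.

(* Two rectangles with a common label a, whose labels al, al2 recur in a common row x0. *)
Definition lambda_pat S x y u v x2 u2 v2 x0 y2 w w2 a al be m al2 be2 m2 :=
  [/\ rect S x y u v a al be m, rect S x2 y2 u2 v2 a al2 be2 m2, S x0 w al & S x0 w2 al2].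

(** The trace of a [moved_l] copy in its row [x]: the arguments are the data kept by the
    translation, whereas [a], [al] and [al2] become internal to the row. *)
Definition H1_row A (etaP : R) w w2 be be2 m m2 x := exists al al2 a,
  [/\ A x w al, A x w2 al2, Pop n A etaP a al be m & Pop n A etaP a al2 be2 m2].

Definition H1 A (etaP eta1 : R) w w2 be be2 m m2 :=
  eta1 * n%:R <= #r[R] (H1_row A etaP w w2 be be2 m m2).

(** In a linear system these eight coordinates determine a whole [lambda_pat]: the first cell gives
    [a], hence [y2], and [x0] gives [w] and [w2]. Bad patterns are therefore measured against
    n^8. *)
Definition PL := (X * Y * X * Y * X * X * Y * X)%type.

Definition bad_l A (etaP eta1 : R) S (t : PL) := let: (x, y, u, v, x2, u2, v2, x0) := t in
  exists y2 w w2 a al be m al2 be2 m2,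
    lambda_pat S x y u v x2 u2 v2 x0 y2 w w2 a al be m al2 be2 m2 /\ ~ H1 A etaP eta1 w w2 be be2 m m2.

(** Only cells in the rows [x], [x2], [x0] have to lie in [S], since only these are translated;
    those in the rows [u], [u2] stay. *)
Definition inc_l T (t : PL) S := let: (x, y, u, v, x2, u2, v2, x0) := t in
  exists y2 w w2 a al be m al2 be2 m2,
    lambda_pat T x y u v x2 u2 v2 x0 y2 w w2 a al be m al2 be2 m2 /\
    ([/\ S x y a, S x v al, S x2 y2 a & S x2 v2 al2] /\ S x0 w al /\ S x0 w2 al2).

(* The configuration obtained from a [lambda_pat] by moving the rows x, x2, x0 with an
   [octa_l]-parameter: columns, hence w and w2, stay put, and so do be, m, be2 and m2. *)
Definition moved_l T y v y2 v2 w w2 xh0 xh xh2 ah alh alh2 :=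
  [/\ T xh0 w alh, T xh0 w2 alh2 & T xh v alh] /\
  [/\ T xh y ah, T xh2 y2 ah & T xh2 v2 alh2].

(** A parameter (p, q, y0) sends [x0] to a row [xh0] through a chain of four cells. Given [xh0], [p]
    and [y0], this chain determines [q], so at most n^2 parameters give the same row. *)
Lemma moved_l_count T x y u v x2 u2 v2 x0 y2 w w2 a al be m al2 be2 m2 : linear3 T ->
  lambda_pat T x y u v x2 u2 v2 x0 y2 w w2 a al be m al2 be2 m2 ->
  #r[R] (fun p => inc_l T (x, y, u, v, x2, u2, v2, x0) (octa_l T p)) <=
  #r[R] (fun xh0 => exists xh xh2 ah alh alh2, moved_l T y v y2 v2 w w2 xh0 xh xh2 ah alh alh2) * n%:R ^+ 2.
Proof.
move=> lT hl.
set M := fun xh0 : X => _.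
have -> : #r[R] M * n%:R ^+ 2 = #r[R] (fun p : X * (X * Y) => M p.1 /\ True).
  by rewrite (cnt_prod M (fun _ : X * Y => True)) cnt_true card_prod cX cY !natrM expr2.
apply: (ler_cnt_rel (S := fun (q : X * X * Y) (p : X * (X * Y)) =>
  p.2 = (q.1.1, q.2) /\
  exists c d y4, [/\ T x0 q.2 c, T q.1.1 y4 c, T q.1.2 y4 d & T p.1 q.2 d])).
  move=> [[p q] y0] [y2' [w' [w2' [a' [al' [be' [m' [al2' [be2' [m2' [hl' hS]]]]]]]]]]].
  (* This equation lets the [match] below find [x0], [w], [w2] under whatever names survive [lin];
     it looks for another row meeting both columns, the image of [x0]. *)
  have mk : (x0, w, w2) = (x0, w, w2) by [].
  rewrite /lambda_pat /rect /octa_l /octa /= in hl hl' hS; destr; lin lT.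
  match goal with mk : (?x, ?w, ?w2) = _, H : T ?q ?w _, H' : T ?q ?w2 _ |- _ =>
    tryif constr_eq q x then fail else exists (q, (p, y0)) end.
    by split=> //; rewrite /M /moved_l /=; do 5 eexists; chase.
  by split=> //=; do 3 eexists; chase.
move=> [[p q] y0] [[p' q'] y0'] [x3 [x5 y5]] _ _ /=.
move=> [[? ?] h1] [[? ?] h2]; subst; destr; by lin lT.
Qed.

Definition unmoved1 A (etaP : R) T (p : PL * X) := let: (x, y, u, v, x2, u2, v2, x0) := p.1 in
  exists y2 w w2 a al be m al2 be2 m2 xh xh2 ah alh alh2,
    [/\ lambda_pat T x y u v x2 u2 v2 x0 y2 w w2 a al be m al2 be2 m2,
        moved_l T y v y2 v2 w w2 p.2 xh xh2 ah alh alh2 & ~ Pop n A etaP ah alh be m].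

Definition unmoved2 A (etaP : R) T (p : PL * X) := let: (x, y, u, v, x2, u2, v2, x0) := p.1 in
  exists y2 w w2 a al be m al2 be2 m2 xh xh2 ah alh alh2,
    [/\ lambda_pat T x y u v x2 u2 v2 x0 y2 w w2 a al be m al2 be2 m2,
        moved_l T y v y2 v2 w w2 p.2 xh xh2 ah alh alh2 & ~ Pop n A etaP ah alh2 be2 m2].

(** The unpopular rectangle in rows [xh], [u] and the five coordinates [x], [x2], [u2], [v2], [x0]
    recover everything: they give [w], and [alh] in column [w] gives the translated row. *)
Lemma unmoved1_count A (etaP : R) T : linear3 T ->
  #r[R] (unmoved1 A etaP T) <= #r[R] (unpop n A etaP T) * n%:R ^+ 5.
Proof.
move=> lT.
have -> : #r[R] (unpop n A etaP T) * n%:R ^+ 5 =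
    #r[R] (fun p : (X * Y * X * Y) * (X * X * X * Y * X) => unpop n A etaP T p.1 /\ True).
  by rewrite (cnt_prod (unpop n A etaP T) (fun _ : (X * X * X * Y * X)%type => True)) cnt_true
    !card_prod cX cY !natrM; ring.
apply: (ler_cnt_rel (S := fun (p : PL * X) (q : (X * Y * X * Y) * (X * X * X * Y * X)) =>
  let: (x, y, u, v, x2, u2, v2, x0) := p.1 in
  exists y2 w w2 a al be m al2 be2 m2 xh xh2 ah alh alh2,
    [/\ lambda_pat T x y u v x2 u2 v2 x0 y2 w w2 a al be m al2 be2 m2,
        moved_l T y v y2 v2 w w2 p.2 xh xh2 ah alh alh2
      & q = ((xh, y, u, v), (x, x2, u2, v2, x0))])).
  move=> [[[[[[[[x y] u] v] x2] u2] v2] x0] xh0] [y2 [w [w2 [a [al [be [m [al2 [be2 [m2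
    [xh [xh2 [ah [alh [alh2 [hl hm np]]]]]]]]]]]]]]]].
  exists ((xh, y, u, v), (x, x2, u2, v2, x0)).
    split=> //; exists ah, alh, be, m; split=> //.
    by rewrite /lambda_pat /rect /moved_l in hl hm *; destr; chase.
  by exists y2, w, w2, a, al, be, m, al2, be2, m2, xh, xh2, ah, alh, alh2.
move=> [[[[[[[[x y] u] v] x2] u2] v2] x0] xh0] [[[[[[[[x' y'] u'] v'] x2'] u2'] v2'] x0'] xh0'] q _ _.
move=> [y2 [w [w2 [a [al [be [m [al2 [be2 [m2 [xh [xh2 [ah [alh [alh2 [hl hm ->]]]]]]]]]]]]]]]].
move=> [y2' [w' [w2' [a' [al' [be' [m' [al2' [be2' [m2'
  [xh' [xh2' [ah' [alh' [alh2' [hl' hm']]]]]]]]]]]]]]]].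
move=> [? ? ? ? ? ? ? ? ?]; subst; rewrite /lambda_pat /rect /moved_l /= in hl hm hl' hm'; destr.
by lin lT.
Qed.

Lemma unmoved2_count A (etaP : R) T : linear3 T ->
  #r[R] (unmoved2 A etaP T) <= #r[R] (unpop n A etaP T) * n%:R ^+ 5.
Proof.
move=> lT.
have -> : #r[R] (unpop n A etaP T) * n%:R ^+ 5 =
    #r[R] (fun p : (X * Y * X * Y) * (X * X * X * Y * X) => unpop n A etaP T p.1 /\ True).
  by rewrite (cnt_prod (unpop n A etaP T) (fun _ : (X * X * X * Y * X)%type => True)) cnt_true
    !card_prod cX cY !natrM; ring.
apply: (ler_cnt_rel (S := fun (p : PL * X) (q : (X * Y * X * Y) * (X * X * X * Y * X)) =>
  let: (x, y, u, v, x2, u2, v2, x0) := p.1 in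
  exists y2 w w2 a al be m al2 be2 m2 xh xh2 ah alh alh2,
    [/\ lambda_pat T x y u v x2 u2 v2 x0 y2 w w2 a al be m al2 be2 m2,
        moved_l T y v y2 v2 w w2 p.2 xh xh2 ah alh alh2
      & q = ((xh2, y2, u2, v2), (x2, x, u, v, x0))])).
  move=> [[[[[[[[x y] u] v] x2] u2] v2] x0] xh0] [y2 [w [w2 [a [al [be [m [al2 [be2 [m2
    [xh [xh2 [ah [alh [alh2 [hl hm np]]]]]]]]]]]]]]]].
  exists ((xh2, y2, u2, v2), (x2, x, u, v, x0)).
    split=> //; exists ah, alh2, be2, m2; split=> //.
    by rewrite /lambda_pat /rect /moved_l in hl hm *; destr; chase.
  by exists y2, w, w2, a, al, be, m, al2, be2, m2, xh, xh2, ah, alh, alh2.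
move=> [[[[[[[[x y] u] v] x2] u2] v2] x0] xh0] [[[[[[[[x' y'] u'] v'] x2'] u2'] v2'] x0'] xh0'] q _ _.
move=> [y2 [w [w2 [a [al [be [m [al2 [be2 [m2 [xh [xh2 [ah [alh [alh2 [hl hm ->]]]]]]]]]]]]]]]].
move=> [y2' [w' [w2' [a' [al' [be' [m' [al2' [be2' [m2'
  [xh' [xh2' [ah' [alh' [alh2' [hl' hm']]]]]]]]]]]]]]]].
move=> [? ? ? ? ? ? ? ? ?]; subst; rewrite /lambda_pat /rect /moved_l /= in hl hm hl' hm'; destr.
by lin lT.
Qed.

(** A bad pattern is scarce, which costs half of [g], or it has [eta * n] translated rows. In the
    latter case fewer than half of them can be rows of [H1_row], so more than [eta / 2 * n] exhibit
    an unpopular rectangle; the two [unmoved] counts bound such pairs by g eta / 4 n^9, which pays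
    for the other half. *)
Lemma stage_l A T (e g etaP : R) : let eta := g / 2 * e ^+ 2 / 4 in
  0 < e -> 0 < g -> linear3 A -> sub3 T A -> e * n%:R ^+ 5 <= (octas T)%:R ->
  #r[R] (unpop n A etaP T) <= g * eta / 8 * n%:R ^+ 4 ->
  exists S, [/\ sub3 S T, rich e * n%:R ^+ 5 <= (octas S)%:R
    & #r[R] (bad_l A etaP (eta / 2) S) <= g * n%:R ^+ 8].
Proof.
move=> eta e0 g0 lA sTA he hu; have lT := linear3S sTA lA.
have eta0 : 0 < eta by rewrite divr_gt0 // mulr_gt0 ?exprn_gt0 // divr_gt0.
have c3 : #|[the finType of (X * X * Y)%type]| = (n ^ 3)%N by rewrite !card_prod cX cY; ring.
have c8 : #|[the finType of PL]| = (n ^ 8)%N by rewrite !card_prod cX cY; ring.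
have g20 : 0 < g / 2 by rewrite divr_gt0.
have [||||S [sST _ h1 h2]] := stage (D := octa_l T) (inc := inc_l T) e0 g20 lT he c3.
- by rewrite c8 expn_gt0 n_gt0.
- move=> [[[[[[[x y] u] v] x2] u2] v2] x0] S S' sSS [y2 [w [w2 [a [al [be [m [al2 [be2 [m2 [hl hS]]]]]]]]]]].
  exists y2, w, w2, a, al, be, m, al2, be2, m2; split=> //.
  by destr; do !split; apply: sSS.
- by move=> p; exact: octa_l_sub.
- by move=> x y; exact: octa_at_l.
exists S; split=> //; rewrite c8 natrX -/eta in h2.
pose good (t : PL) := let: (x, y, u, v, x2, u2, v2, x0) := t in
  exists y2 w w2 a al be m al2 be2 m2,
  [/\ lambda_pat T x y u v x2 u2 v2 x0 y2 w w2 a al be m al2 be2 m2,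
      ~ H1 A etaP (eta / 2) w w2 be be2 m m2 &
      eta * n%:R <= #r[R] (fun xh0 => exists xh xh2 ah alh alh2,
        moved_l T y v y2 v2 w w2 xh0 xh xh2 ah alh alh2)].
have -> : g * n%:R ^+ 8 = g / 2 * n%:R ^+ 8 + g / 2 * n%:R ^+ 8 by field.
have hg : #r[R] good <= g / 2 * n%:R ^+ 8.
  have hh (t : PL) : good t ->
      eta / 2 * n%:R <= #r[R] (fun xh0 => unmoved1 A etaP T (t, xh0) \/ unmoved2 A etaP T (t, xh0)).
    move: t => [[[[[[[x y] u] v] x2] u2] v2] x0]
      [y2 [w [w2 [a [al [be [m [al2 [be2 [m2 [hl nH hm]]]]]]]]]]].
    have h3 := ler_cnt_or (R := R) (Q := H1_row A etaP w w2 be be2 m m2)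
      (P := fun xh0 => exists xh xh2 ah alh alh2, moved_l T y v y2 v2 w w2 xh0 xh xh2 ah alh alh2)
      (S := fun xh0 => unmoved1 A etaP T ((x, y, u, v, x2, u2, v2, x0), xh0) \/
                       unmoved2 A etaP T ((x, y, u, v, x2, u2, v2, x0), xh0)).
    have /h3 {h3} : forall xh0 : X,
      (exists xh xh2 ah alh alh2, moved_l T y v y2 v2 w w2 xh0 xh xh2 ah alh alh2) ->
      H1_row A etaP w w2 be be2 m m2 xh0 \/
      (unmoved1 A etaP T (x, y, u, v, x2, u2, v2, x0, xh0) \/
       unmoved2 A etaP T (x, y, u, v, x2, u2, v2, x0, xh0)).
      move=> xh0 [xh [xh2 [ah [alh [alh2 hm']]]]].
      have [p1|np1] := pselect (Pop n A etaP ah alh be m); last first.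
        by right; left; exists y2, w, w2, a, al, be, m, al2, be2, m2, xh, xh2, ah, alh, alh2.
      have [p2|np2] := pselect (Pop n A etaP ah alh2 be2 m2); last first.
        by right; right; exists y2, w, w2, a, al, be, m, al2, be2, m2, xh, xh2, ah, alh, alh2.
      left; exists alh, alh2, ah; split=> //; case: hm' => -[k3 k4 _] _; exact: sTA.
    move=> h3; have := le_trans hm h3; move/negP: nH; rewrite -ltNge; lra.
  have h3 := cnt_markov (fun (t : PL) (xh0 : X) => unmoved1 A etaP T (t, xh0) \/ unmoved2 A etaP T (t, xh0)) (eta / 2 * n%:R).
  have h4 : #r[R] good * (eta / 2 * n%:R) <= 2 * (g * eta / 8 * n%:R ^+ 4 * n%:R ^+ 5).
    apply: le_trans (_ : #r[R] (unmoved1 A etaP T) + #r[R] (unmoved2 A etaP T) <= _); last first.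
      have := unmoved1_count A etaP lT; have := unmoved2_count A etaP lT.
      have : #r[R] (unpop n A etaP T) * n%:R ^+ 5 <= g * eta / 8 * n%:R ^+ 4 * n%:R ^+ 5.
        by rewrite ler_pM2r ?exprn_gt0.
      lra.
    apply: le_trans (le_trans h3 _).
      by rewrite ler_pM2r ?mulr_gt0 ?invr_gt0 //; apply: ler_cnt.
    by apply: ler_cnt_or => -[t xh0].
  rewrite -(@ler_pM2r _ (eta / 2 * n%:R)) ?mulr_gt0 ?invr_gt0 //.
  by apply: le_trans h4 _; apply: le_of_eq; field.
apply: le_trans (lerD h2 hg); apply: ler_cnt_or.
move=> [[[[[[[x y] u] v] x2] u2] v2] x0] [y2 [w [w2 [a [al [be [m [al2 [be2 [m2 [hl nH]]]]]]]]]]].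
have hlT : lambda_pat T x y u v x2 u2 v2 x0 y2 w w2 a al be m al2 be2 m2.
  by rewrite /lambda_pat /rect in hl *; destr; do !split; apply: sST.
have [h|h] := ltP (#r[R] (fun p => inc_l T (x, y, u, v, x2, u2, v2, x0) (octa_l T p)))
  (eta * n%:R ^+ 3).
  left; split=> //; exists y2, w, w2, a, al, be, m, al2, be2, m2; split=> //.
  by rewrite /lambda_pat /rect in hl; destr; do !split.
right; exists y2, w, w2, a, al, be, m, al2, be2, m2; split=> //.
have := le_trans h (moved_l_count lT hlT).
by rewrite (_ : eta * n%:R ^+ 3 = eta * n%:R * n%:R ^+ 2) ?ler_pM2r ?exprn_gt0 //; ring.
Qed.

End Stages.

(** * Column translations, and the three stages together *)

Section StageR.
Variables (R : realType) (X Y Z : finType) (n : nat).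
Hypotheses (cX : #|X| = n) (cY : #|Y| = n) (cZ : #|Z| = n) (n_gt0 : (0 < n)%N).
Implicit Types T S A : rel3 X Y Z.

Let N0 : 0 < n%:R :> R. Proof. by rewrite ltr0n. Qed.
Let N0' : n%:R != 0 :> R. Proof. by rewrite gt_eqF. Qed.

Definition sigma_pat S x y u v x2 u2 v2 x0 y0 y2 w w2 s s2 a al be m al2 be2 m2 :=
  [/\ lambda_pat S x y u v x2 u2 v2 x0 y2 w w2 a al be m al2 be2 m2, S s y0 be & S s2 y0 be2].

(** Column translations make [be] and [be2] internal as well, as row translations did for [a], [al],
    [al2]. What remains is a link between [m] and [m2] through the positions [w], [w2], [s],
    [s2]. *)
Definition H2_col A (etaP eta1 : R) w w2 s s2 m m2 y := exists be be2,
  [/\ A s y be, A s2 y be2 & H1 n A etaP eta1 w w2 be be2 m m2].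

Definition H2 A (etaP eta1 eta2 : R) w w2 s s2 m m2 :=
  eta2 * n%:R <= #r[R] (H2_col A etaP eta1 w w2 s s2 m m2).

Definition PR := (PL X Y * Y)%type.

Definition bad_r A (etaP eta1 eta2 : R) S (t : PR) :=
  let: (x, y, u, v, x2, u2, v2, x0, y0) := t in
  exists y2 w w2 s s2 a al be m al2 be2 m2,
    sigma_pat S x y u v x2 u2 v2 x0 y0 y2 w w2 s s2 a al be m al2 be2 m2 /\
    ~ H2 A etaP eta1 eta2 w w2 s s2 m m2.

Definition inc_r T (t : PR) S := let: (x, y, u, v, x2, u2, v2, x0, y0) := t in
  exists y2 w w2 s s2 a al be m al2 be2 m2,
    sigma_pat T x y u v x2 u2 v2 x0 y0 y2 w w2 s s2 a al be m al2 be2 m2 /\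
    ([/\ S x y a, S u y be, S x2 y2 a & S u2 y2 be2] /\ S s y0 be /\ S s2 y0 be2).

Definition moved_r T x u x2 u2 s s2 yh0 yh yh2 ah beh beh2 :=
  [/\ T s yh0 beh, T s2 yh0 beh2 & T u yh beh] /\
  [/\ T x yh ah, T x2 yh2 ah & T u2 yh2 beh2].

Lemma moved_r_count T x y u v x2 u2 v2 x0 y0 y2 w w2 s s2 a al be m al2 be2 m2 : linear3 T ->
  sigma_pat T x y u v x2 u2 v2 x0 y0 y2 w w2 s s2 a al be m al2 be2 m2 ->
  #r[R] (fun p => inc_r T (x, y, u, v, x2, u2, v2, x0, y0) (octa_r T p)) <=
  #r[R] (fun yh0 => exists yh yh2 ah beh beh2, moved_r T x u x2 u2 s s2 yh0 yh yh2 ah beh beh2)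
    * n%:R ^+ 2.
Proof.
move=> lT hl.
set M := fun yh0 : Y => _.
have -> : #r[R] M * n%:R ^+ 2 = #r[R] (fun p : Y * (Y * X) => M p.1 /\ True).
  by rewrite (cnt_prod M (fun _ : Y * X => True)) cnt_true card_prod cX cY !natrM expr2.
apply: (ler_cnt_rel (S := fun (q : Y * Y * X) (p : Y * (Y * X)) =>
  p.2 = (q.1.1, q.2) /\
  exists b d x4, [/\ T q.2 y0 b, T x4 q.1.1 b, T x4 q.1.2 d & T q.2 p.1 d])).
  move=> [[p q] xx] [y2' [w' [w2' [s' [s2' [a' [al' [be' [m' [al2' [be2' [m2' [hl' hS]]]]]]]]]]]]].
  have mk : (y0, s, s2) = (y0, s, s2) by [].
  rewrite /sigma_pat /lambda_pat /rect /octa_r /octa /= in hl hl' hS; destr; lin lT.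
  match goal with mk : (?x, ?w, ?w2) = _, H : T ?w ?q _, H' : T ?w2 ?q _ |- _ =>
    tryif constr_eq q x then fail else exists (q, (p, xx)) end.
    by split=> //; rewrite /M /moved_r /=; do 5 eexists; chase.
  by split=> //=; do 3 eexists; chase.
move=> [[p q] xx] [[p' q'] xx'] [x3 [x5 y5]] _ _ /=.
move=> [[? ?] h1] [[? ?] h2]; subst; destr; by lin lT.
Qed.

Definition unmoved A (etaP eta1 : R) T (p : PR * Y) :=
  let: (x, y, u, v, x2, u2, v2, x0, y0) := p.1 in
  exists y2 w w2 s s2 a al be m al2 be2 m2 yh yh2 ah beh beh2,
    [/\ sigma_pat T x y u v x2 u2 v2 x0 y0 y2 w w2 s s2 a al be m al2 be2 m2,
        moved_r T x u x2 u2 s s2 p.2 yh yh2 ah beh beh2 & ~ H1 n A etaP eta1 w w2 beh beh2 m m2].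

(** A translated copy that fails [H1] is a [bad_l] pattern with [yh] in place of [y]; adding [y] and
    [y0] recovers the original and the translated column. *)
Lemma unmoved_count A (etaP eta1 : R) T : linear3 T ->
  #r[R] (unmoved A etaP eta1 T) <= #r[R] (bad_l n A etaP eta1 T) * n%:R ^+ 2.
Proof.
move=> lT.
have -> : #r[R] (bad_l n A etaP eta1 T) * n%:R ^+ 2 =
    #r[R] (fun p : PL X Y * (Y * Y) => bad_l n A etaP eta1 T p.1 /\ True).
  by rewrite (cnt_prod (bad_l n A etaP eta1 T) (fun _ : (Y * Y)%type => True)) cnt_true
    !card_prod cY !natrM; ring.
apply: (ler_cnt_rel (S := fun (p : PR * Y) (q : PL X Y * (Y * Y)) =>
  let: (x, y, u, v, x2, u2, v2, x0, y0) := p.1 in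
  exists y2 w w2 s s2 a al be m al2 be2 m2 yh yh2 ah beh beh2,
    [/\ sigma_pat T x y u v x2 u2 v2 x0 y0 y2 w w2 s s2 a al be m al2 be2 m2,
        moved_r T x u x2 u2 s s2 p.2 yh yh2 ah beh beh2
      & q = ((x, yh, u, v, x2, u2, v2, x0), (y, y0))])).
  move=> [[[[[[[[[x y] u] v] x2] u2] v2] x0] y0] yh0] [y2 [w [w2 [s [s2 [a [al [be [m [al2 [be2 [m2
    [yh [yh2 [ah [beh [beh2 [hl hm np]]]]]]]]]]]]]]]]]].
  exists ((x, yh, u, v, x2, u2, v2, x0), (y, y0)).
    split=> //; exists yh2, w, w2, ah, al, beh, m, al2, beh2, m2; split=> //.
    by rewrite /sigma_pat /lambda_pat /rect /moved_r in hl hm *; destr; chase.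
  by exists y2, w, w2, s, s2, a, al, be, m, al2, be2, m2, yh, yh2, ah, beh, beh2.
move=> [[[[[[[[[x y] u] v] x2] u2] v2] x0] y0] yh0]
  [[[[[[[[[x' y'] u'] v'] x2'] u2'] v2'] x0'] y0'] yh0'] q _ _.
move=> [y2 [w [w2 [s [s2 [a [al [be [m [al2 [be2 [m2 [yh [yh2 [ah [beh [beh2 [hl hm ->]]]]]]]]]]]]]]]]]].
move=> [y2' [w' [w2' [s' [s2' [a' [al' [be' [m' [al2' [be2' [m2'
  [yh' [yh2' [ah' [beh' [beh2' [hl' hm']]]]]]]]]]]]]]]]]].
move=> [? ? ? ? ? ? ? ? ? ?]; subst; rewrite /sigma_pat /lambda_pat /rect /moved_r /= in hl hm hl' hm'; destr.
by lin lT.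
Qed.

(** The argument of [stage_l] with [octa_r] for [octa_l] and [bad_l] in the role of the unpopular
    rectangles. *)
Lemma stage_r A T (e g etaP eta1 : R) : let eta := g / 2 * e ^+ 2 / 4 in
  0 < e -> 0 < g -> linear3 A -> sub3 T A -> e * n%:R ^+ 5 <= (octas T)%:R ->
  #r[R] (bad_l n A etaP eta1 T) <= g * eta / 4 * n%:R ^+ 8 ->
  exists S, [/\ sub3 S T, e ^+ 2 / 2 * n%:R ^+ 2 <= (csize S)%:R
    & #r[R] (bad_r A etaP eta1 (eta / 2) S) <= g * n%:R ^+ 9].
Proof.
move=> eta e0 g0 lA sTA he hu; have lT := linear3S sTA lA.
have eta0 : 0 < eta by rewrite divr_gt0 // mulr_gt0 ?exprn_gt0 // divr_gt0.
have c3 : #|[the finType of (Y * Y * X)%type]| = (n ^ 3)%N by rewrite !card_prod cX cY; ring.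
have c9 : #|[the finType of PR]| = (n ^ 9)%N by rewrite !card_prod cX cY; ring.
have g20 : 0 < g / 2 by rewrite divr_gt0.
have [||||S [sST h1 _ h2]] := stage cX cY cZ n_gt0 (D := octa_r T) (inc := inc_r T) e0 g20 lT he c3.
- by rewrite c9 expn_gt0 n_gt0.
- move=> [[[[[[[[x y] u] v] x2] u2] v2] x0] y0] S S' sSS
    [y2 [w [w2 [s [s2 [a [al [be [m [al2 [be2 [m2 [hl hS]]]]]]]]]]]]].
  exists y2, w, w2, s, s2, a, al, be, m, al2, be2, m2; split=> //.
  by destr; do !split; apply: sSS.
- by move=> p; exact: octa_r_sub.
- by move=> x y; exact: octa_at_r.
exists S; split=> //; rewrite c9 natrX -/eta in h2.
pose good (t : PR) := let: (x, y, u, v, x2, u2, v2, x0, y0) := t in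
  exists y2 w w2 s s2 a al be m al2 be2 m2,
  [/\ sigma_pat T x y u v x2 u2 v2 x0 y0 y2 w w2 s s2 a al be m al2 be2 m2,
      ~ H2 A etaP eta1 (eta / 2) w w2 s s2 m m2 &
      eta * n%:R <= #r[R] (fun yh0 => exists yh yh2 ah beh beh2,
        moved_r T x u x2 u2 s s2 yh0 yh yh2 ah beh beh2)].
have -> : g * n%:R ^+ 9 = g / 2 * n%:R ^+ 9 + g / 2 * n%:R ^+ 9 by field.
have hg : #r[R] good <= g / 2 * n%:R ^+ 9.
  have hh (t : PR) : good t ->
      eta / 2 * n%:R <= #r[R] (fun yh0 => unmoved A etaP eta1 T (t, yh0)).
    move: t => [[[[[[[[x y] u] v] x2] u2] v2] x0] y0]
      [y2 [w [w2 [s [s2 [a [al [be [m [al2 [be2 [m2 [hl nH hm]]]]]]]]]]]]].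
    have h3 : #r[R] (fun yh0 => exists yh yh2 ah beh beh2,
        moved_r T x u x2 u2 s s2 yh0 yh yh2 ah beh beh2) <=
      #r[R] (H2_col A etaP eta1 w w2 s s2 m m2) +
      #r[R] (fun yh0 => unmoved A etaP eta1 T ((x, y, u, v, x2, u2, v2, x0, y0), yh0)).
      apply: ler_cnt_or => yh0 [yh [yh2 [ah [beh [beh2 hm']]]]].
      have [p1|np1] := pselect (H1 n A etaP eta1 w w2 beh beh2 m m2); last first.
        by right; exists y2, w, w2, s, s2, a, al, be, m, al2, be2, m2, yh, yh2, ah, beh, beh2.
      by left; exists beh, beh2; case: hm' => -[k3 k4 _] _; split=> //; exact: sTA.
    have := le_trans hm h3; move/negP: nH; rewrite -ltNge; lra.
  have h3 := cnt_markov (fun (t : PR) (yh0 : Y) => unmoved A etaP eta1 T (t, yh0)) (eta / 2 * n%:R).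
  have h4 : #r[R] good * (eta / 2 * n%:R) <= g * eta / 4 * n%:R ^+ 8 * n%:R ^+ 2.
    apply: le_trans (_ : #r[R] (unmoved A etaP eta1 T) <= _); last first.
      apply: le_trans (unmoved_count A etaP eta1 lT) _.
      by rewrite ler_pM2r ?exprn_gt0.
    apply: le_trans (le_trans h3 _).
      by rewrite ler_pM2r ?mulr_gt0 ?invr_gt0 //; apply: ler_cnt.
    by apply: ler_cnt => -[t yh0].
  rewrite -(@ler_pM2r _ (eta / 2 * n%:R)) ?mulr_gt0 ?invr_gt0 //.
  by apply: le_trans h4 _; apply: le_of_eq; field.
apply: le_trans (lerD h2 hg); apply: ler_cnt_or.
move=> [[[[[[[[x y] u] v] x2] u2] v2] x0] y0]
  [y2 [w [w2 [s [s2 [a [al [be [m [al2 [be2 [m2 [hl nH]]]]]]]]]]]]].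
have hlT : sigma_pat T x y u v x2 u2 v2 x0 y0 y2 w w2 s s2 a al be m al2 be2 m2.
  by rewrite /sigma_pat /lambda_pat /rect in hl *; destr; do !split; apply: sST.
have [h|h] := ltP (#r[R] (fun p => inc_r T (x, y, u, v, x2, u2, v2, x0, y0) (octa_r T p)))
  (eta * n%:R ^+ 3).
  left; split=> //; exists y2, w, w2, s, s2, a, al, be, m, al2, be2, m2; split=> //.
  by rewrite /sigma_pat /lambda_pat /rect in hl; destr; do !split.
right; exists y2, w, w2, s, s2, a, al, be, m, al2, be2, m2; split=> //.
have := le_trans h (moved_r_count lT hlT).
by rewrite (_ : eta * n%:R ^+ 3 = eta * n%:R * n%:R ^+ 2) ?ler_pM2r ?exprn_gt0 //; ring.
Qed.

Lemma unpop_sub A (eta : R) S T t : sub3 S T -> unpop n A eta S t -> unpop n A eta T t.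
Proof.
move=> sST [a [al [be [m [hr nP]]]]]; exists a, al, be, m; split=> //.
by case: hr => *; split; apply: sST.
Qed.

End StageR.

(** The density [b] is fixed before the error [g]: the pruning needs [g] small in terms of [b]. *)
Lemma three_stages (R : realType) (e : R) : 0 < e -> exists2 b : R, 0 < b &
  forall g : R, 0 < g -> exists etaP eta1 eta2 : R, [/\ 0 < etaP, 0 < eta1, 0 < eta2 &
  forall (X Y Z : finType) (n : nat) (A : rel3 X Y Z),
  #|X| = n -> #|Y| = n -> #|Z| = n -> (0 < n)%N -> linear3 A ->
  e * n%:R ^+ 5 <= (octas A)%:R ->
  exists S, [/\ sub3 S A, b * n%:R ^+ 2 <= (csize S)%:R,
    #r[R] (unpop n A etaP S) <= g * n%:R ^+ 4 &
    #r[R] (bad_r n A etaP eta1 eta2 S) <= g * n%:R ^+ 9]].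
Proof.
move=> e0; pose e0' := rich e; pose e1 := rich e0'.
have e00 : 0 < e0' by apply: rich_gt0.
have e10 : 0 < e1 by apply: rich_gt0.
exists (e1 ^+ 2 / 2) => [|g g0]; first by rewrite divr_gt0 ?exprn_gt0.
pose etaR := g / 2 * e1 ^+ 2 / 4.
have etaR0 : 0 < etaR by rewrite divr_gt0 // mulr_gt0 ?exprn_gt0 // divr_gt0.
(* Errors are fixed backwards, each being what the next stage accepts as input. [gP] is also at most
   [g], as the bound on unpopular rectangles is inherited by the final subsystem. *)
pose gL := g * etaR / 4.
have gL0 : 0 < gL by rewrite divr_gt0 // mulr_gt0.
pose etaL := gL / 2 * e0' ^+ 2 / 4.
have etaL0 : 0 < etaL by rewrite divr_gt0 // mulr_gt0 ?exprn_gt0 // divr_gt0.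
pose gP := Num.min g (gL * etaL / 8).
have gP0 : 0 < gP by rewrite lt_min g0 divr_gt0 // mulr_gt0.
have gPg : gP <= g by rewrite ge_min lexx.
have gPL : gP <= gL * etaL / 8 by rewrite ge_min lexx orbT.
exists (gP * e ^+ 2 / 4), (etaL / 2), (etaR / 2); split.
- by rewrite divr_gt0 // mulr_gt0 ?exprn_gt0.
- by rewrite divr_gt0.
- by rewrite divr_gt0.
move=> X Y Z n A cX cY cZ n0 lA he.
have N0 : 0 < n%:R :> R by rewrite ltr0n.
have [A0 [sA0 r0 u0]] := stage_pop cX cY cZ n0 e0 gP0 lA he.
have [|A1 [sA1 r1 u1]] := stage_l cX cY cZ n0 e00 gL0 lA sA0 r0 (etaP := gP * e ^+ 2 / 4).
  by apply: le_trans u0 _; rewrite ler_pM2r ?exprn_gt0.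
have sA1A : sub3 A1 A by move=> x y z /sA1 /sA0.
have [S [sS c u2]] := stage_r cX cY cZ n0 e10 g0 lA sA1A r1 u1.
exists S; split=> // [x y z /sS /sA1A //|].
apply: le_trans (_ : gP * n%:R ^+ 4 <= _); last by rewrite ler_pM2r ?exprn_gt0.
apply: le_trans u0; apply: ler_cnt => t; apply: unpop_sub => x y z /sS /sA1 //.
Qed.

(** * Upper bound: configurations that start from a given label *)

Lemma cnt_ex_le (R : realType) (A B : finType) (P : A -> Prop) (Q : A -> B -> Prop) (k K : R) :
  0 <= K -> #r[R] P <= k -> (forall a, P a -> #r[R] (Q a) <= K) ->
  #r[R] (fun b => exists2 a, P a & Q a b) <= k * K.
Proof.
move=> K0 hP hQ; apply: le_trans (_ : #r[R] P * K <= _); last exact: ler_wpM2r.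
apply: le_trans (cnt_pair_le hQ); apply: (ler_cnt_rel (S := fun b p => p.2 = b)).
  by move=> b [a Pa Qab]; exists (a, b).
by move=> b b' p _ _ <- <-.
Qed.

Lemma cnt_uniq1 (R : realType) (A : finType) (P : A -> Prop) :
  (forall a b, P a -> P b -> a = b) -> #r[R] P <= 1.
Proof. by move=> /cnt_uniq h; rewrite (ler_nat R _ 1). Qed.

Section Config.
Variables (R : realType) (X Y Z : finType) (n : nat).
Hypotheses (cX : #|X| = n) (cY : #|Y| = n) (cZ : #|Z| = n) (n_gt0 : (0 < n)%N).
Variables (A : rel3 X Y Z) (etaP eta1 eta2 : R).
Hypotheses (lA : linear3 A) (etaP0 : 0 < etaP) (eta10 : 0 < eta1) (eta20 : 0 < eta2).

Let N0 : 0 < n%:R :> R. Proof. by rewrite ltr0n. Qed.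

Notation pop := (Pop n A etaP).
Notation h2 := (H2 n A etaP eta1 eta2).

(** A row gives [al] and [al2] from [w] and [w2]; popularity leaves 1 / etaP choices for [a] and as
    many for [m2]. Each admissible [m2] uses at least [eta1 * n] rows. *)
Lemma H1_det w w2 be be2 m :
  #r[R] (fun m2 => H1 n A etaP eta1 w w2 be be2 m m2) <= etaP^-1 ^+ 2 / eta1.
Proof.
have -> : etaP^-1 ^+ 2 / eta1 = n%:R * (1 * (1 * (etaP^-1 * etaP^-1))) / (eta1 * n%:R).
  by field; rewrite !gt_eqF.
apply: det_markov; first by rewrite mulr_gt0.
have p0 : 0 <= etaP^-1 by rewrite invr_ge0 ltW.
apply: le_trans (_ : #r[R] (fun p : X * Z => True /\ H1_row n A etaP w w2 be be2 m p.2 p.1) <= _).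
  apply: (ler_cnt_rel (S := fun p q => p = (q.2, q.1))) => [[m2 x] h|p p' [x m2] _ _ -> -> //].
  by exists (x, m2).
apply: le_trans (cnt_pair_le (P := fun _ : X => True)
  (Q := fun x m2 => H1_row n A etaP w w2 be be2 m m2 x) (k := 1 * (1 * (etaP^-1 * etaP^-1))) _) _.
  move=> x _; apply: le_trans (ler_cnt (Q := fun m2 => exists2 al, A x w al &
    exists2 al2, A x w2 al2 & exists2 a, pop a al be m & pop a al2 be2 m2) _) _.
    move=> m2 [al [al2 [a [h3 h4 h5 h6]]]].
    by exists al => //; exists al2 => //; exists a.
  apply: cnt_ex_le; rewrite ?mulr_ge0 //.
    by apply: cnt_uniq1 => al al'; exact: lin_z.
  move=> al _; apply: cnt_ex_le; rewrite ?mulr_ge0 //.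
    by apply: cnt_uniq1 => al' al''; exact: lin_z.
  move=> al2 _; apply: cnt_ex_le => //; first exact: pop_det_a.
  by move=> a _; exact: pop_det_m.
by rewrite cnt_true cX.
Qed.

Lemma H2_det w w2 s s2 m : #r[R] (fun m2 => h2 w w2 s s2 m m2) <= etaP^-1 ^+ 2 / eta1 / eta2.
Proof.
have -> : etaP^-1 ^+ 2 / eta1 / eta2 = n%:R * (1 * (1 * (etaP^-1 ^+ 2 / eta1))) / (eta2 * n%:R).
  by field; rewrite !gt_eqF.
apply: det_markov; first by rewrite mulr_gt0.
have p0 : 0 <= etaP^-1 ^+ 2 / eta1 by rewrite divr_ge0 ?exprn_ge0 ?invr_ge0 // ltW.
apply: le_trans (_ : #r[R] (fun p : Y * Z => True /\ H2_col n A etaP eta1 w w2 s s2 m p.2 p.1) <= _).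
  apply: (ler_cnt_rel (S := fun p q => p = (q.2, q.1))) => [[m2 x] h|p p' [x m2] _ _ -> -> //].
  by exists (x, m2).
apply: le_trans (cnt_pair_le (P := fun _ : Y => True)
  (Q := fun y m2 => H2_col n A etaP eta1 w w2 s s2 m m2 y)
  (k := 1 * (1 * (etaP^-1 ^+ 2 / eta1))) _) _.
  move=> y _; apply: le_trans (ler_cnt (Q := fun m2 => exists2 be, A s y be &
    exists2 be2, A s2 y be2 & H1 n A etaP eta1 w w2 be be2 m m2) _) _.
    by move=> m2 [be [be2 [h3 h4 h5]]]; exists be => //; exists be2.
  apply: cnt_ex_le; first by rewrite ?mul1r.
    by apply: cnt_uniq1 => be be'; exact: lin_z.
  move=> be _; apply: cnt_ex_le; first by rewrite ?mul1r.
    by apply: cnt_uniq1 => be' be''; exact: lin_z.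
  by move=> be2 _; exact: H1_det.
by rewrite cnt_true cY.
Qed.

(* In the order of the tuple: labels of the mismatched corner and its neighbours, the rows and
   columns where they recur, and the positions of these recurrences; primes refer to the
   second rectangle, and a, b, c to the centres of the three common labels. *)
Definition F18 := (Z * Z * Z * Z * X * Y * Y * X * Y * Y * X * X * Y * X * Y * X * Y * X)%type.

(** From [d] the first rectangle of opposite corners is reached; [m11], [m12], [m21] are carried by
    [h2] to the centres ([ma], [mb], [mc]) and on to the second rectangle, whose last corner [m22']
    leads to [d']. The quantifiers are ordered so that each label or position has boundedly many
    values given its predecessors. *)
Definition conf d d' (t : F18) :=
  let: (al2, be2, m11, m12, x02, y02, w2', s2', w1, w1', s1, s1', wa, sa, wb, sb, wc, sc) := t in
  exists2 m22, pop d al2 be2 m22 & exists2 m21, pop m11 m12 m21 m22 &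
  exists2 w2, A x02 w2 al2 & exists2 s2, A s2 y02 be2 &
  exists2 al2', A x02 w2' al2' & exists2 be2', A s2' y02 be2' &
  exists2 ma, h2 w1 wa s1 sa m11 ma & exists2 m11', h2 wa w1' sa s1' ma m11' &
  exists2 mb, h2 w2 wb s1 sb m12 mb & exists2 m12', h2 wb w2' sb s1' mb m12' &
  exists2 mc, h2 w1 wc s2 sc m21 mc & exists2 m21', h2 wc w1' sc s2' mc m21' &
  exists2 m22', pop m11' m12' m21' m22' & pop d' al2' be2' m22'.

(** One factor per choice in [conf], in that order: [p] for a popular quadruple, [h] for [H2], 1 for
    a cell; the last [p] counts [d']. *)
Definition conf_const : R :=
  let p := etaP^-1 in let h := etaP^-1 ^+ 2 / eta1 / eta2 in
  p * (p * (1 * (1 * (1 * (1 * (h * (h * (h * (h * (h * (h * (p * p)))))))))))).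

Lemma conf_upper d t : #r[R] (fun d' => conf d d' t) <= conf_const.
Proof.
have p0 : 0 <= etaP^-1 by rewrite invr_ge0 ltW.
have h0 : 0 <= etaP^-1 ^+ 2 / eta1 / eta2.
  by rewrite !divr_ge0 ?exprn_ge0 // ltW.
move: t => [[[[[[[[[[[[[[[[[al2 be2] m11] m12] x02] y02] w2'] s2'] w1] w1'] s1] s1'] wa] sa] wb] sb] wc] sc].
rewrite /conf /conf_const /=.
have := H2_det; move: (etaP^-1 ^+ 2 / eta1 / eta2) h0 => h h0 hH.
have hP a al be : #r[R] (fun m => pop a al be m) <= etaP^-1 by exact: pop_det_m.
have hB a al m : #r[R] (fun be => pop a al be m) <= etaP^-1 by exact: pop_det_be.
have hA al be m : #r[R] (fun a => pop a al be m) <= etaP^-1 by exact: pop_det_a.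
move: (etaP^-1) p0 hP hB hA => p p0 hP hB hA.
apply: cnt_ex_le; [by rewrite !mulr_ge0|exact: hP|move=> m22 _].
apply: cnt_ex_le; [by rewrite !mulr_ge0|exact: hB|move=> m21 _].
apply: cnt_ex_le; [by rewrite !mulr_ge0|by apply: cnt_uniq1 => ? ?; apply: lin_y|move=> w2 _].
apply: cnt_ex_le; [by rewrite !mulr_ge0|by apply: cnt_uniq1 => ? ?; apply: lin_x|move=> s2 _].
apply: cnt_ex_le; [by rewrite !mulr_ge0|by apply: cnt_uniq1 => ? ?; apply: lin_z|move=> al2' _].
apply: cnt_ex_le; [by rewrite !mulr_ge0|by apply: cnt_uniq1 => ? ?; apply: lin_z|move=> be2' _].
do 6 (apply: cnt_ex_le; [by rewrite !mulr_ge0|exact: hH|move=> ? _]).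
apply: cnt_ex_le; [by []|exact: hP|by move=> m22' _; exact: hA].
Qed.

(** Double counting of pairs of a label [d'] and one of the n^18 parameter tuples. *)
Lemma conf_degree (M : Z -> Prop) (k : R) d : 0 < k ->
  (forall d', M d' -> k * n%:R ^+ 18 <= #r[R] (conf d d')) -> #r[R] M <= conf_const / k.
Proof.
move=> k0 h; rewrite ler_pdivlMr // -(@ler_pM2r _ (n%:R ^+ 18)) ?exprn_gt0 // -mulrA.
apply: le_trans (cnt_pair_ge h) _.
apply: le_trans (_ : #r[R] (fun p : F18 * Z => True /\ conf d p.2 p.1) <= _).
  apply: (ler_cnt_rel (S := fun p q => p = (q.2, q.1))) => [[d' t] [_ ?]|p p' q _ _ -> -> //].
  by exists (t, d').
apply: le_trans (cnt_pair_le (P := fun _ : F18 => True) (Q := fun t d' => conf d d' t)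
  (k := conf_const) (fun t _ => conf_upper d t)) _.
rewrite cnt_true !card_prod cX cY cZ !natrM mulrC; apply: le_of_eq; ring.
Qed.

End Config.

(** * Random rows, columns and centres that give common neighbours *)

Definition XY (X Y Z : Type) (T : rel3 X Y Z) x y := exists z, T x y z.
Definition XZ (X Y Z : Type) (T : rel3 X Y Z) x z := exists y, T x y z.
Definition YZ (X Y Z : Type) (T : rel3 X Y Z) y z := exists x, T x y z.

Definition all4 (W V : Type) (E : W -> V -> Prop) (q : V * V * V * V) (w : W) :=
  [/\ E w q.1.1.1, E w q.1.1.2, E w q.1.2 & E w q.2].

Definition all3 (W V : Type) (E : W -> V -> Prop) (q : V * V * V) (w : W) :=
  [/\ E w q.1.1, E w q.1.2 & E w q.2].

(** The cube lies above its tangent at [l]; summed over labels, this gives the third moment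
    bound. *)
Lemma cube_ge (R : realType) (t l : R) : 0 <= t -> 0 <= l -> 3 * l ^+ 2 * t - 2 * l ^+ 3 <= t ^+ 3.
Proof.
move=> t0 l0; rewrite -subr_ge0.
have -> : t ^+ 3 - (3 * l ^+ 2 * t - 2 * l ^+ 3) = (t - l) ^+ 2 * (t + 2 * l) by ring.
by rewrite mulr_ge0 ?sqr_ge0 // addr_ge0 // mulr_ge0.
Qed.

Section Choices.
Variables (R : realType) (X Y Z : finType) (n : nat).
Hypotheses (cX : #|X| = n) (cY : #|Y| = n) (cZ : #|Z| = n) (n_gt0 : (0 < n)%N).
Implicit Types T S B : rel3 X Y Z.

Let N0 : 0 < n%:R :> R. Proof. by rewrite ltr0n. Qed.
Let N0' : n%:R != 0 :> R. Proof. by rewrite gt_eqF. Qed.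

(** Keeping only labels that occur in a random row and in a random column makes most quadruples of
    labels recur together in linearly many rows, and in linearly many columns. A label with k cells
    occurs in k rows and k columns by linearity, so the expected size is governed by the third
    moment of k. *)
Lemma choose_labels B (b g : R) : 0 < b -> 0 < g -> linear3 B ->
  b * n%:R ^+ 2 <= (csize B)%:R ->
  exists xs ys, let B1 : rel3 X Y Z := fun x y z => [/\ B x y z, XZ B xs z & YZ B ys z] in
  [/\ b ^+ 3 / 2 * n%:R ^+ 2 <= (csize B1)%:R,
      #r[R] (scarce (all4 (XZ B) : Z * Z * Z * Z -> X -> Prop) (g * b ^+ 3 / 4 * n%:R) xs) <= g * n%:R ^+ 4
    & #r[R] (scarce (all4 (YZ B) : Z * Z * Z * Z -> Y -> Prop) (g * b ^+ 3 / 4 * n%:R) ys) <= g * n%:R ^+ 4].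
Proof.
move=> b0 g0 lB hB; set N : R := n%:R in hB *.
pose B1 (w : X * Y) : rel3 X Y Z := fun x y z => [/\ B x y z, XZ B w.1 z & YZ B w.2 z].
pose k (z : Z) := cnt (fun p : X * Y => B p.1 p.2 z).
set d := g * b ^+ 3 / 4 * N.
have d0 : 0 < d by rewrite /d; repeat first [apply: mulr_gt0|apply: exprn_gt0|by rewrite ?invr_gt0].
have sk : b * N ^+ 2 <= \sum_z (k z)%:R.
  rewrite -natr_sum -cnt_pair; apply: le_trans hB _.
  apply: (ler_cnt_rel (S := fun p q => p = q.2)) => [p [z h]|p p' q _ _ -> -> //].
  by exists (z, p).
have sk3 : b ^+ 3 * N ^+ 4 <= \sum_z (k z)%:R ^+ 3.
  apply: (@le_trans _ _ (\sum_z (3 * (b * N) ^+ 2 * (k z)%:R - 2 * (b * N) ^+ 3))); last first.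
    by apply: ler_sum => z _; apply: cube_ge; rewrite ?ler0n // mulr_ge0 // ltW.
  rewrite sumrB -mulr_sumr sumr_const cZ -[_ *+ n]mulr_natr -/N.
  have : 3 * (b * N) ^+ 2 * (b * N ^+ 2) <= 3 * (b * N) ^+ 2 * (\sum_z (k z)%:R).
    by rewrite ler_pM2l // !mulr_gt0 // exprn_gt0 // mulr_gt0.
  have -> : 3 * (b * N) ^+ 2 * (b * N ^+ 2) = b ^+ 3 * N ^+ 4 + 2 * (b * N) ^+ 3 * N by ring.
  lra.
have sB : b ^+ 3 * N ^+ 4 <= \sum_w (csize (B1 w))%:R.
  apply: le_trans sk3 _; rewrite -natr_sum -cnt_pair.
  apply: (@le_trans _ _ (#r[R] (fun q : Z * ((X * Y) * (X * Y)) =>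
     B q.2.1.1 q.2.1.2 q.1 /\ (XZ B q.2.2.1 q.1 /\ YZ B q.2.2.2 q.1)))).
    rewrite (cnt_pair (fun z (q : (X * Y) * (X * Y)) =>
      B q.1.1 q.1.2 z /\ (XZ B q.2.1 z /\ YZ B q.2.2 z))) natr_sum.
    apply: ler_sum => z _.
    rewrite (cnt_prod (fun p : X * Y => B p.1 p.2 z) (fun p : X * Y => XZ B p.1 z /\ YZ B p.2 z)).
    rewrite (cnt_prod (fun x => XZ B x z) (fun y => YZ B y z)) -natrX ler_nat !expnS expn0 muln1.
    rewrite leq_mul // leq_mul //.
      apply: (cnt_rel (R := fun p x => p.1 = x)) => [[x y] /= h|[x y] [x' y'] x'' /= h h' e e'].
        by exists x => //; exists y.
      by subst; congr (_, _); exact: lin_y h h'.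
    apply: (cnt_rel (R := fun p x => p.2 = x)) => [[x y] /= h|[x y] [x' y'] x'' /= h h' e e'].
      by exists y => //; exists x.
    by subst; congr (_, _); exact: lin_x h h'.
  apply: (ler_cnt_rel (S := fun q p => p = (q.2.2, q.2.1))).
    move=> [z [[x y] [x' y']]] /= [h1 [h2 h3]]; exists ((x', y'), (x, y)) => //=.
    by exists z.
  move=> [z [[x y] [x' y']]] [z1 [[x1 y1] [x1' y1']]] p /= [h1 _] [h2 _] -> [? ? ? ?]; subst.
  by rewrite (lin_z lB h1 h2).
pose f (w : X * Y) : R := (csize (B1 w))%:R / N ^+ 2
  - #r[R] (scarce (all4 (XZ B) : Z * Z * Z * Z -> X -> Prop) d w.1) / (g * N ^+ 4)
  - #r[R] (scarce (all4 (YZ B) : Z * Z * Z * Z -> Y -> Prop) d w.2) / (g * N ^+ 4).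
have G0 : 0 < g * N ^+ 4 by rewrite mulr_gt0 ?exprn_gt0.
have c4 : #|[the finType of (Z * Z * Z * Z)%type]|%:R = N ^+ 4 by rewrite !card_prod cZ !natrM; ring.
have [[xs ys] hw] : exists w, b ^+ 3 / 2 <= f w.
  apply: average_ge; first by rewrite card_prod cX cY muln_gt0 n_gt0.
  rewrite card_prod cX cY natrM -/N /f !big_split /= !sumrN -!mulr_suml.
  have b1 : \sum_(w : X * Y) #r[R] (scarce (all4 (XZ B) : Z * Z * Z * Z -> X -> Prop) d w.1)
     <= N * (N ^+ 4 * d).
    rewrite -(pair_bigA _ (fun a b => #r[R] (scarce (all4 (XZ B) : Z * Z * Z * Z -> X -> Prop) d a))) /=.
    under eq_bigr do rewrite sumr_const cY.
    rewrite sumrMnl -[_ *+ _]mulr_natl ler_pM2l // -c4.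
    by apply: sum_scarce; rewrite ltW.
  have b2 : \sum_(w : X * Y) #r[R] (scarce (all4 (YZ B) : Z * Z * Z * Z -> Y -> Prop) d w.2)
     <= N * (N ^+ 4 * d).
    rewrite -(pair_bigA _ (fun a b => #r[R] (scarce (all4 (YZ B) : Z * Z * Z * Z -> Y -> Prop) d b))) /=.
    rewrite sumr_const cX -[_ *+ _]mulr_natl ler_pM2l // -c4.
    by apply: sum_scarce; rewrite ltW.
  have -> : b ^+ 3 / 2 * (N * N) =
    (b ^+ 3 * N ^+ 4) / N ^+ 2 - N * (N ^+ 4 * d) / (g * N ^+ 4) - N * (N ^+ 4 * d) / (g * N ^+ 4).
    by rewrite /d; field; rewrite !gt_eqF.
  by rewrite !lerB // ler_pM2r // invr_gt0 // exprn_gt0.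
exists xs, ys; rewrite -/(B1 (xs, ys)) -/N -/d /=.
have cS : (csize (B1 (xs, ys)))%:R / N ^+ 2 <= 1.
  rewrite ler_pdivrMr ?exprn_gt0 // mul1r /N -natrX ler_nat.
  by apply: leq_trans (cnt_card _) _; rewrite card_prod cX cY.
have r1 : 0 <= #r[R] (scarce (all4 (XZ B) : Z * Z * Z * Z -> X -> Prop) d xs) / (g * N ^+ 4).
  by rewrite divr_ge0 ?ler0n ?ltW.
have r2 : 0 <= #r[R] (scarce (all4 (YZ B) : Z * Z * Z * Z -> Y -> Prop) d ys) / (g * N ^+ 4).
  by rewrite divr_ge0 ?ler0n ?ltW.
have b30 : 0 < b ^+ 3 by rewrite exprn_gt0.
rewrite /f /= in hw; split.
- rewrite -ler_pdivlMr ?exprn_gt0 //; apply: le_trans hw _; lra.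
- rewrite -[leRHS]mul1r -ler_pdivrMr //; lra.
- rewrite -[leRHS]mul1r -ler_pdivrMr //; lra.
Qed.

(** Keeping only columns that meet a random row makes most triples of columns meet linearly many
    common rows. *)
Lemma choose_cols B (b g : R) : 0 < b -> 0 < g ->
  b * n%:R ^+ 2 <= (csize B)%:R ->
  exists us, let B2 : rel3 X Y Z := fun x y z => B x y z /\ XY B us y in
  b ^+ 2 / 2 * n%:R ^+ 2 <= (csize B2)%:R /\
  #r[R] (scarce (all3 (XY B) : Y * Y * Y -> X -> Prop) (g * b ^+ 2 / 2 * n%:R) us) <= g * n%:R ^+ 3.
Proof.
move=> b0 g0 hB; set N : R := n%:R in hB *.
pose B2 (w : X) : rel3 X Y Z := fun x y z => B x y z /\ XY B w y.
set d := g * b ^+ 2 / 2 * N.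
have d0 : 0 < d by rewrite /d; repeat first [apply: mulr_gt0|apply: exprn_gt0|by rewrite ?invr_gt0].
have sk : (b * N) ^+ 2 * N <= \sum_y #r[R] (fun x => XY B x y) ^+ 2.
  apply: (sum_sqr_ge (P := fun _ : Y => True)) => //; first by rewrite mulr_ge0 ?ltW.
    by rewrite cnt_true cY.
  rewrite -natr_sum -cnt_pair -mulrA -expr2; apply: le_trans hB _.
  apply: (ler_cnt_rel (S := fun p q => p = (q.2, q.1))) => [[x y] h|p p' q _ _ -> -> //].
  by exists (y, x).
have sB : b ^+ 2 * N ^+ 3 <= \sum_w (csize (B2 w))%:R.
  apply: le_trans (_ : (b * N) ^+ 2 * N <= _); first by apply: le_of_eq; ring.
  apply: le_trans sk _; rewrite -natr_sum -cnt_pair.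
  under eq_bigr do rewrite expr2 -natrM -cnt_prod.
  rewrite -natr_sum -cnt_pair.
  apply: (ler_cnt_rel (S := fun q p => p = (q.2.2, (q.2.1, q.1)))).
    move=> [y [x u]] /= [[z h1] h2]; exists (u, (x, y)) => //=.
    by exists z.
  by move=> [y [x u]] [y' [x' u']] p _ _ -> /= [-> -> ->].
pose f (w : X) : R := (csize (B2 w))%:R / N ^+ 2
  - #r[R] (scarce (all3 (XY B) : Y * Y * Y -> X -> Prop) d w) / (g * N ^+ 3).
have G0 : 0 < g * N ^+ 3 by rewrite mulr_gt0 ?exprn_gt0.
have c3 : #|[the finType of (Y * Y * Y)%type]|%:R = N ^+ 3 by rewrite !card_prod cY !natrM; ring.
have [us hw] : exists w, b ^+ 2 / 2 <= f w.
  apply: average_ge; first by rewrite cX.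
  rewrite cX -/N /f !big_split /= !sumrN -!mulr_suml.
  have b1 : \sum_(w : X) #r[R] (scarce (all3 (XY B) : Y * Y * Y -> X -> Prop) d w) <= N ^+ 3 * d.
    by rewrite -c3; apply: sum_scarce; rewrite ltW.
  have -> : b ^+ 2 / 2 * N = (b ^+ 2 * N ^+ 3) / N ^+ 2 - N ^+ 3 * d / (g * N ^+ 3).
    by rewrite /d; field; rewrite !gt_eqF.
  by rewrite !lerB // ler_pM2r // invr_gt0 // exprn_gt0.
exists us; rewrite -/(B2 us) -/N -/d /=.
have cS : (csize (B2 us))%:R / N ^+ 2 <= 1.
  rewrite ler_pdivrMr ?exprn_gt0 // mul1r /N -natrX ler_nat.
  by apply: leq_trans (cnt_card _) _; rewrite card_prod cX cY.
have r1 : 0 <= #r[R] (scarce (all3 (XY B) : Y * Y * Y -> X -> Prop) d us) / (g * N ^+ 3).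
  by rewrite divr_ge0 ?ler0n ?ltW.
have b30 : 0 < b ^+ 2 by rewrite exprn_gt0.
rewrite /f /= in hw; split.
- rewrite -ler_pdivlMr ?exprn_gt0 //; apply: le_trans hw _; lra.
- rewrite -[leRHS]mul1r -ler_pdivrMr //; lra.
Qed.


(* The centre of a label minimises the number of its D-bad partners. *)
Lemma choose_centres S (D : X * Y -> X * Y -> Prop) (t q : R) : 0 < t -> linear3 S ->
  #r[R] (fun p : Z * ((X * Y) * (X * Y)) =>
    [/\ S p.2.1.1 p.2.1.2 p.1, S p.2.2.1 p.2.2.2 p.1 & D p.2.1 p.2.2]) <= q * n%:R ^+ 3 ->
  exists ctr : Z -> X * Y, let S' : rel3 X Y Z := fun x y z =>
      [/\ S x y z, S (ctr z).1 (ctr z).2 z, ~ D (x, y) (ctr z) & ~ D (ctr z) (x, y)] in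
  (csize S)%:R - (t + 2 * q / t) * n%:R ^+ 2 <= (csize S')%:R.
Proof.
move=> t0 lS hD; set N : R := n%:R in hD *.
pose Sz (z : Z) (e : X * Y) := S e.1 e.2 z.
pose DD e f := D e f \/ D f e.
pose bad z f := cnt (fun e => Sz z e /\ DD f e).
pose Q z := cnt (fun p : (X * Y) * (X * Y) => Sz z p.1 /\ (Sz z p.2 /\ DD p.1 p.2)).
have /boolp.choice [ctr hc] : forall z, exists f, t * N <= #r[R] (Sz z) ->
    Sz z f /\ (bad z f)%:R * (t * N) <= (Q z)%:R.
  move=> z; have [hz|] := pselect (t * N <= #r[R] (Sz z)); last first.
    have /card_gt0P [x _] : (0 < #|X|)%N by rewrite cX.
    have /card_gt0P [y _] : (0 < #|Y|)%N by rewrite cY.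
    by exists (x, y).
  have [f0 Sf0] : exists f, Sz z f.
    by apply: cnt_gt0; rewrite -(ltr0n R); apply: lt_le_trans hz; rewrite mulr_gt0.
  have /asboolP Sf0' := Sf0.
  (* The minimum is at most the average of [bad z] over the cells labelled [z], whose sum is
     [Q z]. *)
  case: (@arg_minnP _ f0 (fun f => `[< Sz z f >]) (bad z) Sf0') => f /asboolP Sf fmin; exists f => _; split=> //.
  apply: le_trans (_ : #r[R] (Sz z) * (bad z f)%:R <= _).
    by rewrite mulrC ler_wpM2r // ler0n.
  apply: (cnt_pair_ge (P := Sz z) (Q := fun f e => Sz z e /\ DD f e)) => e Se.
  by rewrite ler_nat; apply: fmin; exact/asboolP.
exists ctr => S'.
have sQ : \sum_z (Q z)%:R <= 2 * q * N ^+ 3.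
  rewrite -natr_sum -cnt_pair.
  apply: le_trans (_ : q * N ^+ 3 + q * N ^+ 3 <= _); last by apply: le_of_eq; ring.
  apply: le_trans (ler_cnt_or (Q := fun p => [/\ Sz p.1 p.2.1, Sz p.1 p.2.2 & D p.2.1 p.2.2])
    (S := fun p => [/\ Sz p.1 p.2.1, Sz p.1 p.2.2 & D p.2.2 p.2.1]) _) _.
    by move=> [z [e f]] /= [h1 [h2 [h3|h3]]]; [left|right].
  apply: lerD; first exact: hD.
  apply: le_trans hD; apply: (ler_cnt_rel (S := fun p q => q = (p.1, (p.2.2, p.2.1)))).
    by move=> [z [e f]] /= [h1 h2 h3]; exists (z, (f, e)).
  by move=> [z [e f]] [z' [e' f']] p _ _ -> /= [-> -> ->].
(* Labels with fewer than [t * n] cells are given up, at a cost of t n^2 cells; the other labels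
   average [Q z] over at least [t * n] candidates. *)
pose small z := #r[R] (Sz z) < t * N.
have h1 : #r[R] (fun p : Z * (X * Y) => small p.1 /\ Sz p.1 p.2) <= N * (t * N).
  apply: le_trans (cnt_pair_le (P := small) (Q := Sz) (k := t * N) _) _; first by move=> z /ltW.
  by apply: ler_wpM2r; [rewrite mulr_ge0 // ltW|rewrite /N ler_nat -cZ cnt_card].
have h2 : #r[R] (fun p : Z * (X * Y) => ~ small p.1 /\ (Sz p.1 p.2 /\ DD (ctr p.1) p.2)) * (t * N) <= 2 * q * N ^+ 3.
  rewrite (cnt_pair (fun z e => ~ small z /\ (Sz z e /\ DD (ctr z) e))) natr_sum mulr_suml.
  apply: le_trans sQ; apply: ler_sum => z _.
  have [/negP hz|hz] := pselect (~ small z); last first.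
    by rewrite cnt0 ?mul0r ?ler0n // => e [].
  rewrite -leNgt in hz; have [_ hb] := hc _ hz; apply: le_trans hb.
  by rewrite ler_pM2r ?mulr_gt0 // ler_nat; apply: cnt_le => e [].
have h2' : #r[R] (fun p : Z * (X * Y) => ~ small p.1 /\ (Sz p.1 p.2 /\ DD (ctr p.1) p.2)) <= 2 * q / t * N ^+ 2.
  rewrite -(@ler_pM2r _ (t * N)) ?mulr_gt0 //; apply: le_trans h2 _.
  by apply: le_of_eq; field; rewrite gt_eqF.
have h3 : (csize S)%:R <= (csize S')%:R + (N * (t * N) + 2 * q / t * N ^+ 2).
  apply: le_trans (_ : (csize S')%:R + (#r[R] (fun e => exists z, small z /\ Sz z e)
     + #r[R] (fun e => exists z, ~ small z /\ (Sz z e /\ DD (ctr z) e))) <= _).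
    apply: le_trans (ler_cnt_or (S := fun e => (exists z, small z /\ Sz z e) \/
      (exists z, ~ small z /\ (Sz z e /\ DD (ctr z) e))) _) (lerD (lexx _) (ler_cnt_or _)) => //.
    move=> [x y] [z /= h]; have [sz|sz] := pselect (small z); first by right; left; exists z.
    have [dd|dd] := pselect (DD (ctr z) (x, y)); first by right; right; exists z.
    left; exists z; move/negP: sz; rewrite -leNgt => /hc [sc _]; split=> // d; apply: dd.
      by right.
    by left.
  apply: lerD => //; apply: lerD.
    apply: le_trans h1; apply: (ler_cnt_rel (S := fun e p => p.2 = e)) => [e [z h]|e e' p _ _ <- <- //].
    by exists (z, e).
  apply: le_trans h2'; apply: (ler_cnt_rel (S := fun e p => p.2 = e)) => [e [z h]|e e' p _ _ <- <- //].
  by exists (z, e).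
rewrite lerBlDr; apply: le_trans h3 _; apply: le_of_eq; ring.
Qed.

End Choices.

(** * Lower bound: the random skeleton around a mismatch *)

Lemma cnt_proj (R : realType) (A B C : finType) (Q : B -> Prop) (f : A -> B) (g : A -> C) (k : R) :
  #r[R] Q <= k -> (forall a a', f a = f a' -> g a = g a' -> a = a') ->
  #r[R] (fun a => Q (f a)) <= k * #|C|%:R.
Proof.
move=> hk inj; apply: le_trans (_ : #r[R] Q * #|C|%:R <= _); last by apply: ler_wpM2r.
rewrite -natrM -cnt_true -cnt_prod.
apply: (ler_cnt_rel (S := fun a p => f a = p.1 /\ g a = p.2)).
  by move=> a Qa; exists (f a, g a).
by move=> a a' [b c] _ _ /= [h1 e1] [h2 e2]; apply: inj; rewrite ?h1 ?e1.
Qed.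

Definition andp (A B : Type) (P : A -> Prop) (Q : B -> Prop) (p : A * B) := P p.1 /\ Q p.2.

Lemma andp_ge (R : realType) (A B : finType) (P : A -> Prop) (Q : B -> Prop) (k l : R) :
  0 <= k -> 0 <= l -> k <= #r[R] P -> l <= #r[R] Q -> k * l <= #r[R] (andp P Q).
Proof. by move=> k0 l0 hP hQ; rewrite /andp cnt_prod natrM; apply: ler_pM. Qed.

Ltac tuple_inj :=
  intros; repeat match goal with p : prod _ _ |- _ => destruct p end; simpl in *; congruence.

Section Skeleton.
Variables (R : realType) (X Y Z : finType) (n : nat).
Hypotheses (cX : #|X| = n) (cY : #|Y| = n) (cZ : #|Z| = n) (n_gt0 : (0 < n)%N).
Variables (A B B1 B2 : rel3 X Y Z) (etaP eta1 eta2 : R) (xs us : X) (ys : Y).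
Variables (ka ga dl gz dz ge g3 g : R).
Hypotheses (lA : linear3 A) (sBA : sub3 B A) (sB1 : sub3 B1 B) (sB2 : sub3 B2 B1).
Hypothesis B1xs : forall x y z, B1 x y z -> XZ B xs z.
Hypothesis B1ys : forall x y z, B1 x y z -> YZ B ys z.
Hypothesis B2us : forall x y z, B2 x y z -> XY B1 us y.
Hypotheses (ka0 : 0 < ka) (dl0 : 0 < dl) (dz0 : 0 < dz).
Hypotheses (ga_small : 14 * ga <= ka ^+ 7) (gz_small : 16 * gz <= ka ^+ 7 * dl ^+ 7).
Hypothesis bad_small : 2 * ge + 2 * g + 6 * g3 <= ka ^+ 7 * dl ^+ 7 / 4 * dz ^+ 4 / 2.
Let N : R := n%:R.

Hypothesis few_rows : #r[R] (scarce (all4 (XZ B)) (dz * N) xs) <= gz * N ^+ 4.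
Hypothesis few_cols : #r[R] (scarce (all4 (YZ B)) (dz * N) ys) <= gz * N ^+ 4.
Hypothesis few_unpop : #r[R] (unpop n A etaP B) <= g * N ^+ 4.

Let N0 : 0 < N. Proof. by rewrite ltr0n. Qed.

Definition scarce_col (y : Y) (p : Y * Y) := scarce (all3 (XY B1)) (dl * N) us (y, p.1, p.2).

(** Each field bounds an average seen from one cell, so few cells fail; yet the conditions hold at
    every corner of an arbitrary mismatch among good cells. *)
Record good_cell (x : X) (y : Y) : Prop := GoodCell {
  good_B2 : XY B2 x y;
  good_row : ka * N <= #r[R] (XY B2 x);
  good_col : #r[R] (scarce_col y) <= ga * N ^+ 2;
  good_pop : #r[R] (fun p : X * Y => unpop n A etaP B (x, y, p.1, p.2)) <= ge * N ^+ 2 }.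

(** The column of [f] is recovered from its row and the label shared with [e]. *)
Definition bad_at (e f : X * Y) (p : X * Y * X * Y * X * Y) :=
  let: (u, v, u2, v2, x0, y0) := p in
  bad_r n A etaP eta1 eta2 B (e.1, e.2, u, v, f.1, u2, v2, x0, y0).

Definition few_bad (e f : X * Y) := #r[R] (bad_at e f) <= g3 * N ^+ 6.

Variables (x1 x2 x3 x4 xa xb xc : X) (y1 y2 y3 y4 ya yb yc : Y) (a b c d d' : Z).
Hypothesis cells : [/\ B x1 y1 a, B x2 y1 b, B x1 y2 c & B x2 y2 d].
Hypothesis cells' : [/\ B x3 y3 a, B x4 y3 b, B x3 y4 c & B x4 y4 d'].
Hypothesis centres : [/\ B xa ya a, B xb yb b & B xc yc c].
Hypothesis good1 : [/\ good_cell x1 y1, good_cell x2 y1, good_cell x1 y2 & good_cell x2 y2].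
Hypothesis good2 : [/\ good_cell x3 y3, good_cell x4 y3, good_cell x3 y4 & good_cell x4 y4].
Hypothesis good3 : [/\ good_cell xa ya, good_cell xb yb & good_cell xc yc].
Hypothesis few_a : few_bad (x1, y1) (xa, ya) /\ few_bad (xa, ya) (x3, y3).
Hypothesis few_b : few_bad (x2, y1) (xb, yb) /\ few_bad (xb, yb) (x4, y3).
Hypothesis few_c : few_bad (x1, y2) (xc, yc) /\ few_bad (xc, yc) (x3, y4).

Notation Y7 := (Y * (Y * (Y * (Y * (Y * (Y * Y))))))%type.
Notation X7 := (X * (X * (X * (X * (X * (X * X))))))%type.
Notation T4 := (X * (X * (Y * Y)))%type.

(* The skeleton: v's are columns (v1, v2 for the first rectangle, v1', v2' for the second,
   va, vb, vc for the centres), u's the corresponding rows. *)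
Definition vtuple : Y7 -> Prop :=
  andp (XY B2 x1) (andp (XY B2 x2) (andp (XY B2 x3) (andp (XY B2 x4)
  (andp (XY B2 xa) (andp (XY B2 xb) (XY B2 xc)))))).

Definition vbad (v : Y7) := let: (v1, (v2, (v1', (v2', (va, (vb, vc)))))) := v in
  scarce_col y1 (v1, v2) \/ (scarce_col y2 (v1, v2) \/ (scarce_col y3 (v1', v2') \/
  (scarce_col y4 (v1', v2') \/ (scarce_col ya (va, v1) \/ (scarce_col yb (vb, v1) \/
   scarce_col yc (vc, v1)))))).

(** [u1] and [u2] both meet [v1] and [v2], so that the opposite corners form a rectangle; likewise
    for the primed rows. For a centre, [v1] completes its two columns to a triple, so that one
    notion of scarcity covers all seven rows. *)
Definition utuple (v : Y7) : X7 -> Prop :=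
  let: (v1, (v2, (v1', (v2', (va, (vb, vc)))))) := v in
  andp (all3 (XY B1) (y1, v1, v2)) (andp (all3 (XY B1) (y2, v1, v2))
  (andp (all3 (XY B1) (y3, v1', v2')) (andp (all3 (XY B1) (y4, v1', v2'))
  (andp (all3 (XY B1) (ya, va, v1)) (andp (all3 (XY B1) (yb, vb, v1))
    (all3 (XY B1) (yc, vc, v1))))))).

Lemma vtuple_count : ka ^+ 7 * N ^+ 7 <= #r[R] vtuple.
Proof.
have kN : 0 <= ka * N by rewrite mulr_ge0 // ltW.
rewrite /vtuple (_ : ka ^+ 7 * N ^+ 7 = ka * N * (ka * N * (ka * N * (ka * N * (ka * N *
  (ka * N * (ka * N))))))); last by ring.
have g0 x y : good_cell x y -> ka * N <= #r[R] (XY B2 x) by case.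
case: good1 good2 good3 => h1 h2 _ _ [h3 h4 _ _] [ha hb hc].
apply: (andp_ge kN); [by do ?[exact: kN|apply: (mulr_ge0 kN)]|exact: g0 h1|].
apply: (andp_ge kN); [by do ?[exact: kN|apply: (mulr_ge0 kN)]|exact: g0 h2|].
apply: (andp_ge kN); [by do ?[exact: kN|apply: (mulr_ge0 kN)]|exact: g0 h3|].
apply: (andp_ge kN); [by do ?[exact: kN|apply: (mulr_ge0 kN)]|exact: g0 h4|].
apply: (andp_ge kN); [by do ?[exact: kN|apply: (mulr_ge0 kN)]|exact: g0 ha|].
by apply: (andp_ge kN) => //; [exact: g0 hb|exact: g0 hc].
Qed.

Lemma vbad_count : #r[R] vbad <= 7 * ga * N ^+ 7.
Proof.
have pr y (f : Y7 -> Y * Y) (h : Y7 -> Y * (Y * (Y * (Y * Y)))) : #r[R] (scarce_col y) <= ga * N ^+ 2 ->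
    (forall v v', f v = f v' -> h v = h v' -> v = v') ->
    #r[R] (fun v => scarce_col y (f v)) <= ga * N ^+ 7.
  move=> hy inj; apply: le_trans (cnt_proj hy inj) _.
  by rewrite !card_prod cY !natrM -/N; apply: le_of_eq; ring.
have gc x y : good_cell x y -> #r[R] (scarce_col y) <= ga * N ^+ 2 by case.
case: good1 good2 good3 => h1 _ h2 _ [h3 _ h4 _] [ha hb hc].
have -> : 7 * ga * N ^+ 7 = ga * N ^+ 7 + (ga * N ^+ 7 + (ga * N ^+ 7 + (ga * N ^+ 7 + (ga * N ^+ 7 + (ga * N ^+ 7 + ga * N ^+ 7))))) by ring.
apply: le_trans (ler_cnt (Q := fun v : Y7 =>
  scarce_col y1 (v.1, v.2.1) \/ (scarce_col y2 (v.1, v.2.1) \/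
  (scarce_col y3 (v.2.2.1, v.2.2.2.1) \/ (scarce_col y4 (v.2.2.1, v.2.2.2.1) \/
  (scarce_col ya (v.2.2.2.2.1, v.1) \/ (scarce_col yb (v.2.2.2.2.2.1, v.1) \/
   scarce_col yc (v.2.2.2.2.2.2, v.1))))))) _) _.
  by move=> [v1 [v2 [v1' [v2' [va [vb vc]]]]]].
apply: le_trans (ler_cnt_or (fun _ h => h)) (lerD _ _).
  apply: (pr _ _ (fun v => v.2.2)); first exact: gc h1.
  by tuple_inj.
apply: le_trans (ler_cnt_or (fun _ h => h)) (lerD _ _).
  apply: (pr _ _ (fun v => v.2.2)); first exact: gc h2.
  by tuple_inj.
apply: le_trans (ler_cnt_or (fun _ h => h)) (lerD _ _).
  apply: (pr _ _ (fun v => (v.1, (v.2.1, v.2.2.2.2)))); first exact: gc h3.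
  by tuple_inj.
apply: le_trans (ler_cnt_or (fun _ h => h)) (lerD _ _).
  apply: (pr _ _ (fun v => (v.1, (v.2.1, v.2.2.2.2)))); first exact: gc h4.
  by tuple_inj.
apply: le_trans (ler_cnt_or (fun _ h => h)) (lerD _ _).
  apply: (pr _ _ (fun v => (v.2.1, (v.2.2.1, (v.2.2.2.1, v.2.2.2.2.2))))); first exact: gc ha.
  by tuple_inj.
apply: le_trans (ler_cnt_or (fun _ h => h)) (lerD _ _).
  apply: (pr _ _ (fun v => (v.2.1, (v.2.2.1, (v.2.2.2.1, (v.2.2.2.2.1, v.2.2.2.2.2.2)))))); first exact: gc hb.
  by tuple_inj.
apply: (pr _ _ (fun v => (v.2.1, (v.2.2.1, (v.2.2.2.1, (v.2.2.2.2.1, v.2.2.2.2.2.1)))))); first exact: gc hc.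
by move=> [v1 [v2 [v1' [v2' [va [vb vc]]]]]] [r1 [r2 [r1' [r2' [ra [rb rc]]]]]] /= [-> ->] [-> -> -> -> ->].
Qed.

(** All columns involved meet the row [us] in [B1], so a triple with few common rows would be
    scarce, against [vbad]. *)
Lemma utuple_count v : vtuple v -> ~ vbad v -> dl ^+ 7 * N ^+ 7 <= #r[R] (utuple v).
Proof.
move: v => [v1 [v2 [v1' [v2' [va [vb vc]]]]]].
move=> [h1 [h2 [h1' [h2' [ha [hb hc]]]]]]; rewrite /vbad => nb.
have kN : 0 <= dl * N by rewrite mulr_ge0 // ltW.
rewrite (_ : dl ^+ 7 * N ^+ 7 = dl * N * (dl * N * (dl * N * (dl * N * (dl * N *
    (dl * N * (dl * N))))))); last by ring.
have us2 x y : XY B2 x y -> XY B1 us y by move=> [z /B2us].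
have gc x y : good_cell x y -> XY B1 us y by case=> /us2.
have key x y v w r r' : good_cell x y -> XY B2 r v -> XY B2 r' w -> ~ scarce_col y (v, w) ->
    dl * N <= #r[R] (all3 (XY B1) (y, v, w)).
  move=> /gc hy /us2 hv /us2 hw; rewrite leNgt => hs; apply/negP => lt; apply: hs.
  by split.
case: good1 good2 good3 => g1 _ g2 _ [g3' _ g4 _] [gga ggb ggc].
apply: (andp_ge kN); [by do ?[exact: kN|apply: (mulr_ge0 kN)]|by apply: key h1 h2 _; [exact: g1|tauto]|].
apply: (andp_ge kN); [by do ?[exact: kN|apply: (mulr_ge0 kN)]|by apply: key h1 h2 _; [exact: g2|tauto]|].
apply: (andp_ge kN); [by do ?[exact: kN|apply: (mulr_ge0 kN)]|by apply: key h1' h2' _; [exact: g3'|tauto]|].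
apply: (andp_ge kN); [by do ?[exact: kN|apply: (mulr_ge0 kN)]|by apply: key h1' h2' _; [exact: g4|tauto]|].
apply: (andp_ge kN); [by do ?[exact: kN|apply: (mulr_ge0 kN)]|by apply: key ha h1 _; [exact: gga|tauto]|].
apply: (andp_ge kN); [by do ?[exact: kN|apply: (mulr_ge0 kN)]|by apply: key hb h1 _; [exact: ggb|tauto]|].
by apply: key hc h1 _; [exact: ggc|tauto].
Qed.


Definition row_bad (r : X * X * X * X) (w : Y * Y * Y * Y) := exists q : Z * Z * Z * Z,
  [/\ B r.1.1.1 w.1.1.1 q.1.1.1, B r.1.1.2 w.1.1.2 q.1.1.2, B r.1.2 w.1.2 q.1.2 & B r.2 w.2 q.2] /\
  scarce (all4 (XZ B)) (dz * N) xs q.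

Definition col_bad (r : Y * Y * Y * Y) (w : X * X * X * X) := exists q : Z * Z * Z * Z,
  [/\ B w.1.1.1 r.1.1.1 q.1.1.1, B w.1.1.2 r.1.1.2 q.1.1.2, B w.1.2 r.1.2 q.1.2 & B w.2 r.2 q.2] /\
  scarce (all4 (YZ B)) (dz * N) ys q.

Definition row_rep (r : X * X * X * X) (w : Y * Y * Y * Y) (x0 : X) := exists q : Z * Z * Z * Z,
  [/\ B r.1.1.1 w.1.1.1 q.1.1.1, B r.1.1.2 w.1.1.2 q.1.1.2, B r.1.2 w.1.2 q.1.2 & B r.2 w.2 q.2] /\
  all4 (XZ B) q x0.

Definition col_rep (r : Y * Y * Y * Y) (w : X * X * X * X) (y0 : Y) := exists q : Z * Z * Z * Z,
  [/\ B w.1.1.1 r.1.1.1 q.1.1.1, B w.1.1.2 r.1.1.2 q.1.1.2, B w.1.2 r.1.2 q.1.2 & B w.2 r.2 q.2] /\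
  all4 (YZ B) q y0.

Let lB : linear3 B. Proof. exact: linear3S sBA lA. Qed.

Lemma row_bad_count r : #r[R] (row_bad r) <= gz * N ^+ 4.
Proof.
apply: le_trans few_rows; apply: (ler_cnt_rel (S := fun (w : Y * Y * Y * Y) q =>
  [/\ B r.1.1.1 w.1.1.1 q.1.1.1, B r.1.1.2 w.1.1.2 q.1.1.2, B r.1.2 w.1.2 q.1.2 & B r.2 w.2 q.2])).
  by move=> w [q [h1 h2]]; exists q.
move=> [[[w1 w2] w3] w4] [[[w1' w2'] w3'] w4'] q _ _ /= [h1 h2 h3 h4] [h1' h2' h3' h4'].
by rewrite (lin_y lB h1 h1') (lin_y lB h2 h2') (lin_y lB h3 h3') (lin_y lB h4 h4').
Qed.

Lemma col_bad_count r : #r[R] (col_bad r) <= gz * N ^+ 4.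
Proof.
apply: le_trans few_cols; apply: (ler_cnt_rel (S := fun (w : X * X * X * X) q =>
  [/\ B w.1.1.1 r.1.1.1 q.1.1.1, B w.1.1.2 r.1.1.2 q.1.1.2, B w.1.2 r.1.2 q.1.2 & B w.2 r.2 q.2])).
  by move=> w [q [h1 h2]]; exists q.
move=> [[[w1 w2] w3] w4] [[[w1' w2'] w3'] w4'] q _ _ /= [h1 h2 h3 h4] [h1' h2' h3' h4'].
by rewrite (lin_x lB h1 h1') (lin_x lB h2 h2') (lin_x lB h3 h3') (lin_x lB h4 h4').
Qed.

Lemma row_rep_count r w : XY B1 r.1.1.1 w.1.1.1 -> XY B1 r.1.1.2 w.1.1.2 ->
  XY B1 r.1.2 w.1.2 -> XY B1 r.2 w.2 -> ~ row_bad r w -> dz * N <= #r[R] (row_rep r w).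
Proof.
move=> [z1 h1] [z2 h2] [z3 h3] [z4 h4] nb.
apply: le_trans (_ : #r[R] (all4 (XZ B) (z1, z2, z3, z4)) <= _).
  rewrite leNgt; apply/negP => lt; apply: nb; exists (z1, z2, z3, z4); split.
    by split; exact: sB1.
  by split=> //; split; [exact: B1xs h1|exact: B1xs h2|exact: B1xs h3|exact: B1xs h4].
apply: ler_cnt => x hx; exists (z1, z2, z3, z4); split=> //.
by split; exact: sB1.
Qed.

Lemma col_rep_count r w : XY B1 w.1.1.1 r.1.1.1 -> XY B1 w.1.1.2 r.1.1.2 ->
  XY B1 w.1.2 r.1.2 -> XY B1 w.2 r.2 -> ~ col_bad r w -> dz * N <= #r[R] (col_rep r w).
Proof.
move=> [z1 h1] [z2 h2] [z3 h3] [z4 h4] nb.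
apply: le_trans (_ : #r[R] (all4 (YZ B) (z1, z2, z3, z4)) <= _).
  rewrite leNgt; apply/negP => lt; apply: nb; exists (z1, z2, z3, z4); split.
    by split; exact: sB1.
  by split=> //; split; [exact: B1ys h1|exact: B1ys h2|exact: B1ys h3|exact: B1ys h4].
apply: ler_cnt => x hx; exists (z1, z2, z3, z4); split=> //.
by split; exact: sB1.
Qed.

Notation "'tup' v1 v2 v1' v2' va vb vc u1 u2 u1' u2' ua ub uc" :=
  ((v1, (v2, (v1', (v2', (va, (vb, vc)))))), (u1, (u2, (u1', (u2', (ua, (ub, uc)))))))
  (at level 0, v1 at level 0, v2 at level 0, v1' at level 0, v2' at level 0, va at level 0,
   vb at level 0, vc at level 0, u1 at level 0, u2 at level 0, u1' at level 0,
   u2' at level 0, ua at level 0, ub at level 0, uc at level 0).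

(** The quadruples are the labels that must recur together: those beside the corners of column [v1],
    of [v1'] and of the centres for [a], [c] in [x01], those of [v2], [v2'] and the centre for [b]
    in [x02], and similarly for the columns [y01], [y02]. Where only three are called for, the label
    at (x1, v1) or (u1, y1) completes the quadruple. *)
Definition lbad (p : Y7 * X7) :=
  let: tup v1 v2 v1' v2' va vb vc u1 u2 u1' u2' ua ub uc := p in
  row_bad (x1, x3, xa, xc) (v1, v1', va, vc) \/ (row_bad (x2, x4, xb, x1) (v2, v2', vb, v1) \/
  (col_bad (y1, y3, ya, yb) (u1, u1', ua, ub) \/ col_bad (y2, y4, yc, y1) (u2, u2', uc, u1))).

Definition reps (p : Y7 * X7) : T4 -> Prop :=
  let: tup v1 v2 v1' v2' va vb vc u1 u2 u1' u2' ua ub uc := p in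
  andp (row_rep (x1, x3, xa, xc) (v1, v1', va, vc))
  (andp (row_rep (x2, x4, xb, x1) (v2, v2', vb, v1))
  (andp (col_rep (y1, y3, ya, yb) (u1, u1', ua, ub))
    (col_rep (y2, y4, yc, y1) (u2, u2', uc, u1)))).

Definition skel (p : Y7 * X7) := (vtuple p.1 /\ ~ vbad p.1) /\ utuple p.1 p.2.

Lemma lbad_count : #r[R] lbad <= 4 * gz * N ^+ 14.
Proof.
have -> : 4 * gz * N ^+ 14 = gz * N ^+ 14 + (gz * N ^+ 14 + (gz * N ^+ 14 + gz * N ^+ 14)) by ring.
have prx r (f : Y7 * X7 -> Y * Y * Y * Y) (h : Y7 * X7 -> Y * Y * Y * X7) :
    (forall v v', f v = f v' -> h v = h v' -> v = v') ->
    #r[R] (fun v => row_bad r (f v)) <= gz * N ^+ 14.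
  move=> inj; apply: le_trans (cnt_proj (row_bad_count r) inj) _.
  by rewrite !card_prod cX cY !natrM -/N; apply: le_of_eq; ring.
have pry r (f : Y7 * X7 -> X * X * X * X) (h : Y7 * X7 -> X * X * X * Y7) :
    (forall v v', f v = f v' -> h v = h v' -> v = v') ->
    #r[R] (fun v => col_bad r (f v)) <= gz * N ^+ 14.
  move=> inj; apply: le_trans (cnt_proj (col_bad_count r) inj) _.
  by rewrite !card_prod cX cY !natrM -/N; apply: le_of_eq; ring.
pose f1 (p : Y7 * X7) := let: tup v1 v2 v1' v2' va vb vc u1 u2 u1' u2' ua ub uc := p in
  (v1, v1', va, vc).
pose f2 (p : Y7 * X7) := let: tup v1 v2 v1' v2' va vb vc u1 u2 u1' u2' ua ub uc := p in
  (v2, v2', vb, v1).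
pose f3 (p : Y7 * X7) := let: tup v1 v2 v1' v2' va vb vc u1 u2 u1' u2' ua ub uc := p in
  (u1, u1', ua, ub).
pose f4 (p : Y7 * X7) := let: tup v1 v2 v1' v2' va vb vc u1 u2 u1' u2' ua ub uc := p in
  (u2, u2', uc, u1).
apply: le_trans (ler_cnt_or (Q := fun p => row_bad (x1, x3, xa, xc) (f1 p))
  (S := fun p => row_bad (x2, x4, xb, x1) (f2 p) \/ (col_bad (y1, y3, ya, yb) (f3 p) \/
   col_bad (y2, y4, yc, y1) (f4 p))) _) (lerD _ _).
- by move=> [[v1 [v2 [v1' [v2' [va [vb vc]]]]]] [u1 [u2 [u1' [u2' [ua [ub uc]]]]]]].
- apply: (prx _ _ (fun p => let: tup v1 v2 v1' v2' va vb vc u1 u2 u1' u2' ua ub uc := p in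
    (v2, v2', vb, p.2))).
  by rewrite /f1; tuple_inj.
apply: le_trans (ler_cnt_or (fun _ h => h)) (lerD _ _).
  apply: (prx _ _ (fun p => let: tup v1 v2 v1' v2' va vb vc u1 u2 u1' u2' ua ub uc := p in
    (v1', va, vc, p.2))).
  by rewrite /f2; tuple_inj.
apply: le_trans (ler_cnt_or (fun _ h => h)) (lerD _ _).
  apply: (pry _ _ (fun p => let: tup v1 v2 v1' v2' va vb vc u1 u2 u1' u2' ua ub uc := p in
    (u2, u2', uc, p.1))).
  by rewrite /f3; tuple_inj.
apply: (pry _ _ (fun p => let: tup v1 v2 v1' v2' va vb vc u1 u2 u1' u2' ua ub uc := p in
    (u1', ua, ub, p.1))).
by rewrite /f4; tuple_inj.
Qed.

Lemma reps_count p : skel p -> ~ lbad p -> dz ^+ 4 * N ^+ 4 <= #r[R] (reps p).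
Proof.
move: p => [[v1 [v2 [v1' [v2' [va [vb vc]]]]]] [u1 [u2 [u1' [u2' [ua [ub uc]]]]]]].
move=> [[[h1 [h2 [h1' [h2' [ha [hb hc]]]]]] _] [k1 [k2 [k1' [k2' [ka' [kb kc]]]]]]].
rewrite /lbad => nb; rewrite /= in h1 h2 h1' h2' ha hb hc k1 k2 k1' k2' ka' kb kc.
have B21 x y : XY B2 x y -> XY B1 x y by move=> [z /sB2]; exists z.
have kN : 0 <= dz * N by rewrite mulr_ge0 // ltW.
rewrite (_ : dz ^+ 4 * N ^+ 4 = dz * N * (dz * N * (dz * N * (dz * N)))); last by ring.
apply: (andp_ge kN); first by do ?[exact: kN|apply: (mulr_ge0 kN)].
  by apply: row_rep_count => /=; try exact: B21; tauto.
apply: (andp_ge kN); first by do ?[exact: kN|apply: (mulr_ge0 kN)].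
  by apply: row_rep_count => /=; try exact: B21; tauto.
case: k1 k2 k1' k2' ka' kb kc => q1 _ _ [q2 _ _] [q1' _ _] [q2' _ _] [qa _ _] [qb _ _] [qc _ _].
apply: (andp_ge kN) => //.
  by apply: col_rep_count => //=; tauto.
by apply: col_rep_count => //=; tauto.
Qed.

Lemma skeleton_count : ka ^+ 7 * dl ^+ 7 / 4 * dz ^+ 4 * N ^+ 18 <=
  #r[R] (fun t : (Y7 * X7) * T4 => (skel t.1 /\ ~ lbad t.1) /\ reps t.1 t.2).
Proof.
have c1 : ka ^+ 7 / 2 * N ^+ 7 <= #r[R] (fun v => vtuple v /\ ~ vbad v).
  have : #r[R] vtuple <= #r[R] (fun v => vtuple v /\ ~ vbad v) + #r[R] vbad.
    by apply: ler_cnt_or => v hv; have [|] := pselect (vbad v); [right|left].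
  have := vtuple_count; have := vbad_count.
  have : 14 * ga * N ^+ 7 <= ka ^+ 7 * N ^+ 7 by rewrite ler_pM2r ?exprn_gt0.
  lra.
have c2 : ka ^+ 7 * dl ^+ 7 / 2 * N ^+ 14 <= #r[R] skel.
  apply: le_trans (cnt_pair_ge (P := fun v => vtuple v /\ ~ vbad v) (Q := utuple)
    (k := dl ^+ 7 * N ^+ 7) _); last by move=> v [h1 h2]; exact: utuple_count.
  apply: le_trans (_ : ka ^+ 7 / 2 * N ^+ 7 * (dl ^+ 7 * N ^+ 7) <= _).
    by apply: le_of_eq; ring.
  by rewrite ler_pM2r // mulr_gt0 ?exprn_gt0.
have c3 : ka ^+ 7 * dl ^+ 7 / 4 * N ^+ 14 <= #r[R] (fun p => skel p /\ ~ lbad p).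
  have : #r[R] skel <= #r[R] (fun p => skel p /\ ~ lbad p) + #r[R] lbad.
    by apply: ler_cnt_or => v hv; have [|] := pselect (lbad v); [right|left].
  have := lbad_count; have : 16 * gz * N ^+ 14 <= ka ^+ 7 * dl ^+ 7 * N ^+ 14 by rewrite ler_pM2r ?exprn_gt0.
  lra.
apply: le_trans (cnt_pair_ge (P := fun p => skel p /\ ~ lbad p) (Q := reps)
  (k := dz ^+ 4 * N ^+ 4) _); last by move=> v [h1 h2]; exact: reps_count.
apply: le_trans (_ : ka ^+ 7 * dl ^+ 7 / 4 * N ^+ 14 * (dz ^+ 4 * N ^+ 4) <= _).
  by apply: le_of_eq; ring.
by rewrite ler_pM2r // mulr_gt0 ?exprn_gt0.
Qed.


Definition unpop_at x y (p : X * Y) := unpop n A etaP B (x, y, p.1, p.2).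

Notation T18 := ((Y7 * X7) * T4)%type.

(** The ten ways in which a relation of [conf] may fail: the corners at [d] and [d'], the two
    rectangles of opposite corners, and six links between a corner and a centre. *)
Definition tbad (t : T18) :=
  let: (tup v1 v2 v1' v2' va vb vc u1 u2 u1' u2' ua ub uc, (x01, (x02, (y01, y02)))) := t in
  unpop_at x2 y2 (u2, v2) \/ (unpop_at x4 y4 (u2', v2') \/ (
  unpop n A etaP B (u1, v1, u2, v2) \/ (unpop n A etaP B (u1', v1', u2', v2') \/ (
  bad_at (x1, y1) (xa, ya) (u1, v1, ua, va, x01, y01) \/ (bad_at (xa, ya) (x3, y3) (ua, va, u1', v1', x01, y01) \/ (
  bad_at (x2, y1) (xb, yb) (u1, v2, ub, vb, x02, y01) \/ (bad_at (xb, yb) (x4, y3) (ub, vb, u1', v2', x02, y01) \/ (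
  bad_at (x1, y2) (xc, yc) (u2, v1, uc, vc, x01, y02) \/ (bad_at (xc, yc) (x3, y4) (uc, vc, u2', v1', x01, y02)))))))))).

(** Each event depends on the coordinates selected by one of [f0] to [f9]; the others are free. The
    first two use [good_pop], the next two the global count of unpopular rectangles, the last six
    [few_bad]. *)
Lemma tbad_count : #r[R] tbad <= (2 * ge + 2 * g + 6 * g3) * N ^+ 18.
Proof.
have pr (C D : finType) (Q : C -> Prop) (f : T18 -> C) (h : T18 -> D) (l : R) m :
    #r[R] Q <= l * N ^+ m -> #|D|%:R * N ^+ m = N ^+ 18 ->
    (forall t t', f t = f t' -> h t = h t' -> t = t') ->
    #r[R] (fun t => Q (f t)) <= l * N ^+ 18.
  by move=> hQ hD inj; apply: le_trans (cnt_proj hQ inj) _; rewrite -hD -mulrA [N ^+ m * _]mulrC.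
have -> : (2 * ge + 2 * g + 6 * g3) * N ^+ 18 = ge * N ^+ 18 + (ge * N ^+ 18 + (g * N ^+ 18 + (g * N ^+ 18 + (g3 * N ^+ 18 + (g3 * N ^+ 18 + (g3 * N ^+ 18 + (g3 * N ^+ 18 + (g3 * N ^+ 18 + (g3 * N ^+ 18))))))))) by ring.
pose f0 (t : T18) := let: (tup v1 v2 v1' v2' va vb vc u1 u2 u1' u2' ua ub uc, (x01, (x02, (y01, y02)))) := t in
  (u2, v2).
pose f1 (t : T18) := let: (tup v1 v2 v1' v2' va vb vc u1 u2 u1' u2' ua ub uc, (x01, (x02, (y01, y02)))) := t in
  (u2', v2').
pose f2 (t : T18) := let: (tup v1 v2 v1' v2' va vb vc u1 u2 u1' u2' ua ub uc, (x01, (x02, (y01, y02)))) := t in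
  (u1, v1, u2, v2).
pose f3 (t : T18) := let: (tup v1 v2 v1' v2' va vb vc u1 u2 u1' u2' ua ub uc, (x01, (x02, (y01, y02)))) := t in
  (u1', v1', u2', v2').
pose f4 (t : T18) := let: (tup v1 v2 v1' v2' va vb vc u1 u2 u1' u2' ua ub uc, (x01, (x02, (y01, y02)))) := t in
  (u1, v1, ua, va, x01, y01).
pose f5 (t : T18) := let: (tup v1 v2 v1' v2' va vb vc u1 u2 u1' u2' ua ub uc, (x01, (x02, (y01, y02)))) := t in
  (ua, va, u1', v1', x01, y01).
pose f6 (t : T18) := let: (tup v1 v2 v1' v2' va vb vc u1 u2 u1' u2' ua ub uc, (x01, (x02, (y01, y02)))) := t in
  (u1, v2, ub, vb, x02, y01).
pose f7 (t : T18) := let: (tup v1 v2 v1' v2' va vb vc u1 u2 u1' u2' ua ub uc, (x01, (x02, (y01, y02)))) := t in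
  (ub, vb, u1', v2', x02, y01).
pose f8 (t : T18) := let: (tup v1 v2 v1' v2' va vb vc u1 u2 u1' u2' ua ub uc, (x01, (x02, (y01, y02)))) := t in
  (u2, v1, uc, vc, x01, y02).
pose f9 (t : T18) := let: (tup v1 v2 v1' v2' va vb vc u1 u2 u1' u2' ua ub uc, (x01, (x02, (y01, y02)))) := t in
  (uc, vc, u2', v1', x01, y02).
apply: le_trans (ler_cnt (Q := fun t =>
  unpop_at x2 y2 (f0 t) \/ (unpop_at x4 y4 (f1 t) \/ (
  unpop n A etaP B (f2 t) \/ (unpop n A etaP B (f3 t) \/ (
  bad_at (x1, y1) (xa, ya) (f4 t) \/ (bad_at (xa, ya) (x3, y3) (f5 t) \/ (
  bad_at (x2, y1) (xb, yb) (f6 t) \/ (bad_at (xb, yb) (x4, y3) (f7 t) \/ (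
  bad_at (x1, y2) (xc, yc) (f8 t) \/ (bad_at (xc, yc) (x3, y4) (f9 t))))))))))) _) _.
  move=> [[[v1 [v2 [v1' [v2' [va [vb vc]]]]]] [u1 [u2 [u1' [u2' [ua [ub uc]]]]]]] [x01 [x02 [y01 y02]]]].
  by [].
case: good1 good2 few_a few_b few_c => _ _ _ [_ _ _ q0] [_ _ _ [_ _ _ q1]] [q4 q5] [q6 q7] [q8 q9].
have q2 := few_unpop; have q3 := few_unpop.
apply: le_trans (ler_cnt_or (fun _ h => h)) (lerD _ _).
  apply: (pr _ _ _ f0 (fun t => let: (tup v1 v2 v1' v2' va vb vc u1 u2 u1' u2' ua ub uc, (x01, (x02, (y01, y02)))) := t in
    (u1, u1', u2', ua, ub, uc, x01, x02, v1, v1', v2', va, vb, vc, y01, y02)) _ _ q0).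
    by rewrite !card_prod cX cY !natrM -/N; ring.
  by rewrite /f0; tuple_inj.
apply: le_trans (ler_cnt_or (fun _ h => h)) (lerD _ _).
  apply: (pr _ _ _ f1 (fun t => let: (tup v1 v2 v1' v2' va vb vc u1 u2 u1' u2' ua ub uc, (x01, (x02, (y01, y02)))) := t in
    (u1, u2, u1', ua, ub, uc, x01, x02, v1, v2, v1', va, vb, vc, y01, y02)) _ _ q1).
    by rewrite !card_prod cX cY !natrM -/N; ring.
  by rewrite /f1; tuple_inj.
apply: le_trans (ler_cnt_or (fun _ h => h)) (lerD _ _).
  apply: (pr _ _ _ f2 (fun t => let: (tup v1 v2 v1' v2' va vb vc u1 u2 u1' u2' ua ub uc, (x01, (x02, (y01, y02)))) := t in
    (u1', u2', ua, ub, uc, x01, x02, v1', v2', va, vb, vc, y01, y02)) _ _ q2).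
    by rewrite !card_prod cX cY !natrM -/N; ring.
  by rewrite /f2; tuple_inj.
apply: le_trans (ler_cnt_or (fun _ h => h)) (lerD _ _).
  apply: (pr _ _ _ f3 (fun t => let: (tup v1 v2 v1' v2' va vb vc u1 u2 u1' u2' ua ub uc, (x01, (x02, (y01, y02)))) := t in
    (u1, u2, ua, ub, uc, x01, x02, v1, v2, va, vb, vc, y01, y02)) _ _ q3).
    by rewrite !card_prod cX cY !natrM -/N; ring.
  by rewrite /f3; tuple_inj.
apply: le_trans (ler_cnt_or (fun _ h => h)) (lerD _ _).
  apply: (pr _ _ _ f4 (fun t => let: (tup v1 v2 v1' v2' va vb vc u1 u2 u1' u2' ua ub uc, (x01, (x02, (y01, y02)))) := t in
    (u2, u1', u2', ub, uc, x02, v2, v1', v2', vb, vc, y02)) _ _ q4).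
    by rewrite !card_prod cX cY !natrM -/N; ring.
  by rewrite /f4; tuple_inj.
apply: le_trans (ler_cnt_or (fun _ h => h)) (lerD _ _).
  apply: (pr _ _ _ f5 (fun t => let: (tup v1 v2 v1' v2' va vb vc u1 u2 u1' u2' ua ub uc, (x01, (x02, (y01, y02)))) := t in
    (u1, u2, u2', ub, uc, x02, v1, v2, v2', vb, vc, y02)) _ _ q5).
    by rewrite !card_prod cX cY !natrM -/N; ring.
  by rewrite /f5; tuple_inj.
apply: le_trans (ler_cnt_or (fun _ h => h)) (lerD _ _).
  apply: (pr _ _ _ f6 (fun t => let: (tup v1 v2 v1' v2' va vb vc u1 u2 u1' u2' ua ub uc, (x01, (x02, (y01, y02)))) := t in
    (u2, u1', u2', ua, uc, x01, v1, v1', v2', va, vc, y02)) _ _ q6).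
    by rewrite !card_prod cX cY !natrM -/N; ring.
  by rewrite /f6; tuple_inj.
apply: le_trans (ler_cnt_or (fun _ h => h)) (lerD _ _).
  apply: (pr _ _ _ f7 (fun t => let: (tup v1 v2 v1' v2' va vb vc u1 u2 u1' u2' ua ub uc, (x01, (x02, (y01, y02)))) := t in
    (u1, u2, u2', ua, uc, x01, v1, v2, v1', va, vc, y02)) _ _ q7).
    by rewrite !card_prod cX cY !natrM -/N; ring.
  by rewrite /f7; tuple_inj.
apply: le_trans (ler_cnt_or (fun _ h => h)) (lerD _ _).
  apply: (pr _ _ _ f8 (fun t => let: (tup v1 v2 v1' v2' va vb vc u1 u2 u1' u2' ua ub uc, (x01, (x02, (y01, y02)))) := t in
    (u1, u1', u2', ua, ub, x02, v2, v1', v2', va, vb, y01)) _ _ q8).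
    by rewrite !card_prod cX cY !natrM -/N; ring.
  by rewrite /f8; tuple_inj.
apply: (pr _ _ _ f9 (fun t => let: (tup v1 v2 v1' v2' va vb vc u1 u2 u1' u2' ua ub uc, (x01, (x02, (y01, y02)))) := t in
    (u1, u2, u1', ua, ub, x02, v1, v2, v2', va, vb, y01)) _ _ q9).
  by rewrite !card_prod cX cY !natrM -/N; ring.
by rewrite /f9; tuple_inj.
Qed.

(* The 18 parameters in f determine the skeleton t, which gives a lower bound for [conf]. *)
Definition traces (t : T18) (f : F18 X Y Z) :=
  let: (tup v1 v2 v1' v2' va vb vc u1 u2 u1' u2' ua ub uc, (x01, (x02, (y01, y02)))) := t in
  let: (al2, be2, m11, m12, r02, c02, w2', s2', w1, w1', s1, s1', wa, sa, wb, sb, wc, sc) := f in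
  exists al1 al1' al2' ala alb alc be1 be1' be2' bea beb bec,
  [/\ x02 = r02, y02 = c02, B x2 v2 al2 & B u2 y2 be2] /\
  [/\ B x02 w2' al2', B x4 v2' al2', B s2' y02 be2' & B u2' y4 be2'] /\
  [/\ B u1 v2 m12, B u1 v1 m11, B x1 v1 al1 & B u1 y1 be1] /\
  [/\ B x01 w1 al1, B s1 y01 be1, B x01 w1' al1' & B x3 v1' al1'] /\
  [/\ B s1' y01 be1', B u1' y3 be1', B x01 wa ala & B xa va ala] /\
  [/\ B sa y01 bea, B ua ya bea, B x02 wb alb & B xb vb alb] /\
  [/\ B sb y01 beb, B ub yb beb, B x01 wc alc & B xc vc alc] /\
  (B sc y02 bec /\ B uc yc bec).

Lemma traces_inj t t' f : traces t f -> traces t' f -> t = t'.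
Proof.
clear cells cells' centres.
move: t => [[[v1 [v2 [v1' [v2' [va [vb vc]]]]]] [u1 [u2 [u1' [u2' [ua [ub uc]]]]]]] [x01 [x02 [y01 y02]]]].
move: t' => [[[q1 [q2 [q1' [q2' [qa [qb qc]]]]]] [p1 [p2 [p1' [p2' [pa [pb pc]]]]]]] [r01 [r02 [c01 c02]]]].
move: f => [[[[[[[[[[[[[[[[[al2 be2] m11] m12] k02] l02] w2'] s2'] w1] w1'] s1] s1'] wa] sa] wb] sb] wc] sc].
(* [al2] and [be2] give [v2] and [u2]; [m12] and [m11] give [u1] and [v1]. Then [w1] and [s1] place
   [x01] and [y01], and the remaining positions give the rest. *)
rewrite /traces => h h'; destr; subst; lin lB; by [].
Qed.

Lemma popP x y u v z al be m : ~ unpop n A etaP B (x, y, u, v) ->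
  rect B x y u v z al be m -> Pop n A etaP z al be m.
Proof. by move=> nu hr; apply: contrapT => nP; apply: nu; exists z, al, be, m. Qed.

Lemma H2P e f u v u' v' x0 y0 w w' s s' z al be m al' be' m' : ~ bad_at e f (u, v, u', v', x0, y0) ->
  sigma_pat B e.1 e.2 u v f.1 u' v' x0 y0 f.2 w w' s s' z al be m al' be' m' ->
  H2 n A etaP eta1 eta2 w w' s s' m m'.
Proof.
move=> nb hs; apply: contrapT => nH; apply: nb.
by exists f.2, w, w', s, s', z, al, be, m, al', be', m'.
Qed.

(** By [bad_small] at most half of the skeletons counted in [skeleton_count] fall in [tbad]; each of
    the others satisfies all relations of [conf], with parameters from which it is recovered. *)
Lemma conf_lower : ka ^+ 7 * dl ^+ 7 / 4 * dz ^+ 4 / 2 * N ^+ 18 <=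
  #r[R] (conf n A etaP eta1 eta2 d d').
Proof.
apply: le_trans (_ : #r[R] (fun t : T18 => ((skel t.1 /\ ~ lbad t.1) /\ reps t.1 t.2) /\ ~ tbad t) <= _).
  have : #r[R] (fun t : T18 => (skel t.1 /\ ~ lbad t.1) /\ reps t.1 t.2) <=
      #r[R] (fun t : T18 => ((skel t.1 /\ ~ lbad t.1) /\ reps t.1 t.2) /\ ~ tbad t) + #r[R] tbad.
    by apply: ler_cnt_or => t ht; have [|] := pselect (tbad t); [right|left].
  have := skeleton_count; have := tbad_count.
  have : (2 * ge + 2 * g + 6 * g3) * N ^+ 18 <= ka ^+ 7 * dl ^+ 7 / 4 * dz ^+ 4 / 2 * N ^+ 18.
    by rewrite ler_pM2r ?exprn_gt0.
  lra.
apply: (ler_cnt_rel (S := traces)); last by move=> t t' f _ _; exact: traces_inj.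
move=> [[[v1 [v2 [v1' [v2' [va [vb vc]]]]]] [u1 [u2 [u1' [u2' [ua [ub uc]]]]]]] [x01 [x02 [y01 y02]]]].
move=> [[[[_ hu] _] [r1 [r2 [c1 c2]]]] nb].
case: hu => -[_ [m11 /sB1 k11] [m12 /sB1 k12]] [[_ [m21 /sB1 k21] [m22 /sB1 k22]]].
case=> -[_ [m11' /sB1 k11'] [m12' /sB1 k12']] [[_ [m21' /sB1 k21'] [m22' /sB1 k22']]].
case=> -[_ [ma /sB1 kma] _] [[_ [mb /sB1 kmb] _] [_ [mc /sB1 kmc] _]].
move: r1 => [[[[al1 al1'] ala] alc] [[e1 e1' ea ec] [[w1 f1] [w1' f1'] [wa fa] [wc fc]]]].
move: r2 => [[[[al2 al2'] alb] al1x] [[e2 e2' eb e1x] [[w2 f2] [w2' f2'] [wb fb] _]]].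
move: c1 => [[[[be1 be1'] bea] beb] [[i1 i1' ia ib] [[s1 j1] [s1' j1'] [sa ja] [sb jb]]]].
move: c2 => [[[[be2 be2'] bec] be1x] [[i2 i2' ic _] [[s2 j2] [s2' j2'] [sc jc] _]]].
rewrite /= in k11 k12 k21 k22 k11' k12' k21' k22' kma kmb kmc e1 e1' ea ec f1 f1' fa fc
  e2 e2' eb f2 f2' fb i1 i1' ia ib j1 j1' ja jb i2 i2' ic j2 j2' jc.
rewrite /tbad in nb.
have [n0 [n1 [n2 [n3 [n4 [n5 [n6 [n7 [n8 n9]]]]]]]]] : ~ unpop_at x2 y2 (u2, v2) /\
  ~ unpop_at x4 y4 (u2', v2') /\ ~ unpop n A etaP B (u1, v1, u2, v2) /\
  ~ unpop n A etaP B (u1', v1', u2', v2') /\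
  ~ bad_at (x1, y1) (xa, ya) (u1, v1, ua, va, x01, y01) /\
  ~ bad_at (xa, ya) (x3, y3) (ua, va, u1', v1', x01, y01) /\
  ~ bad_at (x2, y1) (xb, yb) (u1, v2, ub, vb, x02, y01) /\
  ~ bad_at (xb, yb) (x4, y3) (ub, vb, u1', v2', x02, y01) /\
  ~ bad_at (x1, y2) (xc, yc) (u2, v1, uc, vc, x01, y02) /\
  ~ bad_at (xc, yc) (x3, y4) (uc, vc, u2', v1', x01, y02) by tauto.
move: cells cells' centres => [t1 t2 t3 t4] [t1' t2' t3' t4'] [ta tb tc].
exists (al2, be2, m11, m12, x02, y02, w2', s2', w1, w1', s1, s1', wa, sa, wb, sb, wc, sc); last first.
  by exists al1, al1', al2', ala, alb, alc, be1, be1', be2', bea, beb, bec.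
exists m22; first by apply: popP n0 _; chase.
exists m21; first by apply: popP n2 _; chase.
exists w2; first exact: sBA.
exists s2; first exact: sBA.
exists al2'; first exact: sBA.
exists be2'; first exact: sBA.
exists ma; first by apply: H2P n4 _; chase.
exists m11'; first by apply: H2P n5 _; chase.
exists mb; first by apply: H2P n6 _; chase.
exists m12'; first by apply: H2P n7 _; chase.
exists mc; first by apply: H2P n8 _; chase.
exists m21'; first by apply: H2P n9 _; chase.
exists m22'; first by apply: popP n3 _; chase.
by apply: popP n1 _; chase.
Qed.

End Skeleton.

(** * Mismatches, and pruning until each has many configurations *)

Definition mism (X Y Z : Type) (S : rel3 X Y Z) (z z' : Z) := z <> z' /\
  exists x1 x2 x3 x4 y1 y2 y3 y4 a b c,
    [/\ S x1 y1 a, S x2 y1 b, S x1 y2 c & S x2 y2 z] /\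
    [/\ S x3 y3 a, S x4 y3 b, S x3 y4 c & S x4 y4 z'].

Section Prune.
Variables (R : realType) (X Y Z : finType) (n : nat).
Hypotheses (cX : #|X| = n) (cY : #|Y| = n) (cZ : #|Z| = n) (n_gt0 : (0 < n)%N).
Variables (A B : rel3 X Y Z) (etaP eta1 eta2 : R).
Variables (b k1 k2 ka ga gk dl gz dz k3 ge g3 g : R).
Hypotheses (lA : linear3 A) (sBA : sub3 B A) (b0 : 0 < b) (g0 : 0 < g).
Hypotheses (k1E : k1 = b ^+ 3 / 2) (k2E : k2 = k1 ^+ 2 / 2) (kaE : ka = k2 / 8)
  (gaE : ga = ka ^+ 7 / 14) (gkE : gk = ga * k2 / 8) (dlE : dl = gk * k1 ^+ 2 / 2)
  (gzE : gz = ka ^+ 7 * dl ^+ 7 / 16) (dzE : dz = gz * b ^+ 3 / 4)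
  (k3E : k3 = ka ^+ 7 * dl ^+ 7 / 4 * dz ^+ 4) (geE : ge = k3 / 40) (g3E : g3 = k3 / 40).
Hypotheses (g_ge : g <= ge * k2 / 8) (g_g3 : g <= g3 * k2 ^+ 2 / 128) (g_k3 : g <= k3 / 40).
Let N : R := n%:R.
Hypothesis csB : b * N ^+ 2 <= (csize B)%:R.
Hypothesis few_unpop : #r[R] (unpop n A etaP B) <= g * N ^+ 4.
Hypothesis few_bad_r : #r[R] (bad_r n A etaP eta1 eta2 B) <= g * N ^+ 9.

Let N0 : 0 < N. Proof. by rewrite ltr0n. Qed.
Let lB : linear3 B. Proof. exact: linear3S sBA lA. Qed.
Let k10 : 0 < k1. Proof. by rewrite k1E divr_gt0 ?exprn_gt0. Qed.
Let k20 : 0 < k2. Proof. by rewrite k2E divr_gt0 ?exprn_gt0. Qed.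
Let ka0 : 0 < ka. Proof. by rewrite kaE divr_gt0. Qed.
Let ga0 : 0 < ga. Proof. by rewrite gaE divr_gt0 ?exprn_gt0. Qed.
Let gk0 : 0 < gk. Proof. by rewrite gkE divr_gt0 ?mulr_gt0. Qed.
Let dl0 : 0 < dl. Proof. by rewrite dlE divr_gt0 ?mulr_gt0 ?exprn_gt0. Qed.
Let gz0 : 0 < gz. Proof. by rewrite gzE divr_gt0 ?mulr_gt0 ?exprn_gt0. Qed.
Let dz0 : 0 < dz. Proof. by rewrite dzE divr_gt0 ?mulr_gt0 ?exprn_gt0. Qed.
Let k30 : 0 < k3.
Proof. by rewrite k3E mulr_gt0 ?exprn_gt0 // divr_gt0 ?mulr_gt0 ?exprn_gt0. Qed.
Let ge0 : 0 < ge. Proof. by rewrite geE divr_gt0. Qed.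
Let g30 : 0 < g3. Proof. by rewrite g3E divr_gt0. Qed.

Section GoodCells.
Variables (B1 B2 : rel3 X Y Z) (us : X).
Hypothesis few_triples : #r[R] (scarce (all3 (XY B1)) (dl * N) us) <= gk * N ^+ 3.
Hypothesis csB2 : k2 * N ^+ 2 <= (csize B2)%:R.

Notation good := (good_cell n A B B1 B2 etaP us ka ga dl ge).

Lemma low_row_count : #r[R] (fun p : X * Y => #r[R] (XY B2 p.1) < ka * N /\ XY B2 p.1 p.2)
  <= k2 / 8 * N ^+ 2.
Proof.
apply: le_trans (cnt_pair_le (P := fun x => #r[R] (XY B2 x) < ka * N) (Q := XY B2)
  (k := ka * N) (fun x h => ltW h)) _.
rewrite (_ : k2 / 8 * N ^+ 2 = N * (ka * N)); last by rewrite kaE; ring.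
apply: ler_wpM2r; first by rewrite mulr_ge0 // ltW.
by rewrite /N ler_nat -cX cnt_card.
Qed.

Lemma scarce_col_count : #r[R] (fun p : X * Y => ga * N ^+ 2 < #r[R] (scarce_col n B1 us dl p.2))
  <= k2 / 8 * N ^+ 2.
Proof.
have h : #r[R] (fun y => ga * N ^+ 2 <= #r[R] (scarce_col n B1 us dl y)) <= k2 / 8 * N.
  rewrite -(@ler_pM2r _ (ga * N ^+ 2)) ?mulr_gt0 ?exprn_gt0 //.
  apply: le_trans (cnt_markov _ _) _.
  apply: le_trans (_ : gk * N ^+ 3 <= _); last first.
    by rewrite gkE; apply: le_of_eq; ring.
  apply: le_trans few_triples; apply: (ler_cnt_rel (S := fun p q => q = (p.1, p.2.1, p.2.2))).
    by move=> [y [v v']] h; exists (y, v, v').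
  by move=> [y [v v']] [q [w w']] p _ _ -> [-> -> ->].
apply: le_trans (_ : k2 / 8 * N * #|X|%:R <= _); last first.
  by rewrite cX -/N; apply: le_of_eq; ring.
apply: le_trans (cnt_proj (f := snd) (g := fst) h _).
  by apply: ler_cnt => p /ltW.
by move=> [x y] [x' y'] /= -> ->.
Qed.

Lemma unpop_cell_count : #r[R] (fun p : X * Y => ge * N ^+ 2 <
    #r[R] (fun q : X * Y => unpop n A etaP B (p.1, p.2, q.1, q.2))) <= k2 / 8 * N ^+ 2.
Proof.
rewrite -(@ler_pM2r _ (ge * N ^+ 2)) ?mulr_gt0 ?exprn_gt0 //.
apply: le_trans (_ : #r[R] (fun p : X * Y => ge * N ^+ 2 <=
  #r[R] (fun q : X * Y => unpop n A etaP B (p.1, p.2, q.1, q.2))) * (ge * N ^+ 2) <= _).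
  by rewrite ler_pM2r ?mulr_gt0 ?exprn_gt0 //; apply: ler_cnt => p /ltW.
apply: le_trans (cnt_markov _ _) _.
apply: le_trans (_ : g * N ^+ 4 <= _); last first.
  rewrite (_ : k2 / 8 * N ^+ 2 * (ge * N ^+ 2) = ge * k2 / 8 * N ^+ 4); last by ring.
  by rewrite ler_pM2r ?exprn_gt0.
apply: le_trans few_unpop; apply: (ler_cnt_rel (S := fun p q => q = (p.1.1, p.1.2, p.2.1, p.2.2))).
  by move=> [[x y] [u v]] h; exists (x, y, u, v).
by move=> [[x y] [u v]] [[x' y'] [u' v']] p _ _ -> [-> -> -> ->].
Qed.

Lemma good_cell_count :
  5 * k2 / 8 * N ^+ 2 <= (csize (fun x y z => B2 x y z /\ good x y))%:R.
Proof.
pose P1 p := #r[R] (XY B2 p.1) < ka * N /\ XY B2 p.1 p.2.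
pose P2 (p : X * Y) := ga * N ^+ 2 < #r[R] (scarce_col n B1 us dl p.2).
pose P3 (p : X * Y) := ge * N ^+ 2 < #r[R] (fun q : X * Y => unpop n A etaP B (p.1, p.2, q.1, q.2)).
have : (csize B2)%:R <= (csize (fun x y z => B2 x y z /\ good x y))%:R + (#r[R] P1 + (#r[R] P2 + #r[R] P3)).
  apply: le_trans (ler_cnt_or (Q := fun p : X * Y => exists z, B2 p.1 p.2 z /\ good p.1 p.2)
    (S := fun p => P1 p \/ (P2 p \/ P3 p)) _) (lerD (lexx _) _).
    move=> [x y] [z /= h].
    have [p1|/negP p1] := pselect (#r[R] (XY B2 x) < ka * N).
      by right; left; split=> //; exists z.
    have [p2|/negP p2] := pselect (P2 (x, y)); first by right; right; left.
    have [p3|/negP p3] := pselect (P3 (x, y)); first by right; right; right.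
    left; exists z; split=> //; split; rewrite ?leNgt //; by exists z.
  exact: le_trans (ler_cnt_or (fun _ h => h)) (lerD (lexx _) (ler_cnt_or (fun _ h => h))).
have := low_row_count; have := scarce_col_count; have := unpop_cell_count.
rewrite -/P1 -/P2 -/P3; move: csB2; lra.
Qed.

End GoodCells.

(** A pair of cells with the same label is determined by the first cell and the row of the second.
    Each bad pair accounts for more than g3 n^6 of the at most g n^9 [bad_r] patterns. *)
Lemma bad_pair_count S : sub3 S B -> #r[R] (fun p : Z * ((X * Y) * (X * Y)) =>
    [/\ S p.2.1.1 p.2.1.2 p.1, S p.2.2.1 p.2.2.2 p.1
      & ~ few_bad n A B etaP eta1 eta2 g3 p.2.1 p.2.2]) <= g / g3 * N ^+ 3.
Proof.
move=> sSB.
pose Q (e : (X * Y) * X) (p : X * Y * X * Y * X * Y) := let: (u, v, u2, v2, x0, y0) := p in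
  bad_r n A etaP eta1 eta2 B (e.1.1, e.1.2, u, v, e.2, u2, v2, x0, y0).
apply: le_trans (_ : #r[R] (fun e => g3 * N ^+ 6 <= #r[R] (Q e)) <= _).
  apply: (ler_cnt_rel (S := fun p e => e = (p.2.1, p.2.2.1))).
    move=> [z [e [x y]]] /= [h1 h2 h3]; exists (e, x) => //.
    by move/negP: h3; rewrite /few_bad -ltNge => /ltW.
  move=> [z [[x y] [x' y']]] [z1 [[x1 y1] [x1' y1']]] p /= [h1 h2 _] [h3 h4 _] -> [? ? ?]; subst.
  have ez := lin_z lB (sSB _ _ _ h1) (sSB _ _ _ h3); subst.
  by rewrite (lin_y lB (sSB _ _ _ h2) (sSB _ _ _ h4)).
rewrite -(@ler_pM2r _ (g3 * N ^+ 6)) ?mulr_gt0 ?exprn_gt0 //.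
apply: le_trans (cnt_markov _ _) _.
rewrite (_ : g / g3 * N ^+ 3 * (g3 * N ^+ 6) = g * N ^+ 9); last by field; rewrite gt_eqF.
apply: le_trans few_bad_r; apply: (ler_cnt_rel (S := fun p t =>
  let: (e, (u, v, u2, v2, x0, y0)) := p in t = (e.1.1, e.1.2, u, v, e.2, u2, v2, x0, y0))).
  move=> [e [[[[[u v] u2] v2] x0] y0]] h.
  by exists (e.1.1, e.1.2, u, v, e.2, u2, v2, x0, y0).
move=> [[[x y] x2] [[[[[u v] u2] v2] x0] y0]] [[[x' y'] x2'] [[[[[u' v'] u2'] v2'] x0'] y0']] t _ _ /= ->.
by case=> -> -> -> -> -> -> -> -> ->.
Qed.

(** [S] consists of good cells that form a [few_bad] pair with the centre of their label in both
    orders, as cells of the first rectangle precede the centre and those of the second follow it.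
    The centres lie among the good cells too, so [conf_lower] applies to every mismatch. *)
Lemma prune : exists S, [/\ sub3 S B, 3 * k2 / 8 * N ^+ 2 <= (csize S)%:R &
  forall z z', mism S z z' -> k3 / 2 * N ^+ 18 <= #r[R] (conf n A etaP eta1 eta2 z z')].
Proof.
have [xs [ys [csB1 few_rows few_cols]]] := choose_labels cX cY cZ n_gt0 b0 gz0 lB csB.
set B1 := (X in (csize X)%:R) in csB1.
rewrite -dzE -k1E in csB1 few_rows few_cols.
have [us [csB2 few_triples]] := choose_cols cX cY n_gt0 k10 gk0 csB1.
set B2 := (X in (csize X)%:R) in csB2.
rewrite -dlE -k2E in csB2 few_triples.
pose B3 : rel3 X Y Z := fun x y z => B2 x y z /\ good_cell n A B B1 B2 etaP us ka ga dl ge x y.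
have csB3 : 5 * k2 / 8 * N ^+ 2 <= (csize B3)%:R by exact: good_cell_count.
have sB1 : sub3 B1 B by move=> x y z [].
have sB2 : sub3 B2 B1 by move=> x y z [].
have sB3 : sub3 B3 B by move=> x y z [/sB2/sB1].
have t0 : 0 < k2 / 8 by rewrite divr_gt0.
have [ctr hctr] := choose_centres cX cY cZ n_gt0
  (D := fun e f => ~ few_bad n A B etaP eta1 eta2 g3 e f) t0 (linear3S sB3 lB) (bad_pair_count sB3).
rewrite /= in hctr; set S := (X in _ <= (csize X)%:R) in hctr.
exists S; split.
- by move=> x y z [/sB3].
(* The 128 in [g_g3] is 2 * 8 * 8: good cells have density 5 k2 / 8, and small labels and bad
   partners may each cost k2 / 8. *)
- have q8 : 2 * (g / g3) / (k2 / 8) <= k2 / 8.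
    rewrite ler_pdivrMr // mulrA ler_pdivrMr //.
    by move: g_g3; lra.
  have : (k2 / 8 + 2 * (g / g3) / (k2 / 8)) * N ^+ 2 <= (k2 / 8 + k2 / 8) * N ^+ 2.
    by rewrite ler_pM2r ?exprn_gt0 // lerD2l.
  move: hctr csB3; rewrite -/N; lra.
move=> z z' [_ [x1 [x2 [x3 [x4 [y1 [y2 [y3 [y4 [a [b' [c [h h']]]]]]]]]]]]].
case: h => -[[q1 w1] ca /contrapT fa1 /contrapT fa1'] [[q2 w2] cb /contrapT fb1 /contrapT fb1']
  [[q3 w3] cc /contrapT fc1 /contrapT fc1'] [[q4 w4] _ _ _].
case: h' => -[[q1' w1'] _ /contrapT fa2 /contrapT fa2'] [[q2' w2'] _ /contrapT fb2 /contrapT fb2']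
  [[q3' w3'] _ /contrapT fc2 /contrapT fc2'] [[q4' w4'] _ _ _].
have B2B x y t : B2 x y t -> B x y t by move=> /sB2/sB1.
rewrite k3E.
have ga_s : 14 * ga <= ka ^+ 7 by rewrite gaE; lra.
have gz_s : 16 * gz <= ka ^+ 7 * dl ^+ 7 by rewrite gzE; lra.
have bad_s : 2 * ge + 2 * g + 6 * g3 <= ka ^+ 7 * dl ^+ 7 / 4 * dz ^+ 4 / 2.
  by rewrite -k3E geE g3E; move: g_k3 k30; lra.
have B1xs x y t : B1 x y t -> XZ B xs t by case.
have B1ys x y t : B1 x y t -> YZ B ys t by case.
have B2us x y t : B2 x y t -> XY B1 us y by case.
have [[ha ka'] [hb kb'] [hc kc']] := And3 ca cb cc.
apply: (conf_lower cX cY n_gt0 lA sBA sB1 sB2 B1xs B1ys B2us ka0 dl0 dz0 ga_s gz_s bad_s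
  few_rows few_cols few_unpop (x1 := x1) (x2 := x2) (x3 := x3) (x4 := x4)
  (y1 := y1) (y2 := y2) (y3 := y3) (y4 := y4)
  (xa := (ctr a).1) (ya := (ctr a).2) (xb := (ctr b').1) (yb := (ctr b').2)
  (xc := (ctr c).1) (yc := (ctr c).2) (a := a) (b := b') (c := c)).
- by split; exact: B2B.
- by split; exact: B2B.
- by split; exact: B2B.
- by split.
- by split.
- by split.
- by move: fa1 fa2'; case: (ctr a).
- by move: fb1 fb2'; case: (ctr b').
- by move: fc1 fc2'; case: (ctr c).
Qed.

End Prune.

(** [e'] is part of the conclusion because the reduction is repeated for the other coordinates. It
    comes from [pop_rich]: [S] inherits from [B] that few rectangles are unpopular. *)
Lemma bounded_mism (R : realType) (e : R) : 0 < e -> exists b e' C : R, [/\ 0 < b, 0 < e' &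
  forall (X Y Z : finType) (n : nat) (A : rel3 X Y Z),
  #|X| = n -> #|Y| = n -> #|Z| = n -> (0 < n)%N -> linear3 A ->
  e * n%:R ^+ 5 <= (octas A)%:R ->
  exists S, [/\ sub3 S A, b * n%:R ^+ 2 <= (csize S)%:R, e' * n%:R ^+ 5 <= (octas S)%:R &
    forall z, #r[R] (mism S z) <= C]].
Proof.
move=> e0; have [b b0 hb] := three_stages e0.
(* [k1], [k2] are the densities after [choose_labels] and [choose_cols], and [ka] is the row density
   of good cells. [ga], [gk] and [gz] are proportions of scarce tuples small enough to preserve most
   skeletons, [dl] and [dz] the resulting densities of common rows or columns, and [k3] the density
   of skeletons. *)
pose k1 := b ^+ 3 / 2; pose k2 := k1 ^+ 2 / 2; pose ka := k2 / 8; pose ga := ka ^+ 7 / 14.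
pose gk := ga * k2 / 8; pose dl := gk * k1 ^+ 2 / 2; pose gz := ka ^+ 7 * dl ^+ 7 / 16.
pose dz := gz * b ^+ 3 / 4; pose k3 := ka ^+ 7 * dl ^+ 7 / 4 * dz ^+ 4; pose g3 := k3 / 40.
have k10 : 0 < k1 by rewrite divr_gt0 ?exprn_gt0.
have k20 : 0 < k2 by rewrite divr_gt0 ?exprn_gt0.
have ka0 : 0 < ka by rewrite divr_gt0.
have ga0 : 0 < ga by rewrite divr_gt0 ?exprn_gt0.
have gk0 : 0 < gk by rewrite /gk divr_gt0 // mulr_gt0.
have dl0 : 0 < dl by rewrite /dl divr_gt0 // mulr_gt0 // exprn_gt0.
have gz0 : 0 < gz by rewrite /gz divr_gt0 // mulr_gt0 // exprn_gt0.
have dz0 : 0 < dz by rewrite /dz divr_gt0 // mulr_gt0 // exprn_gt0.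
have k30 : 0 < k3 by rewrite /k3 mulr_gt0 ?exprn_gt0 // divr_gt0 // mulr_gt0 // exprn_gt0.
have g30 : 0 < g3 by rewrite divr_gt0.
pose bb := 3 * k2 / 8.
have bb0 : 0 < bb by rewrite /bb divr_gt0 // mulr_gt0.
(* The first three bounds are required by [prune], the fourth by [pop_rich]. *)
pose g := Num.min (Num.min (g3 * k2 / 8) (g3 * k2 ^+ 2 / 128)) (Num.min (k3 / 40) (bb ^+ 4 / 2)).
have g0 : 0 < g.
  rewrite /g !lt_min; apply/andP; split; apply/andP; split; rewrite divr_gt0 //.
  - exact: mulr_gt0.
  - by rewrite mulr_gt0 // exprn_gt0.
  - exact: exprn_gt0.
have g_ge : g <= g3 * k2 / 8 by rewrite !ge_min lexx.
have g_g3 : g <= g3 * k2 ^+ 2 / 128 by rewrite !ge_min lexx ?orbT.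
have g_k3 : g <= k3 / 40 by rewrite !ge_min lexx ?orbT.
have g_bb : g <= bb ^+ 4 / 2 by rewrite !ge_min lexx ?orbT.
have [etaP [eta1 [eta2 [p0 p1 p2 hA]]]] := hb _ g0.
exists bb, (etaP * (bb ^+ 4 / 2) ^+ 2), (conf_const etaP eta1 eta2 / (k3 / 2)); split=> //.
  by rewrite mulr_gt0 ?exprn_gt0 // divr_gt0 ?exprn_gt0.
move=> X Y Z n A cX cY cZ n0 lA hO.
have [B [sBA csB fu fb]] := hA _ _ _ _ _ cX cY cZ n0 lA hO.
have [S [sSB csS hS]] := prune cX cY cZ n0 lA sBA b0 erefl erefl erefl erefl erefl
  erefl erefl erefl erefl erefl erefl g_ge g_g3 g_k3 csB fu fb.
exists S; split=> //.
- by move=> x y z /sSB/sBA.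
- apply: (pop_rich cX cY cZ n0 (T := A)) => //; first by move=> x y z /sSB/sBA.
  apply: le_trans (ler_cnt (fun t => unpop_sub sSB)) (le_trans fu _).
  by rewrite ler_pM2r // exprn_gt0 // ltr0n.
- move=> z; apply: (conf_degree cX cY cZ n0 lA p0 p1 p2); first by rewrite divr_gt0.
  by move=> z'; exact: hS.
Qed.

(** * Exchange of coordinates and colouring of the mismatch graphs *)

Definition swap_xz (X Y Z : Type) (T : rel3 X Y Z) : rel3 Z Y X := fun z y x => T x y z.
Definition swap_yz (X Y Z : Type) (T : rel3 X Y Z) : rel3 X Z Y := fun x z y => T x y z.

Lemma linear3_xz (X Y Z : Type) (T : rel3 X Y Z) : linear3 T -> linear3 (swap_xz T).
Proof.
move=> lT; rewrite /swap_xz; split=> [z y x x'|z x y y'|y x z z'].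
- exact: (lin_x lT).
- exact: (lin_y lT).
- exact: (lin_z lT).
Qed.

Lemma linear3_yz (X Y Z : Type) (T : rel3 X Y Z) : linear3 T -> linear3 (swap_yz T).
Proof.
move=> lT; rewrite /swap_yz; split=> [z y x x'|z x y y'|y x z z'].
- exact: (lin_y lT).
- exact: (lin_z lT).
- exact: (lin_x lT).
Qed.

(** With labels as rows, the same eight cells form an octahedron with rows a, b, c, d, columns y1,
    y3, y2, y4 and labels x1, x2, x3, x4. *)
Lemma octas_xz (X Y Z : finType) (T : rel3 X Y Z) : linear3 T ->
  (octas T <= octas (swap_xz T))%N.
Proof.
move=> lT; apply: (cnt_rel (R := fun (t : (X * Y) * (X * Y * X)) (s : (Z * Y) * (Z * Y * Z)) =>
  exists x3 y3 y4 a b c d, octa T t.1.1 t.2.1.1 x3 t.2.2 t.1.2 t.2.1.2 y3 y4 a b c d /\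
    s = ((a, t.1.2), (b, y3, d)))).
  move=> [[x1 y1] [[x2 y2] x4]] [a [x3 [y3 [y4 [b [c [d h]]]]]]].
  exists ((a, y1), (b, y3, d)); last by exists x3, y3, y4, a, b, c, d.
  exists x1, c, y2, y4, x2, x3, x4; move: h => [[h1 h2 h3 h4] [h5 h6 h7 h8]].
  by split; split.
move=> [[x1 y1] [[x2 y2] x4]] [[x1' y1'] [[x2' y2'] x4']] s _ _ /=.
move=> [x3 [y3 [y4 [a [b [c [d [h ->]]]]]]]] [x3' [y3' [y4' [a' [b' [c' [d' [h' [? ? ? ? ?]]]]]]]]].
by subst; rewrite /octa in h h'; destr; lin lT.
Qed.

(** With labels as columns, the rows are x1, x3, x2, x4, the columns a, c, b, d and the labels y1,
    y3, y2, y4. *)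
Lemma octas_yz (X Y Z : finType) (T : rel3 X Y Z) : linear3 T ->
  (octas T <= octas (swap_yz T))%N.
Proof.
move=> lT; apply: (cnt_rel (R := fun (t : (X * Y) * (X * Y * X)) (s : (X * Z) * (X * Z * X)) =>
  exists x3 y3 y4 a b c d, octa T t.1.1 t.2.1.1 x3 t.2.2 t.1.2 t.2.1.2 y3 y4 a b c d /\
    s = ((t.1.1, a), (x3, c, t.2.2)))).
  move=> [[x1 y1] [[x2 y2] x4]] [a [x3 [y3 [y4 [b [c [d h]]]]]]].
  exists ((x1, a), (x3, c, x4)); last by exists x3, y3, y4, a, b, c, d.
  exists y1, x2, b, d, y3, y2, y4; move: h => [[h1 h2 h3 h4] [h5 h6 h7 h8]].
  by split; split.
move=> [[x1 y1] [[x2 y2] x4]] [[x1' y1'] [[x2' y2'] x4']] s _ _ /=.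
move=> [x3 [y3 [y4 [a [b [c [d [h ->]]]]]]]] [x3' [y3' [y4' [a' [b' [c' [d' [h' [? ? ? ? ?]]]]]]]]].
by subst; rewrite /octa in h h'; destr; lin lT.
Qed.

Lemma mism_sym (X Y Z : Type) (S : rel3 X Y Z) z z' : mism S z z' -> mism S z' z.
Proof.
move=> [ne [x1 [x2 [x3 [x4 [y1 [y2 [y3 [y4 [a [b [c [h h']]]]]]]]]]]]].
by split; [move=> /esym|exists x3, x4, x1, x2, y3, y4, y1, y2, a, b, c].
Qed.

Lemma mism_sub (X Y Z : Type) (S T : rel3 X Y Z) z z' : sub3 S T -> mism S z z' -> mism T z z'.
Proof.
move=> sST [ne [x1 [x2 [x3 [x4 [y1 [y2 [y3 [y4 [a [b [c [h h']]]]]]]]]]]]].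
split=> //; exists x1, x2, x3, x4, y1, y2, y3, y4, a, b, c.
by case: h h' => ? ? ? ? [? ? ? ?]; split; split; exact: sST.
Qed.

Lemma greedy_colouring (V : finType) (E : V -> V -> Prop) (m : nat) :
  (forall u v, E u v -> E v u) -> (forall v, ~ E v v) -> (forall v, cnt (E v) < m)%N ->
  exists col : V -> 'I_m, forall u v, E u v -> col u <> col v.
Proof.
move=> symE irrE degE.
have [v0|V0] := pselect (exists v : V, True); last first.
  have {}V0 (v : V) : False by apply: V0; exists v.
  by exists (fun v => False_rect _ (V0 v)) => u; case: (V0 u).
have m0 : (0 < m)%N by case: v0 => v _; exact: leq_trans (degE v).
suff [col hcol] : exists col : V -> 'I_m, forall u v, u \in enum V -> v \in enum V ->
    E u v -> col u <> col v.
  by exists col => u v; apply: hcol; rewrite mem_enum.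
elim: (enum V) => [|w s [col IH]]; first by exists (fun _ => Ordinal m0).
(* The new vertex avoids the current colours of all its neighbours, treated or not; there are fewer
   than [m] of them. *)
have [k hk] : exists k : 'I_m, k \notin col @: [set v | `[< E w v >]].
  apply/existsP; rewrite -negb_forall; apply/negP => /forallP h.
  have := leq_imset_card col [set v | `[< E w v >]].
  rewrite leqNgt => /negP; apply; apply: leq_trans (degE w) _.
  apply: (@leq_trans #|'I_m|); first by rewrite card_ord.
  by apply/subset_leq_card/subsetP => k _; have := h k.
have fresh v : E w v -> col v <> k.
  move=> Ewv ek; move/negP: hk; apply; apply/imsetP; exists v => //.
  by rewrite inE; apply/asboolP.
exists (fun v => if v == w then k else col v) => u v; rewrite !inE.
case: (eqVneq u w) => [->|uw] /= hu; case: (eqVneq v w) => [->|vw] /= hv Euv.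
- by case: (irrE w).
- by move=> e; apply: (fresh v).
- by apply: fresh; apply: symE.
- exact: IH.
Qed.

Lemma mism_colouring (R : realType) (C : R) : exists m : nat, forall (X Y Z : finType) (S : rel3 X Y Z),
  (forall z, #r[R] (mism S z) <= C) ->
  exists col : Z -> 'I_m, forall z z', mism S z z' -> col z <> col z'.
Proof.
exists (Num.bound `|C|) => X Y Z S hS; apply: greedy_colouring.
- by move=> z z'; exact: mism_sym.
- by move=> z [].
- move=> z; rewrite -(ltr_nat R); apply: le_lt_trans (archi_boundP (normr_ge0 C)).
  exact: le_trans (hS z) (ler_norm C).
Qed.

(** * One reduction per coordinate, and the most popular colour class *)

Theorem theorem1p11 (R : realType) (eps : R) (eps_gt0 : 0 < eps) :
  exists alpha : R, 0 < alpha /\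
    forall (n : nat) (X Y Z : finType) (A : {set X * Y}) (phi : X -> Y -> Z),
      #|X| = n -> #|Y| = n -> #|Z| = n ->
      partial_latin_square A phi ->
      eps * n%:R ^+ 5 <= #|octahedra A phi|%:R ->
      exists B : {set X * Y},
        [/\ B \subset A,
            alpha * n%:R ^+ 2 <= #|B|%:R
          & quadrangle_condition B phi].
Proof.
have [b1 [e1 [C1 [b10 e10 step1]]]] := bounded_mism eps_gt0.
have [b2 [e2 [C2 [b20 e20 step2]]]] := bounded_mism e10.
have [b3 [e3 [C3 [b30 e30 step3]]]] := bounded_mism e20.
have [m1 hm1] := mism_colouring C1; have [m2 hm2] := mism_colouring C2.
have [m3 hm3] := mism_colouring C3.
(* The successor makes the denominator positive without any information on the numbers of
   colours. *)
exists (b3 / (m1 * m2 * m3).+1%:R); split; first by rewrite divr_gt0.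
move=> n X Y Z A phi cX cY cZ [pls1 pls2] hO.
have [n0|n0] := posnP n.
  exists set0; rewrite sub0set n0 expr2 !mulr0 ler0n; split=> //.
  split=> -[x1 [x2 [x3 [x4 [y1 [y2 [y3 [y4]]]]]]]].
  - by case=> -[]; rewrite inE.
  - by case=> y5 [_ []]; rewrite inE.
  - by case=> y5 [_ []]; rewrite inE.
pose T : rel3 X Y Z := fun x y z => (x, y) \in A /\ phi x y = z.
have lT : linear3 T.
  split=> [x y z z' [_ <-] [_ <-] //|x z y y' [h1 <-] [h2 /esym]|y z x x' [h1 <-] [h2 /esym]].
    exact: pls1.
  exact: pls2.
have hT : eps * n%:R ^+ 5 <= (octas T)%:R.
  apply: le_trans hO _; rewrite ler_nat.
  apply: leq_trans (_ : cnt (fun t => is_octahedron A phi t) <= _)%N.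
    by apply/subset_leq_card/subsetP => t; rewrite !inE => h; apply/asboolP.
  apply: (cnt_rel (R := fun t s => let: (x1, x2, y1, y2, x3, x4, y3, y4) := t in
    s = ((x1, y1), (x2, y2, x4)))).
    move=> [[[[[[[x1 x2] y1] y2] x3] x4] y3] y4] /=.
    case/and5P=> /and4P [h1 h2 h3 h4] /and4P [h5 h6 h7 h8] /eqP q1 /eqP q2 /andP [/eqP q3 /eqP q4].
    exists ((x1, y1), (x2, y2, x4)) => //.
    by exists (phi x1 y1), x3, y3, y4, (phi x2 y1), (phi x1 y2), (phi x2 y2).
  move=> [[[[[[[x1 x2] y1] y2] x3] x4] y3] y4] [[[[[[[x1' x2'] y1'] y2'] x3'] x4'] y3'] y4'] s /=.
  case/and5P=> /and4P [h1 h2 h3 h4] /and4P [h5 h6 h7 h8] /eqP q1 /eqP q2 /andP [/eqP q3 /eqP q4].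
  case/and5P=> /and4P [h1' h2' h3' h4'] /and4P [h5' h6' h7' h8'] /eqP q1' /eqP q2' /andP [/eqP q3' /eqP q4'].
  move=> -> [? ? ? ? ?]; subst.
  have ey3 : y3 = y3' by apply: (pls1 x4') => //; rewrite -q2 -q2'.
  have ey4 : y4 = y4' by apply: (pls1 x4') => //; rewrite -q4 -q4'.
  subst; suff -> : x3 = x3' by [].
  by apply: (pls2 _ _ y3') => //; rewrite -q1 -q1'.
have grow (e : R) p q : e * n%:R ^+ 5 <= p%:R -> (p <= q)%N -> e * n%:R ^+ 5 <= q%:R.
  by move=> h pq; apply: le_trans h _; rewrite ler_nat.
have lT' := linear3_xz lT.
(* With rows and labels exchanged, this bounds mismatches between rows; the next two reductions
   treat columns and labels. Later subsystems keep the earlier bounds, since a mismatch in a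
   subsystem is one in the system. *)
have [S1 [sS1 _ oS1 dS1]] := step1 _ _ _ _ _ cZ cY cX n0 lT' (grow _ _ _ hT (octas_xz lT)).
have lS1 := linear3S sS1 lT'; have lU1 := linear3_xz lS1; have lU1' := linear3_yz lU1.
have oU1 := grow _ _ _ (grow _ _ _ oS1 (octas_xz lS1)) (octas_yz lU1).
have [S2 [sS2 _ oS2 dS2]] := step2 _ _ _ _ _ cX cZ cY n0 lU1' oU1.
have lS2 := linear3S sS2 lU1'; have lU2 := linear3_yz lS2.
have [S [sS cS _ dS]] := step3 _ _ _ _ _ cX cY cZ n0 lU2 (grow _ _ _ oS2 (octas_yz lS2)).
have sST : sub3 S T by move=> x y z /sS /sS2 /sS1.
have [f1 hf1] := hm1 _ _ _ _ dS1; have [f2 hf2] := hm2 _ _ _ _ dS2.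
have [f3 hf3] := hm3 _ _ _ _ dS.
(* Within a class all rows share a colour, and so do all columns and all labels. *)
pose class (k : 'I_m1 * 'I_m2 * 'I_m3) (p : X * Y) :=
  S p.1 p.2 (phi p.1 p.2) /\ (f1 p.1, f2 p.2, f3 (phi p.1 p.2)) = k.
have m0 : (0 < m1 * m2 * m3)%N.
  have /card_gt0P [x _] : (0 < #|X|)%N by rewrite cX.
  have /card_gt0P [y _] : (0 < #|Y|)%N by rewrite cY.
  have l1 := leq_ltn_trans (leq0n _) (ltn_ord (f1 x)).
  have l2 := leq_ltn_trans (leq0n _) (ltn_ord (f2 y)).
  have l3 := leq_ltn_trans (leq0n _) (ltn_ord (f3 (phi x y))).
  by rewrite !muln_gt0 l1 l2 l3.
have [k hk] : exists k, b3 / (m1 * m2 * m3).+1%:R * n%:R ^+ 2 <= #r[R] (class k).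
  apply: average_ge; first by rewrite !card_prod !card_ord.
  apply: (@le_trans _ _ (csize S)%:R); last first.
    rewrite -natr_sum -cnt_pair.
    apply: (ler_cnt_rel (S := fun p q => q.2 = p)) => [[x y] [z /= h]|p p' q _ _ <- <- //].
    have [_ ez] := sST _ _ _ h.
    by exists ((f1 x, f2 y, f3 (phi x y)), (x, y)) => //; split=> //=; rewrite ez.
  apply: le_trans cS; rewrite !card_prod !card_ord.
  rewrite mulrAC ler_wpM2r ?exprn_ge0 // mulrAC -mulrA ler_piMr ?(ltW b30) //.
  by rewrite ler_pdivrMr ?ltr0n // mul1r ler_nat.
exists [set p | `[< class k p >]]; split=> //.
  by apply/subsetP => -[x y]; rewrite inE => /asboolP [/sST []].
have inB x y : ((x, y) \in [set p | `[< class k p >]]) -> class k (x, y).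
  by rewrite inE => /asboolP.
split.
- move=> [x1 [x2 [x3 [x4 [y1 [y2 [y3 [y4 [h h' [q1 q2 q3] ne]]]]]]]]].
  case: h h' => /inB [h1 _] /inB [h2 _] /inB [h3 _] /inB [h4 c4].
  case=> /inB [h1' _] /inB [h2' _] /inB [h3' _] /inB [h4' c4'].
  rewrite /= in h1 h2 h3 h4 h1' h2' h3' h4' c4 c4'.
  apply: (hf3 (phi x2 y2) (phi x4 y4)); last by move: c4; rewrite -c4' => -[].
  split=> //; exists x1, x2, x3, x4, y1, y2, y3, y4, (phi x1 y1), (phi x2 y1), (phi x1 y2).
  by split; split=> //; rewrite ?q1 ?q2 ?q3.
- move=> [x1 [x2 [x3 [x4 [x5 [y1 [y2 [y3 [y4 [ne h h' [q1 q2 q3 q4]]]]]]]]]]].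
  case: h h' => /inB [h1 _] /inB [h2 _] /inB [h3 _] /inB [h4 _].
  case=> /inB [h1' _] /inB [h2' c4] /inB [h3' _] /inB [h4' c4'].
  rewrite /= in h1 h2 h3 h4 h1' h2' h3' h4' c4 c4'.
  (* [x4] and [x5] are rows of cells of the class, so their colours agree; a violation makes them
     mismatched in [S1]. *)
  apply: (hf1 x4 x5); last by move: c4; rewrite -c4' => -[].
  have sub : sub3 (swap_xz S) S1 by move=> z y x /sS /sS2.
  apply: (mism_sub sub); split; first by move=> /esym.
  exists (phi x1 y1), (phi x2 y1), (phi x1 y2), (phi x2 y2), y1, y3, y2, y4, x1, x2, x3.
  by rewrite /swap_xz; split; split=> //; rewrite ?q1 ?q2 ?q3 ?q4.
- move=> [x1 [x2 [x3 [x4 [y1 [y2 [y3 [y4 [y5 [ne h h' [q1 q2 q3 q4]]]]]]]]]]].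
  case: h h' => /inB [h1 _] /inB [h2 _] /inB [h3 _] /inB [h4 _].
  case=> /inB [h1' _] /inB [h2' _] /inB [h3' c4] /inB [h4' c4'].
  rewrite /= in h1 h2 h3 h4 h1' h2' h3' h4' c4 c4'.
  (* [y4] and [y5] likewise share a colour, yet would be mismatched in [S2]. *)
  apply: (hf2 y4 y5); last by move: c4; rewrite -c4' => -[].
  have sub : sub3 (swap_yz S) S2 by move=> z y x /sS.
  apply: (mism_sub sub); split; first by move=> /esym.
  exists x1, x3, x2, x4, (phi x1 y1), (phi x1 y2), (phi x2 y1), (phi x2 y2), y1, y3, y2.
  by rewrite /swap_yz; split; split=> //; rewrite ?q1 ?q2 ?q3 ?q4.
Qed.
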